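(* Let $H=\sum_X\Phi_X$ with self-adjoint $\Phi_X\in\mathcal A_X$, $\Phi_X=0$ if $\mathrm{diam}(X)>R$, $\|\Phi_X\|\le m$, and $[\Phi_X,Q_Y]=0$ whenever $X\subset Y$. Suppose $H$ has a non-degenerate eigenvalue $0$ with unit eigenvector $\Omega$ and $\mathrm{Spec}(H)\subset\{0\}\cup[g,\infty)$, with $R,m,g>0$ independent of $L$. Define the current across $\partial_-$ by $$J_-:=\mathrm{i}\sum_{X:\ X\cap\{x:|x_1|\le R\}\neq\emptyset}[\Phi_X,Q],$$ so that $\mathrm{i}[H,Q]=J_-+J_+$ with $J_+$ the analogous sum over $X$ meeting $\{x:|x_1-L/2|\le R\}$ (for $L>8R$). Then $$\langle\Omega,J_-\Omega\rangle=\mathcal O(L^{-\infty}).$$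
   Context: $\Lambda=\Lambda_L=\mathbb Z_L^d$, $L$ even, $\mathbb Z_L$ identified with $\{-L/2+1,\dots,L/2\}$ (so $x_1$ is taken mod $L$); $\mathrm{diam}$ is the diameter in graph distance. Local algebras $\mathcal A_X$: spins (operators $O_X\otimes 1_{\Lambda\setminus X}$ on $\bigotimes_x\mathbb C^n$) or fermions (even elements of the algebra generated by CAR operators $c_{x,\sigma},c^*_{x,\sigma}$, $x\in X$). Charges: self-adjoint $Q_x\in\mathcal A_{\{x\}}$ with integer spectrum, $Q_Y=\sum_{x\in Y}Q_x$, $Q=Q_\Gamma$ with $\Gamma=\{0\le x_1<L/2\}$. All objects are sequences indexed by $L$; $\mathcal O(L^{-\infty})$ means bounded by $C_kL^{-k}$ for every $k$, with $C_k$ independent of $L$.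
   Formalization: The formal theorem adds that the on-site charges satisfy ‖Q_x‖ ≤ q with q independent of L (without it, rescaling Q_x by large integers depending on L breaks the claim), and it does not state the explanatory identity i[H,Q] = J_- + J_+. *)

(* Defs.v *)
From Stdlib Require Import Reals ZArith.
From HB Require Import structures.
From mathcomp Require Import all_boot.
Delimit Scope R_scope with coqR.
Set Implicit Arguments. Unset Strict Implicit. Unset Printing Implicit Defensive.

Record Cplx := mkC { Cre : R; Cim : R }.
Definition C0 : Cplx := mkC 0%coqR 0%coqR.
Definition C1 : Cplx := mkC 1%coqR 0%coqR.
Definition Ci : Cplx := mkC 0%coqR 1%coqR.
Definition RtoC (r : R) : Cplx := mkC r 0%coqR.
Definition Cadd (a b : Cplx) : Cplx := mkC (Cre a + Cre b)%coqR (Cim a + Cim b)%coqR.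
Definition Copp (a : Cplx) : Cplx := mkC (- Cre a)%coqR (- Cim a)%coqR.
Definition Cmul (a b : Cplx) : Cplx :=
  mkC (Cre a * Cre b - Cim a * Cim b)%coqR (Cre a * Cim b + Cim a * Cre b)%coqR.
Definition Cconj (a : Cplx) : Cplx := mkC (Cre a) (- Cim a)%coqR.
Definition Cmod (a : Cplx) : R := sqrt (Cre a ^ 2 + Cim a ^ 2)%coqR.

Section Ops.
Variable B : finType.
Definition Vec := B -> Cplx.
Definition Op := B -> B -> Cplx.
Definition app (A : Op) (v : Vec) : Vec :=
  fun b => \big[Cadd/C0]_(b' : B) Cmul (A b b') (v b').
Definition opmul (A A' : Op) : Op :=
  fun b b'' => \big[Cadd/C0]_(b' : B) Cmul (A b b') (A' b' b'').
Definition opadd (A A' : Op) : Op := fun b b' => Cadd (A b b') (A' b b').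
Definition opscale (a : Cplx) (A : Op) : Op := fun b b' => Cmul a (A b b').
Definition opsub (A A' : Op) : Op := opadd A (opscale (Copp C1) A').
Definition comm (A A' : Op) : Op := opsub (opmul A A') (opmul A' A).
Definition opzero : Op := fun _ _ => C0.
Definition opid : Op := fun b b' => if b == b' then C1 else C0.
Definition adj (A : Op) : Op := fun b b' => Cconj (A b' b).
Definition selfadj (A : Op) : Prop := forall b b', A b b' = adj A b b'.
Definition opsum (I : finType) (P : pred I) (F : I -> Op) : Op :=
  fun b b' => \big[Cadd/C0]_(i | P i) F i b b'.
Definition inner (u v : Vec) : Cplx :=
  \big[Cadd/C0]_(b : B) Cmul (Cconj (u b)) (v b).
Definition norm2 (v : Vec) : R := Cre (inner v v).
(* ||A|| <= m  (for m >= 0), written out *)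
Definition opnorm_le (A : Op) (m : R) : Prop :=
  forall v : Vec, (norm2 (app A v) <= m ^ 2 * norm2 v)%coqR.
Definition eigenvalue (A : Op) (l : Cplx) : Prop :=
  exists v : Vec, (exists b, v b <> C0) /\ forall b, app A v b = Cmul l (v b).
End Ops.

(* The torus Lambda_L = Z_L^d.  A coordinate in Z_L is stored as its
   representative c in {0,...,L-1}; the identification with
   {-L/2+1,...,L/2} is c |-> c if c <= L/2, c - L otherwise.           *)
Notation site d L := {ffun 'I_d -> 'I_L}.

Definition cdist (L : nat) (a b : 'I_L) : nat :=
  let k := if a <= b then b - a else a - b in minn k (L - k).
(* graph distance of the nearest-neighbour torus graph *)
Definition dist d L (x y : site d L) : nat := \sum_(i < d) cdist (x i) (y i).
Definition diam d L (X : {set site d L}) : nat :=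
  \max_(x in X) \max_(y in X) dist x y.

(* |x_1| for the signed representative (x_1 is coordinate number 0) *)
Definition absx1 (d L : nat) (hd : 0 < d) (x : site d L) : nat :=
  let c := nat_of_ord (x (Ordinal hd)) in if c <= L./2 then c else L - c.
Definition Gamma (d L : nat) (hd : 0 < d) : {set site d L} :=
  [set x : site d L | nat_of_ord (x (Ordinal hd)) < L./2].
Definition stripm (d L : nat) (hd : 0 < d) (Rr : R) : {set site d L} :=
  [set x : site d L | if Rle_dec (INR (absx1 hd x)) Rr then true else false].

(* Quantum spins: basis = configurations Lambda -> {0..n-1};
   A_X = { O_X (x) 1_{Lambda \ X} }.                                   *)
Notation sconf d L n := {ffun site d L -> 'I_n}.
Definition srest d L n (X : {set site d L}) (b : sconf d L n)
  : {ffun site d L -> option 'I_n} :=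
  [ffun y => if y \in X then Some (b y) else None].
Definition spin_local d L n (X : {set site d L}) (O : Op (sconf d L n)) : Prop :=
  exists OX : {ffun site d L -> option 'I_n} -> {ffun site d L -> option 'I_n} -> Cplx,
    forall b b', O b b' = if srest (~: X) b == srest (~: X) b'
                          then OX (srest X b) (srest X b') else C0.

(* Fermions: modes (x, sigma), sigma in {0..n-1}; Fock space basis =
   occupation functions; c_{x,sigma} via Jordan-Wigner w.r.t. the
   enumeration order of the modes.  A_X = even elements of the algebra
   generated by c_{x,sigma}, c*_{x,sigma}, x in X.                      *)
Notation fconf d L n := {ffun (site d L * 'I_n)%type -> bool}.
Definition fsign d L n (b : fconf d L n) (j : (site d L * 'I_n)%type) : Cplx :=
  if odd #|[set j' | (enum_rank j' < enum_rank j)%N && b j']| then Copp C1 else C1.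
Definition fflip d L n (b : fconf d L n) (j : (site d L * 'I_n)%type) : fconf d L n :=
  [ffun j' => if j' == j then ~~ b j' else b j'].
Definition annih d L n (j : (site d L * 'I_n)%type) : Op (fconf d L n) :=
  fun b b' => if b' j && (b == fflip b' j) then fsign b' j else C0.
Definition parity d L n : Op (fconf d L n) :=
  fun b b' => if b == b' then (if odd #|[set j | b j]| then Copp C1 else C1) else C0.
Inductive fgen d L n (X : {set site d L}) : Op (fconf d L n) -> Prop :=
  | fg_c j : j.1 \in X -> fgen X (annih j)
  | fg_cs j : j.1 \in X -> fgen X (adj (annih j))
  | fg_one : fgen X (@opid _)
  | fg_add A A' : fgen X A -> fgen X A' -> fgen X (opadd A A')
  | fg_mul A A' : fgen X A -> fgen X A' -> fgen X (opmul A A')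
  | fg_scale a A : fgen X A -> fgen X (opscale a A).
Definition ferm_local d L n (X : {set site d L}) (O : Op (fconf d L n)) : Prop :=
  fgen X O /\ forall b b', opmul (@parity d L n) (opmul O (@parity d L n)) b b' = O b b'.

Definition Conf (fermionic : bool) d L n : finType :=
  if fermionic then (fconf d L n : finType) else (sconf d L n : finType).
Definition local (fermionic : bool) d L n :
  {set site d L} -> Op (Conf fermionic d L n) -> Prop :=
  match fermionic as f return {set site d L} -> Op (Conf f d L n) -> Prop with
  | true => @ferm_local d L n
  | false => @spin_local d L n
  end.

Definition hamiltonian (B : finType) (Xs : finType) (Phi : Xs -> Op B) : Op B :=
  opsum (fun _ => true) Phi.
Definition chargeY (B : finType) d L (Qx : site d L -> Op B) (Y : {set site d L}) : Op B :=
  opsum (fun x => x \in Y) Qx.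
Definition Jminus (B : finType) d L (hd : 0 < d) (Rr : R)
  (Phi : {set site d L} -> Op B) (Qx : site d L -> Op B) : Op B :=
  opscale Ci (opsum (fun X : {set site d L} => X :&: stripm L hd Rr != set0)
                    (fun X => comm (Phi X) (chargeY Qx (Gamma L hd)))).

(* Main.v *)
From Stdlib Require Import Reals ZArith.
From HB Require Import structures.
From mathcomp Require Import all_boot all_order all_algebra.
From mathcomp Require Import Rstruct.
From mathcomp Require Import boolp classical_sets functions reals topology normedtype derive realfun sequences exp trigo.
From mathcomp Require Import complex.
From mathcomp Require Import ring lra zify.
Require Import Defs.
Set Implicit Arguments. Unset Strict Implicit. Unset Printing Implicit Defensive.
Import Order.TTheory GRing.Theory Num.Theory.
Import numFieldNormedType.Exports.

(** A lower bound on the energy of two trial states pins the current from both sides.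

Write [H = H1 + H0 + H2], where [H1] ([H2]) collects the terms near the cut [x_1 = 0]
([x_1 = L/2]) and [H0] the rest, and split the charge of the half torus as [Q = Q1 + Q2]
accordingly, so that [i[H, Q] = J1 + J2] with [Ji = i[Hi, Qi]].  Averaging [e^{iuH} Q e^{-iuH}]
over suitable times [u <= T] damps all spectral components of [Q Omega] above the gap, hence
turns [Omega] into an approximate eigenvector of the averaged charge.  By the Lieb-Robinson
bound the averaged charge is, up to an exponentially small error for [T] a small multiple of
[L], the sum [Qb1 + Qb2] of the averages of [Qi] under the dynamics of [Hi] alone, and these
two commute.

The state [e^{2 pi i Qb1} Omega] has nonnegative energy.  Since [e^{2 pi i Q2} = 1], that
energy is also obtained by integrating along the flow of [Q2 + Qb1] over [[0, 2 pi]]; its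
derivative is the expectation of [i[H1, Qb1]] up to small errors, and is unchanged if the flow
is replaced by that of [Qb2 + Qb1], which fixes [Omega] approximately.  Hence the energy is
[2 pi <J1>] up to a small error, and [<J1>] is bounded below.  The same holds for [J2], and
[<J1> + <J2> = 0]. *)

(** [Q2] enters, although the trial state involves only [Qb1], because the bulk [H0] conserves [Q]
    but in general neither half of it. [Q2 + Qb1] differs from [Q] by [K1 = Q1 - Qb1], an average of
    integrated currents that sits near its cut and hence far from [H0]. So the bulk energy hardly
    changes along the flow of [Q2 + Qb1], and integrality returns that flow at time [2 pi] to the
    one of [Qb1]. The terms [H2], which need not conserve [Q2], are left out of the energy that is
    followed: they commute with [Qb1], so their energy is the same at both ends. Finally
    [<i[H1, Qb1]>] is close to [<J1>] because [i[H, K1]] has mean zero in an eigenstate.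

    Averages run over finitely many times, so the spectral filter is a finite product of factors
    [(1 + e^{itl}) / 2]. It reaches the error [2^-N] in total time proportional to [N], however high
    the spectrum extends. Integrals are avoided throughout: a bound on a derivative is turned into a
    bound on an increment by the mean value theorem. With [N] proportional to [L], all errors are
    exponentially small up to powers of the volume. *)

Local Open Scope ring_scope.

(** * Operator norms of complex matrices *)

Notation "A ^H" := (map_mx Num.conj (trmx A)) (at level 8, format "A ^H") : ring_scope.

Section ComplexParts.
Variable R : realType.
Local Notation C := R[i].
Local Notation Re := (@complex.Re R).
Local Notation Im := (@complex.Im R).

Lemma cReD (x y : C) : Re (x + y) = Re x + Re y.
Proof. by case: x; case: y. Qed.
Lemma cImD (x y : C) : Im (x + y) = Im x + Im y.
Proof. by case: x; case: y. Qed.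
Lemma cReN (x : C) : Re (- x) = - Re x.
Proof. by case: x. Qed.
Lemma cReM (x y : C) : Re (x * y) = Re x * Re y - Im x * Im y.
Proof. by case: x; case: y. Qed.
Lemma cImM (x y : C) : Im (x * y) = Re x * Im y + Im x * Re y.
Proof. by case: x; case: y. Qed.
Lemma cRe_conj (x : C) : Re (Num.conj x) = Re x.
Proof. by case: x. Qed.
Lemma cIm_conj (x : C) : Im (Num.conj x) = - Im x.
Proof. by case: x. Qed.
Lemma cRe_sum (I : Type) (r : seq I) (P : pred I) (F : I -> C) :
  Re (\sum_(i <- r | P i) F i) = \sum_(i <- r | P i) Re (F i).
Proof. exact: (big_morph _ cReD). Qed.
Lemma complex_eqP (x y : C) : Re x = Re y -> Im x = Im y -> x = y.
Proof. by case: x; case: y => a b c d /= -> ->. Qed.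

End ComplexParts.

Section Adjoint.
Variable C : numClosedFieldType.

Lemma adjmxK m n (A : 'M[C]_(m, n)) : A^H^H = A.
Proof. by apply/matrixP=> i j; rewrite !mxE conjCK. Qed.
Lemma adjmxM m n p (A : 'M[C]_(m, n)) (B : 'M_(n, p)) : (A *m B)^H = B^H *m A^H.
Proof. by rewrite trmx_mul map_mxM. Qed.
Lemma adjmxD m n (A B : 'M[C]_(m, n)) : (A + B)^H = A^H + B^H.
Proof. by rewrite linearD map_mxD. Qed.
Lemma adjmxN m n (A : 'M[C]_(m, n)) : (- A)^H = - A^H.
Proof. by rewrite linearN map_mxN. Qed.
Lemma adjmxB m n (A B : 'M[C]_(m, n)) : (A - B)^H = A^H - B^H.
Proof. by rewrite adjmxD adjmxN. Qed.
Lemma adjmxZ m n a (A : 'M[C]_(m, n)) : (a *: A)^H = a^* *: A^H.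
Proof. by rewrite linearZ /= map_mxZ. Qed.
Lemma adjmx_sum m n (I : Type) (r : seq I) (P : pred I) (F : I -> 'M[C]_(m, n)) :
  (\sum_(i <- r | P i) F i)^H = \sum_(i <- r | P i) (F i)^H.
Proof.
apply: (big_morph (fun A : 'M[C]_(m, n) => A^H)); first exact: adjmxD.
by rewrite trmx0 map_mx0.
Qed.
Lemma adjmx1 n : (1%:M : 'M[C]_n)^H = 1%:M.
Proof. by rewrite trmx1 map_mx1. Qed.

End Adjoint.

HB.lock Definition cmt (R : realType) n (A B : 'M[R[i]]_n) : 'M[R[i]]_n := A *m B - B *m A.

Section Norms.
Variable R : realType.
Local Notation C := R[i].
Local Notation Re := (@complex.Re R).
Local Notation Im := (@complex.Im R).

(** Taking the real part turns [C^n] into a real Euclidean space with the same norm: the form is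
    symmetric, and expectations of Hermitian operators lose nothing. *)
Definition ip n (u v : 'cV[C]_n) : R := Re ((u^H *m v) 0 0).
Definition nrm n (u : 'cV[C]_n) : R := Num.sqrt (ip u u).

Lemma ipE n (u v : 'cV[C]_n) :
  ip u v = \sum_i (Re (u i 0) * Re (v i 0) + Im (u i 0) * Im (v i 0)).
Proof.
rewrite /ip mxE cRe_sum; apply: eq_bigr => i _.
by rewrite !mxE cReM cRe_conj cIm_conj; ring.
Qed.

Lemma ipC n (u v : 'cV[C]_n) : ip u v = ip v u.
Proof. by rewrite !ipE; apply: eq_bigr => i _; ring. Qed.
Lemma ipDr n (u v w : 'cV[C]_n) : ip u (v + w) = ip u v + ip u w.
Proof. by rewrite /ip mulmxDr mxE cReD. Qed.
Lemma ipNr n (u v : 'cV[C]_n) : ip u (- v) = - ip u v.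
Proof. by rewrite /ip mulmxN mxE cReN. Qed.
Lemma ipDl n (u v w : 'cV[C]_n) : ip (v + w) u = ip v u + ip w u.
Proof. by rewrite ipC ipDr !(ipC u). Qed.
Lemma ipNl n (u v : 'cV[C]_n) : ip (- v) u = - ip v u.
Proof. by rewrite ipC ipNr ipC. Qed.
Lemma ipBr n (u v w : 'cV[C]_n) : ip u (v - w) = ip u v - ip u w.
Proof. by rewrite ipDr ipNr. Qed.
Lemma ip0r n (u : 'cV[C]_n) : ip u 0 = 0.
Proof. by rewrite /ip mulmx0 mxE. Qed.
Lemma ipZr n (u v : 'cV[C]_n) (a : R) : ip u (a%:C%C *: v) = a * ip u v.
Proof. by rewrite /ip -scalemxAr mxE cReM /= mul0r subr0. Qed.
Lemma ipZl n (u v : 'cV[C]_n) (a : R) : ip (a%:C%C *: v) u = a * ip v u.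
Proof. by rewrite ipC ipZr ipC. Qed.
Lemma ipBl n (u v w : 'cV[C]_n) : ip (v - w) u = ip v u - ip w u.
Proof. by rewrite ipDl ipNl. Qed.
Lemma ip_ge0 n (u : 'cV[C]_n) : 0 <= ip u u.
Proof. by rewrite ipE; apply: sumr_ge0 => i _; nra. Qed.
Lemma ip_adj m n (A : 'M[C]_(m, n)) (u : 'cV_m) v : ip u (A *m v) = ip (A^H *m u) v.
Proof. by rewrite /ip adjmxM adjmxK mulmxA. Qed.

Lemma nrm_ge0 n (u : 'cV[C]_n) : 0 <= nrm u. Proof. exact: sqrtr_ge0. Qed.
Lemma nrm_sqr n (u : 'cV[C]_n) : nrm u ^+ 2 = ip u u.
Proof. by rewrite sqr_sqrtr // ip_ge0. Qed.
Lemma nrmN n (u : 'cV[C]_n) : nrm (- u) = nrm u.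
Proof. by rewrite /nrm ipNr ipNl opprK. Qed.
Lemma nrm0 n : nrm (0 : 'cV[C]_n) = 0.
Proof. by rewrite /nrm ip0r sqrtr0. Qed.

Lemma ip_le n (u v : 'cV[C]_n) : ip u v <= nrm u * nrm v.
Proof.
(* Expansion of the square of [y u - x v]. Taking the two norms for [x] and [y] settles the
   nondegenerate case; when exactly one norm vanishes, the parameters chosen below make the
   expansion equal to [- (2 * ip u v) ^+ 2]. *)
have H (x y : R) : 0 <= y ^+ 2 * nrm u ^+ 2 - 2 * (x * y) * ip u v + x ^+ 2 * nrm v ^+ 2.
  apply: le_trans (ip_ge0 (y%:C%C *: u - x%:C%C *: v)) _.
  rewrite !nrm_sqr !ipBr !ipZr !ipBl !ipZl (ipC v u).
  move: (ip u u) (ip u v) (ip v v) => a b c.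
  by rewrite le_eqVlt; apply/orP; left; apply/eqP; ring.
have := H (nrm u) (nrm v); have := nrm_ge0 u; have := nrm_ge0 v.
case: (ltgtP 0 (nrm v)) => // [v0|v0] _; case: (ltgtP 0 (nrm u)) => // [u0|u0] _.
- move=> h; have uv : 0 < 2 * (nrm u * nrm v) by rewrite !mulr_gt0.
  rewrite -subr_ge0 -(pmulr_rge0 _ uv); apply: le_trans h _.
  by rewrite le_eqVlt; apply/orP; left; apply/eqP; ring.
- rewrite -u0 mul0r => _; rewrite leNgt; apply/negP => p.
  have := H (2 * ip u v) (nrm v ^+ 2 + 1); rewrite -u0.
  suff -> : (nrm v ^+ 2 + 1) ^+ 2 * 0 ^+ 2 - 2 * (2 * ip u v * (nrm v ^+ 2 + 1)) * ip u v
    + (2 * ip u v) ^+ 2 * nrm v ^+ 2 = - (2 * ip u v) ^+ 2 by rewrite oppr_ge0 leNgt exprn_gt0 ?mulr_gt0.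
  by ring.
- rewrite -v0 mulr0 => _; rewrite leNgt; apply/negP => p.
  have := H (nrm u ^+ 2 + 1) (2 * ip u v); rewrite -v0.
  suff -> : (2 * ip u v) ^+ 2 * nrm u ^+ 2 - 2 * ((nrm u ^+ 2 + 1) * (2 * ip u v)) * ip u v
    + (nrm u ^+ 2 + 1) ^+ 2 * 0 ^+ 2 = - (2 * ip u v) ^+ 2 by rewrite oppr_ge0 leNgt exprn_gt0 ?mulr_gt0.
  by ring.
- rewrite -v0 mulr0 => _; rewrite leNgt; apply/negP => p.
  have := H 1 1; rewrite -v0 -u0; lra.
Qed.

Lemma nrmD n (u v : 'cV[C]_n) : nrm (u + v) <= nrm u + nrm v.
Proof.
rewrite -(ler_pXn2r (_ : 0 < 2)%N) ?nnegrE ?addr_ge0 ?nrm_ge0 //.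
rewrite nrm_sqr ipDr !ipDl sqrrD !nrm_sqr (ipC v u) -mulr_natl.
move: (ip_le u v); move: (ip u v) (nrm u * nrm v) (ip u u) (ip v v) => a b c d; lra.
Qed.

Lemma nrm_iso m n (U : 'M[C]_(m, n)) v : U^H *m U = 1%:M -> nrm (U *m v) = nrm v.
Proof. by move=> h; rewrite /nrm ip_adj mulmxA h mul1mx. Qed.

Variant bnd m n (A : 'M[C]_(m, n)) (e : R) : Prop :=
  Bnd of forall v, nrm (A *m v) <= e * nrm v.

Lemma bndE m n (A : 'M[C]_(m, n)) e v : bnd A e -> nrm (A *m v) <= e * nrm v.
Proof. by case. Qed.

(** Testing against [u = A *m v] recovers the norm. The scalar form is what the mean value theorem
    can be applied to, and it makes the passage to adjoints immediate. *)
Lemma bndP m n (A : 'M[C]_(m, n)) (e : R) : 0 <= e ->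
  bnd A e <-> forall u v, ip u (A *m v) <= e * (nrm u * nrm v).
Proof.
move=> e0; split=> [[h] u v|h]; last split=> v.
  apply: le_trans (ip_le _ _) _; rewrite mulrCA ler_wpM2l ?nrm_ge0 //; exact: h.
have := h (A *m v) v; rewrite -nrm_sqr.
have := nrm_ge0 (A *m v); have := nrm_ge0 v.
case: (ltgtP 0 (nrm (A *m v))) => // [p|<-] v0 _; last by rewrite mulr_ge0.
by rewrite expr2 mulrCA ler_pM2l.
Qed.

Lemma bndW m n (A : 'M[C]_(m, n)) e e' : bnd A e -> e <= e' -> bnd A e'.
Proof. move=> [h] le; split=> v; apply: le_trans (h v) _; by rewrite ler_wpM2r ?nrm_ge0. Qed.
Lemma bnd0 m n e : 0 <= e -> bnd (0 : 'M[C]_(m, n)) e.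
Proof. by move=> e0; split=> v; rewrite mul0mx nrm0 mulr_ge0 ?nrm_ge0. Qed.
Lemma bndD m n (A B : 'M[C]_(m, n)) a b : bnd A a -> bnd B b -> bnd (A + B) (a + b).
Proof.
move=> [hA] [hB]; split=> v; rewrite mulmxDl mulrDl; apply: le_trans (nrmD _ _) _; exact: lerD.
Qed.
Lemma bndN m n (A : 'M[C]_(m, n)) a : bnd A a -> bnd (- A) a.
Proof. by move=> [hA]; split=> v; rewrite mulNmx nrmN. Qed.
Lemma bndB m n (A B : 'M[C]_(m, n)) a b : bnd A a -> bnd B b -> bnd (A - B) (a + b).
Proof. by move=> hA hB; apply: bndD => //; apply: bndN. Qed.
Lemma bndM m n p (A : 'M[C]_(m, n)) (B : 'M_(n, p)) a b : 0 <= a ->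
  bnd A a -> bnd B b -> bnd (A *m B) (a * b).
Proof.
move=> a0 [hA] [hB]; split=> v; rewrite -mulmxA; apply: le_trans (hA _) _.
by rewrite -mulrA ler_wpM2l.
Qed.
Lemma nrmZ n (a : C) (v : 'cV[C]_n) : nrm (a *: v) = Num.sqrt (Re a ^+ 2 + Im a ^+ 2) * nrm v.
Proof.
rewrite /nrm -sqrtrM ?addr_ge0 ?sqr_ge0 //; congr (Num.sqrt _).
rewrite !ipE mulr_sumr; apply: eq_bigr => i _; rewrite !mxE cReM cImM; ring.
Qed.
Lemma bndZ m n (a : C) (A : 'M[C]_(m, n)) e : bnd A e ->
  bnd (a *: A) (Num.sqrt (Re a ^+ 2 + Im a ^+ 2) * e).
Proof.
by move=> [h]; split=> v; rewrite -scalemxAl nrmZ -mulrA ler_wpM2l ?sqrtr_ge0.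
Qed.
Lemma bndi m n (A : 'M[C]_(m, n)) e : bnd A e -> bnd ('i%C *: A) e.
Proof. by move/(bndZ 'i%C); rewrite /= expr0n add0r expr1n sqrtr1 mul1r. Qed.
Lemma bndr m n (a : R) (A : 'M[C]_(m, n)) e : bnd A e -> bnd (a%:C%C *: A) (`|a| * e).
Proof. by move/(bndZ a%:C%C); rewrite /= expr0n addr0 sqrtr_sqr. Qed.
Lemma bnd_sum m n (I : Type) (r : seq I) (P : pred I) (F : I -> 'M[C]_(m, n)) (e : I -> R) :
  (forall i, P i -> bnd (F i) (e i)) ->
  bnd (\sum_(i <- r | P i) F i) (\sum_(i <- r | P i) e i).
Proof.
move=> h; elim/big_rec2: _ => [|i y1 y2 Pi hy]; first exact: bnd0.
exact: bndD (h _ Pi) hy.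
Qed.
Lemma bnd_iso m n (U : 'M[C]_(m, n)) : U^H *m U = 1%:M -> bnd U 1.
Proof. by move=> h; split=> v; rewrite nrm_iso // mul1r. Qed.
Lemma bnd_adj m n (A : 'M[C]_(m, n)) e : 0 <= e -> bnd A e -> bnd A^H e.
Proof.
move=> e0 /(bndP _ e0) h; apply/(bndP _ e0) => u v.
by rewrite ip_adj adjmxK ipC (mulrC (nrm u)).
Qed.

Lemma cmtE n (A B : 'M[C]_n) : cmt A B = A *m B - B *m A.
Proof. by rewrite cmt.unlock. Qed.

Lemma bnd_cmt n (A B : 'M[C]_n) a b : 0 <= a -> 0 <= b ->
  bnd A a -> bnd B b -> bnd (cmt A B) (2 * a * b).
Proof.
move=> a0 b0 hA hB; rewrite !cmtE; have -> : 2 * a * b = a * b + b * a by ring.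
by apply: bndB; apply: bndM.
Qed.

Lemma bnd_conj n (U A : 'M[C]_n) e : 0 <= e -> U^H *m U = 1%:M -> U *m U^H = 1%:M ->
  bnd A e -> bnd (U *m A *m U^H) e.
Proof.
move=> e0 h h' hA; rewrite -(mulr1 e); apply: bndM => //.
  by rewrite -(mul1r e); apply: bndM => //; apply: bnd_iso.
by apply: bnd_iso; rewrite adjmxK.
Qed.

Lemma cmtDl n (A B D : 'M[C]_n) : cmt (A + B) D = cmt A D + cmt B D.
Proof. by rewrite !cmtE mulmxDl mulmxDr opprD addrACA. Qed.
Lemma cmtDr n (A B D : 'M[C]_n) : cmt D (A + B) = cmt D A + cmt D B.
Proof. by rewrite !cmtE mulmxDl mulmxDr opprD addrACA. Qed.
Lemma cmtNl n (A B : 'M[C]_n) : cmt (- A) B = - cmt A B.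
Proof. by rewrite !cmtE mulNmx mulmxN opprB opprK addrC. Qed.
Lemma cmtNr n (A B : 'M[C]_n) : cmt A (- B) = - cmt A B.
Proof. by rewrite !cmtE mulNmx mulmxN opprB opprK addrC. Qed.
Lemma cmtBr n (A B D : 'M[C]_n) : cmt D (A - B) = cmt D A - cmt D B.
Proof. by rewrite cmtDr cmtNr. Qed.
Lemma cmtZr n a (A B : 'M[C]_n) : cmt A (a *: B) = a *: cmt A B.
Proof. by rewrite !cmtE -scalemxAl -scalemxAr scalerBr. Qed.
Lemma cmtC n (A B : 'M[C]_n) : cmt A B = - cmt B A.
Proof. by rewrite !cmtE opprB. Qed.
Lemma cmt0l n (A : 'M[C]_n) : cmt 0 A = 0.
Proof. by rewrite !cmtE mulmx0 mul0mx subrr. Qed.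
Lemma cmt0r n (A : 'M[C]_n) : cmt A 0 = 0.
Proof. by rewrite !cmtE mulmx0 mul0mx subrr. Qed.
Lemma cmt_suml n (I : Type) (r : seq I) (P : pred I) (F : I -> 'M[C]_n) A :
  cmt (\sum_(i <- r | P i) F i) A = \sum_(i <- r | P i) cmt (F i) A.
Proof. by apply: (big_morph (fun X => cmt X A)) => [X Y|]; rewrite ?cmtDl ?cmt0l. Qed.
Lemma cmt_sumr n (I : Type) (r : seq I) (P : pred I) (F : I -> 'M[C]_n) A :
  cmt A (\sum_(i <- r | P i) F i) = \sum_(i <- r | P i) cmt A (F i).
Proof. by apply: (big_morph (fun X => cmt A X)) => [X Y|]; rewrite ?cmtDr ?cmt0r. Qed.
Lemma cmtMr n (A B D : 'M[C]_n) : cmt A (B *m D) = cmt A B *m D + B *m cmt A D.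
Proof. by rewrite !cmtE mulmxBl mulmxBr !mulmxA addrA subrK. Qed.
Lemma jacobi n (A B D : 'M[C]_n) : cmt A (cmt B D) = cmt (cmt A B) D + cmt B (cmt A D).
Proof.
have -> : cmt B D = B *m D - D *m B by rewrite !cmtE.
rewrite cmtBr !cmtMr opprD (addrC (- (cmt A D *m B))) addrACA.
by rewrite (cmtE (cmt A B)) (cmtE B (cmt A D)).
Qed.
Lemma cmt_adj n (A B : 'M[C]_n) : (cmt A B)^H = - cmt A^H B^H.
Proof. by rewrite !cmtE adjmxB !adjmxM opprB. Qed.

End Norms.

(** * Derivatives of matrix-valued functions *)

Section MatrixCalculus.
Variable R : realType.
Local Notation C := R[i].
Local Notation Re := (@complex.Re R).
Local Notation Im := (@complex.Im R).

Definition cder (f : R -> C) (d : C) (t : R) :=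
  is_derive t (1 : R) (fun s => Re (f s)) (Re d) /\
  is_derive t (1 : R) (fun s => Im (f s)) (Im d).

Lemma cder_cst (a : C) t : cder (fun=> a) 0 t.
Proof. by split; apply: is_derive_cst. Qed.

Lemma cderD f g d e t : cder f d t -> cder g e t -> cder (fun s => f s + g s) (d + e) t.
Proof.
move=> [f1 f2] [g1 g2]; split.
  rewrite (_ : (fun s => _) = (fun s => Re (f s)) + (fun s => Re (g s))); last by apply/funext=> s; rewrite cReD.
  by rewrite cReD; apply: is_deriveD.
rewrite (_ : (fun s => _) = (fun s => Im (f s)) + (fun s => Im (g s))); last by apply/funext=> s; rewrite cImD.
by rewrite cImD; apply: is_deriveD.
Qed.

Lemma cderM f g d e t : cder f d t -> cder g e t ->
  cder (fun s => f s * g s) (d * g t + f t * e) t.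
Proof.
move=> [f1 f2] [g1 g2]; split.
  rewrite (_ : (fun s => _) = (fun s => Re (f s)) * (fun s => Re (g s)) - (fun s => Im (f s)) * (fun s => Im (g s)));
    last by apply/funext=> s; rewrite cReM.
  apply: is_derive_eq (is_deriveB (is_deriveM f1 g1) (is_deriveM f2 g2)) _; rewrite cReD !cReM /GRing.scale /=.
  by move: (Re (f t)) (Re (g t)) (Im (f t)) (Im (g t)) => *; ring.
rewrite (_ : (fun s => _) = (fun s => Re (f s)) * (fun s => Im (g s)) + (fun s => Im (f s)) * (fun s => Re (g s)));
  last by apply/funext=> s; rewrite cImM.
apply: is_derive_eq (is_deriveD (is_deriveM f1 g2) (is_deriveM f2 g1)) _; rewrite cImD !cImM /GRing.scale /=.
by move: (Re (f t)) (Re (g t)) (Im (f t)) (Im (g t)) => *; ring.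
Qed.

Lemma cder_sum (I : Type) (r : seq I) (P : pred I) (f : I -> R -> C) d t :
  (forall i, P i -> cder (f i) (d i) t) ->
  cder (fun s => \sum_(i <- r | P i) f i s) (\sum_(i <- r | P i) d i) t.
Proof.
move=> h; elim: r => [|a r IH].
  rewrite big_nil (_ : (fun s => _) = fun=> 0); first exact: cder_cst.
  by apply/funext=> s; rewrite big_nil.
rewrite big_cons (_ : (fun s => _) = fun s => (if P a then f a s + \sum_(j <- r | P j) f j s else \sum_(j <- r | P j) f j s)); last by apply/funext=> s; rewrite big_cons.
by case: ifP => // Pa; apply: cderD => //; apply: h.
Qed.

Lemma cder_conj f d t : cder f d t -> cder (fun s => Num.conj (f s)) (Num.conj d) t.
Proof.
move=> [f1 f2]; split.
  by rewrite cRe_conj (_ : (fun s => _) = (fun s => Re (f s))) //; apply/funext=> s; rewrite cRe_conj.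
rewrite cIm_conj (_ : (fun s => _) = - (fun s => Im (f s))); first exact: is_deriveN.
by apply/funext=> s; rewrite cIm_conj.
Qed.

Variant mder m n (F : R -> 'M[C]_(m, n)) (D : 'M[C]_(m, n)) (t : R) : Prop :=
  MDer of forall i j, cder (fun s => F s i j) (D i j) t.

Lemma mder_eq m n F (D D' : 'M[C]_(m, n)) t : mder F D t -> D = D' -> mder F D' t.
Proof. by move=> h <-. Qed.
Lemma mder_cst m n (A : 'M[C]_(m, n)) t : mder (fun=> A) 0 t.
Proof. by split=> i j; rewrite mxE; apply: cder_cst. Qed.
Lemma mderD m n F G (D E : 'M[C]_(m, n)) t : mder F D t -> mder G E t ->
  mder (fun s => F s + G s) (D + E) t.
Proof.
move=> [hF] [hG]; split=> i j; rewrite mxE (_ : (fun s => _) = (fun s => F s i j + G s i j)); first exact: cderD.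
by apply/funext=> s; rewrite mxE.
Qed.
Lemma mderM m n p F G (D : 'M[C]_(m, n)) (E : 'M[C]_(n, p)) t : mder F D t -> mder G E t ->
  mder (fun s => F s *m G s) (D *m G t + F t *m E) t.
Proof.
move=> [hF] [hG]; split=> i j; rewrite !mxE -big_split /=.
rewrite (_ : (fun s => _) = (fun s => \sum_k F s i k * G s k j)); last by apply/funext=> s; rewrite mxE.
by apply: cder_sum => k _; apply: cderM.
Qed.
Lemma mderMl m n p (A : 'M[C]_(m, n)) G (E : 'M[C]_(n, p)) t : mder G E t ->
  mder (fun s => A *m G s) (A *m E) t.
Proof. by move=> h; have := mderM (mder_cst A t) h; rewrite mul0mx add0r. Qed.
Lemma mderMr m n p F (D : 'M[C]_(m, n)) (A : 'M[C]_(n, p)) t : mder F D t ->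
  mder (fun s => F s *m A) (D *m A) t.
Proof. by move=> h; have := mderM h (mder_cst A t); rewrite mulmx0 addr0. Qed.
Lemma mderZ m n a F (D : 'M[C]_(m, n)) t : mder F D t -> mder (fun s => a *: F s) (a *: D) t.
Proof.
move=> h; rewrite -mul_scalar_mx (_ : (fun s => _) = (fun s => a%:M *m F s)); first exact: mderMl.
by apply/funext=> s; rewrite mul_scalar_mx.
Qed.
Lemma mderN m n F (D : 'M[C]_(m, n)) t : mder F D t -> mder (fun s => - F s) (- D) t.
Proof.
move=> h; rewrite -scaleN1r (_ : (fun s => _) = (fun s => -1 *: F s)); first exact: mderZ.
by apply/funext=> s; rewrite scaleN1r.
Qed.
Lemma mderB m n F G (D E : 'M[C]_(m, n)) t : mder F D t -> mder G E t ->
  mder (fun s => F s - G s) (D - E) t.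
Proof. by move=> hF hG; apply: mderD => //; apply: mderN. Qed.
Lemma mder_adj m n F (D : 'M[C]_(m, n)) t : mder F D t -> mder (fun s => (F s)^H) D^H t.
Proof.
move=> [h]; split=> i j; rewrite !mxE (_ : (fun s => _) = (fun s => Num.conj (F s j i))); first exact: cder_conj.
by apply/funext=> s; rewrite !mxE.
Qed.
Lemma mder_cmt n F (D A : 'M[C]_n) t : mder F D t -> mder (fun s => cmt A (F s)) (cmt A D) t.
Proof.
move=> h; rewrite cmtE (_ : (fun s => _) = fun s => A *m F s - F s *m A).
  by apply: mderB; [apply: mderMl|apply: mderMr].
by apply/funext=> s; rewrite cmtE.
Qed.

Lemma is_derive_ip n (u : 'cV[C]_n) p (F : R -> 'M[C]_(n, p)) D (v : 'cV[C]_p) t : mder F D t ->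
  is_derive t (1 : R) (fun s => ip u (F s *m v)) (ip u (D *m v)).
Proof. by move=> h; have [/(_ 0 0) []] := mderMl u^H (mderMr v h). Qed.

(** Mean value theorem for [c s^(k+1) / (k+1) - f s], whose derivative is nonnegative. It stands in
    for integrating a monomial bound; the powers of [s] are those produced by the Lieb-Robinson
    induction. *)
Lemma derive_le (f df : R -> R) (c : R) k (t : R) : 0 <= t ->
  (forall s, 0 <= s <= t -> is_derive s (1 : R) f (df s)) ->
  (forall s, 0 <= s <= t -> df s <= c * s ^+ k) ->
  f t - f 0 <= c * t ^+ k.+1 / k.+1%:R.
Proof.
move=> t0 hd hle.
pose c' := c / k.+1%:R.
pose g : R -> R := c' \*: (id ^+ k.+1) - f.
pose dg s := c * s ^+ k - df s.
have hg s : 0 <= s <= t -> is_derive s (1 : R) g (dg s).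
  move=> hs; have := hd _ hs => hf; apply: is_derive_eq.
  rewrite /dg /c' /GRing.scale /=.
  by field; rewrite addrC natr1 pnatr_eq0.
have hc : ({within `[0, t], continuous g})%classic.
  apply: derivable_within_continuous => x; rewrite in_itv /= => hx.
  exact: (@ex_derive _ _ _ _ _ _ _ (hg _ hx)).
have hi x : x \in `]0, t[ -> is_derive x (1 : R) g (dg x).
  by rewrite in_itv /= => /andP[x0 x1]; apply: hg; rewrite !ltW.
have [s] := MVT_segment t0 hi hc.
rewrite in_itv /= subr0 => hs e.
have : 0 <= g t - g 0 by rewrite e mulr_ge0 // subr_ge0 hle.
rewrite /g /= /c'.
have E a : (c / k.+1%:R \*: id ^+ k.+1 - f) a = c / k.+1%:R * a ^+ k.+1 - f a by rewrite -[LHS]/(c / k.+1%:R * (id ^+ k.+1 : R -> R) a - f a) exprfctE.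
rewrite !E expr0n /= mulr0; set y := c / _ * _.
rewrite (_ : c * t ^+ k.+1 / k.+1%:R = y); last by rewrite /y mulrAC.
move: y (f t) (f 0) => y a b; lra.
Qed.

Lemma bnd_mder m n (F D : R -> 'M[C]_(m, n)) (c : R) k (t : R) : 0 <= t -> 0 <= c ->
  (forall s, 0 <= s <= t -> mder F (D s) s) ->
  (forall s, 0 <= s <= t -> bnd (D s) (c * s ^+ k)) ->
  bnd (F t - F 0) (c * t ^+ k.+1 / k.+1%:R).
Proof.
move=> t0 c0 hd hb.
have e0 : 0 <= c * t ^+ k.+1 / k.+1%:R by rewrite divr_ge0 // mulr_ge0 // exprn_ge0.
apply/(bndP _ e0) => u v; rewrite mulmxBl ipBr.
have h0 := mulr_ge0 (nrm_ge0 u) (nrm_ge0 v).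
have := @derive_le (fun s => ip u (F s *m v)) (fun s => ip u (D s *m v)) (c * (nrm u * nrm v)) k t t0.
have -> : c * (nrm u * nrm v) * t ^+ k.+1 / k.+1%:R = c * t ^+ k.+1 / k.+1%:R * (nrm u * nrm v).
  move: (nrm u * nrm v) => x; ring.
apply => s hs; first exact/is_derive_ip/hd.
have s0 : 0 <= c * s ^+ k by case/andP: hs => s0 _; rewrite mulr_ge0 // exprn_ge0.
have /(bndP _ s0)/(_ u v) := hb s hs; congr (_ <= _); move: (nrm u * nrm v) => x; ring.
Qed.

Lemma bnd_mder1 m n (F D : R -> 'M[C]_(m, n)) (c : R) (t : R) : 0 <= t -> 0 <= c ->
  (forall s, 0 <= s <= t -> mder F (D s) s) ->
  (forall s, 0 <= s <= t -> bnd (D s) c) ->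
  bnd (F t - F 0) (t * c).
Proof.
move=> t0 c0 hd hb; have := @bnd_mder m n F D c 0 t t0 c0 hd.
rewrite expr1 divr1 (mulrC t); apply=> s hs; rewrite expr0 mulr1; exact: hb.
Qed.

Lemma bnd_eq0 m n (A : 'M[C]_(m, n)) : bnd A 0 -> A = 0.
Proof.
move=> h; apply/matrixP => i j; rewrite mxE.
have hj (v : 'cV[C]_n) : A *m v = 0.
  have : nrm (A *m v) = 0.
    by apply/eqP; rewrite eq_le nrm_ge0 andbT -(mul0r (nrm v)); apply: bndE.
  move/(congr1 (fun x => x ^+ 2)); rewrite nrm_sqr expr0n /= ipE => /eqP.
  rewrite psumr_eq0 => [/allP h0|k _]; last by rewrite -!expr2 addr_ge0 ?sqr_ge0.
  apply/colP => k; have := h0 k (mem_index_enum _).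
  rewrite /= -!expr2 paddr_eq0 ?sqr_ge0 // !sqrf_eq0 => /andP[/eqP r /eqP q].
  by rewrite [RHS]mxE; apply: complex_eqP.
have := hj (delta_mx j 0); rewrite -colE => /colP/(_ i); by rewrite !mxE.
Qed.

Lemma mder0_cst m n (F : R -> 'M[C]_(m, n)) t : 0 <= t ->
  (forall s, mder F 0 s) -> F t = F 0.
Proof.
move=> t0 h; apply/eqP; rewrite -subr_eq0; apply/eqP/bnd_eq0.
have := @bnd_mder1 m n F (fun=> 0) 0 t t0 (lexx 0); rewrite mulr0; apply=> // *.
exact: bnd0.
Qed.

End MatrixCalculus.

(** * Unitary groups and Heisenberg dynamics *)

Section Cis.
Variable R : realType.
Local Notation C := R[i].
Local Notation Re := (@complex.Re R).
Local Notation Im := (@complex.Im R).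

Definition cis (x : R) : C := (cos x +i* sin x)%C.

Lemma cis0 : cis 0 = 1.
Proof. by rewrite /cis cos0 sin0. Qed.

Lemma cisD x y : cis (x + y) = cis x * cis y.
Proof.
apply: complex_eqP; rewrite /= ?cosD ?sinD; ring.
Qed.

Lemma conj_cisM x : Num.conj (cis x) * cis x = 1.
Proof.
apply: complex_eqP; rewrite ?cReM ?cImM cRe_conj cIm_conj /=.
  by rewrite -(cos2Dsin2 x); ring.
by ring.
Qed.

Lemma is_derive_scalel (a t : R) : is_derive t (1 : R) (fun s : R => s * a) a.
Proof.
rewrite (_ : (fun s => _) = a \*: id); last by apply/funext=> s; rewrite /= mulrC.
by apply: is_derive_eq; rewrite /GRing.scale /= mulr1.
Qed.

Lemma cder_cis (a t : R) : cder (fun s => cis (s * a)) (('i%C : C) * (a%:C%C : C) * cis (t * a)) t.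
Proof.
have h := is_derive_scalel a t.
have hc : is_derive t (1 : R) (@cos R \o (fun s => s * a)) (- sin (t * a) * a).
  by apply: is_derive_eq (is_derive1_comp _ h) _; rewrite mulrC.
have hs : is_derive t (1 : R) (@sin R \o (fun s => s * a)) (cos (t * a) * a).
  by apply: is_derive_eq (is_derive1_comp _ h) _; rewrite mulrC.
split.
  by apply: is_derive_eq hc _; rewrite [RHS]cReM [X in X * _ - _]cReM [X in _ - X * _]cImM /=; ring.
by apply: is_derive_eq hs _; rewrite [RHS]cImM [X in X * _ + _]cReM [X in _ + X * _]cImM /=; ring.
Qed.

Lemma spectral_herm n (A : 'M[C]_n) : A^H = A ->
  [/\ A = (spectralmx A)^H *m diag_mx (spectral_diag A) *m spectralmx A,
      spectralmx A *m (spectralmx A)^H = 1%:M,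
      (spectralmx A)^H *m spectralmx A = 1%:M &
      forall j, spectral_diag A 0 j = (Re (spectral_diag A 0 j))%:C%C].
Proof.
move=> hA; have hh : A \is hermsymmx.
  by apply/is_hermitianmxP; rewrite expr0 scale1r -[in LHS]hA.
have U := spectral_unitarymx A.
have E : invmx (spectralmx A) = (spectralmx A)^H by rewrite invmx_unitary.
split.
- by rewrite -E; apply/orthomx_spectralP/hermitian_normalmx.
- exact/unitarymxP.
- by rewrite -E mulVmx // spectral_unit.
- move=> j; have /mxOverP/(_ 0 j)/RRe_real h := hermitian_spectral_diag_real hh.
  by rewrite h.
Qed.

Lemma conj_mulmx n (S D E : 'M[C]_n) : S *m S^H = 1%:M ->
  (S^H *m D *m S) *m (S^H *m E *m S) = S^H *m (D *m E) *m S.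
Proof. by move=> h; rewrite !mulmxA -(mulmxA _ S) h mulmx1. Qed.

End Cis.

(** The unitary [e^{itA}], read off in an eigenbasis so that no matrix power series has to converge.
    For Hermitian [A] the eigenvalues are real and [Re] drops nothing. *)
HB.lock Definition flow (R : realType) n (A : 'M[R[i]]_n) (t : R) : 'M[R[i]]_n :=
  (spectralmx A)^H *m diag_mx (\row_j cis (t * complex.Re (spectral_diag A 0 j))) *m spectralmx A.

HB.lock Definition tau (R : realType) n (A : 'M[R[i]]_n) (t : R) (X : 'M[R[i]]_n) : 'M[R[i]]_n :=
  flow A t *m X *m (flow A t)^H.

(** The inverse of [tau A t]; a separate name keeps all times nonnegative, as the derivative
    estimates on [[0, t]] require. *)
HB.lock Definition tauV (R : realType) n (A : 'M[R[i]]_n) (t : R) (X : 'M[R[i]]_n) : 'M[R[i]]_n :=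
  (flow A t)^H *m X *m flow A t.

Section Flow.
Variable R : realType.
Local Notation C := R[i].
Local Notation Re := (@complex.Re R).
Local Notation Im := (@complex.Im R).

Section HermitianFlow.
Variables (n : nat) (A : 'M[C]_n).
Hypothesis hA : A^H = A.

Lemma flow0 : flow A 0 = 1%:M.
Proof.
have [_ _ h _] := spectral_herm hA; rewrite flow.unlock (_ : diag_mx _ = 1%:M) ?mulmx1 //.
by apply/matrixP=> i j; rewrite !mxE mul0r cis0.
Qed.

Lemma flowVM t : (flow A t)^H *m flow A t = 1%:M.
Proof.
have [_ h1 h _] := spectral_herm hA; rewrite flow.unlock !adjmxM adjmxK !mulmxA.
rewrite -(mulmxA (_ *m _) (spectralmx A)) h1 mulmx1 -(mulmxA (spectralmx A)^H).
rewrite (_ : _^H *m diag_mx _ = 1%:M) ?mulmx1 // tr_diag_mx map_diag_mx mulmx_diag.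
by apply/matrixP=> i j; rewrite !mxE conj_cisM.
Qed.

Lemma flowMV t : flow A t *m (flow A t)^H = 1%:M.
Proof. exact/mulmx1C/flowVM. Qed.

Lemma flow_comm t : comm_mx A (flow A t).
Proof.
have [h h1 h2 _] := spectral_herm hA; have E : flow A t = (spectralmx A)^H *m diag_mx (\row_j cis (t * Re (spectral_diag A 0 j))) *m spectralmx A.
  by rewrite flow.unlock.
have -> : comm_mx A (flow A t) = comm_mx ((spectralmx A)^H *m diag_mx (spectral_diag A) *m spectralmx A) (flow A t) by rewrite -h.
by rewrite /comm_mx E (conj_mulmx _ _ h1) diag_mx_comm -(conj_mulmx _ _ h1).
Qed.

Lemma mder_flow t : mder (flow A) ('i%C *: (A *m flow A t)) t.
Proof.
have [h h1 h2 h3] := spectral_herm hA.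
have hd : mder (fun s => diag_mx (\row_j cis (s * Re (spectral_diag A 0 j))))
  ('i%C *: (diag_mx (spectral_diag A) *m diag_mx (\row_j cis (t * Re (spectral_diag A 0 j))))) t.
  rewrite mulmx_diag; split=> i j; rewrite !mxE.
  case: eqP => [e|e]; last first.
    rewrite !mulr0n mulr0 (_ : (fun s => _) = fun=> 0); first exact: cder_cst.
    by apply/funext=> s; rewrite !mxE; move/eqP/negPf: e => ->.
  rewrite (_ : (fun s => _) = fun s => cis (s * Re (spectral_diag A 0 i))); last first.
    by apply/funext=> s; rewrite !mxE e eqxx.
  rewrite mulr1n [X in 'i%C * (X * _)]h3 mulrA; exact: cder_cis.
have E : flow A = fun s => (spectralmx A)^H *m diag_mx (\row_j cis (s * Re (spectral_diag A 0 j))) *m spectralmx A.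
  by apply/funext=> s; rewrite flow.unlock.
rewrite {1}E; apply: mder_eq (mderMr _ (mderMl _ hd)) _.
rewrite -scalemxAr -scalemxAl; congr (_ *: _).
have -> : A *m flow A t = (spectralmx A)^H *m diag_mx (spectral_diag A) *m spectralmx A *m flow A t by rewrite -h.
by rewrite flow.unlock conj_mulmx.
Qed.

Lemma mder_flowV t : mder (fun s => (flow A s)^H) (- 'i%C *: ((flow A t)^H *m A)) t.
Proof.
apply: mder_eq (mder_adj (mder_flow t)) _.
by rewrite adjmxZ adjmxM hA; congr (_ *: _); apply: complex_eqP; rewrite /= ?oppr0.
Qed.

End HermitianFlow.

Section Heisenberg.
Variables (n : nat) (A : 'M[C]_n).
Hypothesis hA : A^H = A.

Lemma mder_tau X D t : mder X D t ->
  mder (fun s => tau A s (X s)) (tau A t ('i%C *: cmt A (X t) + D)) t.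
Proof.
move=> hX; rewrite (_ : (fun s => _) = fun s => flow A s *m X s *m (flow A s)^H); last first.
  by apply/funext=> s; rewrite tau.unlock.
apply: mder_eq (mderM (mderM (mder_flow hA t) hX) (mder_flowV hA t)) _.
have VA : (flow A t)^H *m A = A *m (flow A t)^H.
  by have /(congr1 (fun X => X^H)) := flow_comm hA t; rewrite !adjmxM hA.
rewrite VA (flow_comm hA t) tau.unlock !cmtE (mulmxDr (flow A t)) (mulmxDl (flow A t *m _)).
rewrite -(scalemxAr _ (flow A t)) -(scalemxAl _ _ (flow A t)^H) mulmxBr mulmxBl scalerBr.
by rewrite mulmxDl -!scalemxAl -scalemxAr scaleNr !mulmxA addrAC.
Qed.

Lemma mder_tauV X D t : mder X D t ->
  mder (fun s => tauV A s (X s)) (tauV A t (D - 'i%C *: cmt A (X t))) t.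
Proof.
move=> hX; rewrite (_ : (fun s => _) = fun s => (flow A s)^H *m X s *m flow A s); last first.
  by apply/funext=> s; rewrite tauV.unlock.
apply: mder_eq (mderM (mderM (mder_flowV hA t) hX) (mder_flow hA t)) _.
rewrite tauV.unlock !cmtE mulmxBr mulmxBl -(scalemxAr _ (flow A t)^H) -(scalemxAl _ _ (flow A t)).
rewrite mulmxBr mulmxBl scalerBr opprB mulmxDl -!scalemxAl -scalemxAr scaleNr !mulmxA.
by rewrite (addrC (- _)) -addrA (addrC (- _)).
Qed.

Lemma tau0 X : tau A 0 X = X.
Proof. by rewrite tau.unlock flow0 // adjmx1 mul1mx mulmx1. Qed.
Lemma tauV0 X : tauV A 0 X = X.
Proof. by rewrite tauV.unlock flow0 // adjmx1 mul1mx mulmx1. Qed.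
Lemma tauVK t X : tau A t (tauV A t X) = X.
Proof. by rewrite tau.unlock tauV.unlock !mulmxA flowMV // mul1mx -mulmxA flowMV // mulmx1. Qed.
Lemma bnd_tau t X e : 0 <= e -> bnd X e -> bnd (tau A t X) e.
Proof. by move=> e0; rewrite tau.unlock; apply: bnd_conj => //; [apply: flowVM|apply: flowMV]. Qed.
Lemma bnd_tauV t X e : 0 <= e -> bnd X e -> bnd (tauV A t X) e.
Proof.
move=> e0 h; rewrite tauV.unlock -{2}(adjmxK (flow A t)); apply: bnd_conj => //.
  by rewrite adjmxK flowMV.
by rewrite adjmxK flowVM.
Qed.
Lemma tau_adj t X : (tau A t X)^H = tau A t X^H.
Proof. by rewrite tau.unlock !adjmxM adjmxK mulmxA. Qed.
Lemma tauD t X Y : tau A t (X + Y) = tau A t X + tau A t Y.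
Proof. by rewrite tau.unlock mulmxDr mulmxDl. Qed.
Lemma tauB t X Y : tau A t (X - Y) = tau A t X - tau A t Y.
Proof. by rewrite tau.unlock mulmxBr mulmxBl. Qed.

Lemma comm_flow B t : 0 <= t -> comm_mx A B -> comm_mx (flow A t) B.
Proof.
move=> t0 hB.
have : tauV A t B = B.
  rewrite -[RHS](tauV0 B); apply: (@mder0_cst _ _ _ (fun s => tauV A s B)) => // s.
  apply: mder_eq (mder_tauV (mder_cst B s)) _.
  by rewrite !cmtE hB subrr scaler0 subrr tauV.unlock mulmx0 mul0mx.
move/(congr1 (mulmx (flow A t))).
by rewrite tauV.unlock !mulmxA flowMV // mul1mx /comm_mx => ->.
Qed.

Lemma comm_flowV B t : 0 <= t -> comm_mx A B -> comm_mx (flow A t)^H B.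
Proof.
move=> t0 hB; have h : comm_mx A B^H.
  by rewrite /comm_mx -{1}hA -adjmxM -hB adjmxM hA.
have /(congr1 (fun X => X^H)) := comm_flow t0 h.
by rewrite !adjmxM adjmxK /comm_mx => ->.
Qed.

Lemma comm_tau B X t : 0 <= t -> comm_mx A B -> comm_mx X B -> comm_mx (tau A t X) B.
Proof.
move=> t0 hA' hX; rewrite tau.unlock; apply: comm_mx_sym; apply: comm_mxM; last exact/comm_mx_sym/comm_flowV.
by apply: comm_mxM; apply: comm_mx_sym => //; apply: comm_flow.
Qed.

End Heisenberg.

Lemma cmt0P n (A B : 'M[C]_n) : comm_mx A B <-> cmt A B = 0.
Proof. by rewrite /comm_mx !cmtE; split=> [->|/eqP]; rewrite ?subrr // subr_eq0 => /eqP. Qed.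

Lemma mder_evol n (A : 'M[C]_n) X t : A^H = A ->
  mder (fun s => tau A s X) (tau A t ('i%C *: cmt A X)) t.
Proof. by move=> hA; apply: mder_eq (mder_tau hA (mder_cst X t)) _; rewrite addr0. Qed.

(** [e^{-is(A+B)} e^{isA} e^{isB}] has derivative zero, because [B] can be moved past [e^{isA}]. *)
Lemma flowD n (A B : 'M[C]_n) t : 0 <= t -> A^H = A -> B^H = B -> comm_mx A B ->
  flow (A + B) t = flow A t *m flow B t.
Proof.
move=> t0 hA hB hAB; have hD : (A + B)^H = A + B by rewrite adjmxD hA hB.
pose G s := (flow (A + B) s)^H *m (flow A s *m flow B s).
have hG s : 0 <= s <= t -> mder G 0 s.
  case/andP=> s0 _; apply: mder_eq (mderM (mder_flowV hD s) (mderM (mder_flow hA s) (mder_flow hB s))) _.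
  rewrite -!scalemxAl -!scalemxAr -scalerDr -scalemxAr scaleNr addrC.
  apply/eqP; rewrite subr_eq0; apply/eqP; congr (_ *: _).
  rewrite -[RHS]mulmxA mulmxDl; congr (_ *m (_ + _)); first by rewrite mulmxA.
  by rewrite !mulmxA (comm_flow hA s0 hAB).
have : G t = G 0.
  apply/eqP; rewrite -subr_eq0; apply/eqP/bnd_eq0.
  have := @bnd_mder1 _ _ _ G (fun=> 0) 0 t t0 (lexx 0) hG; rewrite mulr0; apply=> *; exact: bnd0.
rewrite /G !flow0 // adjmx1 !mulmx1 => /(congr1 (mulmx (flow (A + B) t))).
by rewrite mulmxA flowMV // mul1mx mulmx1 => ->.
Qed.

End Flow.

(** * Time averages and the Lieb-Robinson bound *)

Section Averages.
Variable R : realType.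
Local Notation C := R[i].

(* The mean of [F] over [s] plus the subset sums of [ts]; on [F := flow A] each time [t] in
   [ts] contributes the spectral filter [(1 + e^{itA}) / 2]. *)
Fixpoint avg m n (ts : seq R) (F : R -> 'M[C]_(m, n)) (s : R) : 'M[C]_(m, n) :=
  if ts is t :: ts' then (2^-1)%:C%C *: (avg ts' F s + avg ts' F (s + t)) else F s.

(** A property stable under midpoints passes from the sampled values to the average. The sampled
    times are [s] plus subset sums of nonnegative numbers, so they stay in [[s, T]]. *)
Lemma avg_ind m n (P : 'M[C]_(m, n) -> Prop) (F : R -> 'M[C]_(m, n)) ts s T :
  (forall X Y, P X -> P Y -> P ((2^-1)%:C%C *: (X + Y))) ->
  (forall t, t \in ts -> 0 <= t) -> s + \sum_(t <- ts) t <= T ->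
  (forall u, s <= u <= T -> P (F u)) -> P (avg ts F s).
Proof.
move=> hP; elim: ts s => [|t ts IH] s hts.
  by rewrite big_nil addr0 => sT; apply; rewrite lexx.
have t0 : 0 <= t by apply: hts; rewrite mem_head.
have hts' u : u \in ts -> 0 <= u by move=> h; apply: hts; rewrite in_cons h orbT.
have S0 : 0 <= \sum_(j <- ts) j by rewrite big_seq; apply: sumr_ge0.
rewrite big_cons => sT hF /=; apply: hP; apply: IH => //.
- by apply: le_trans sT; rewrite addrA lerD2r lerDl.
- by rewrite -addrA.
- move=> u /andP[u1 u2]; apply: hF; rewrite u2 andbT; apply: le_trans u1; by rewrite lerDl.
Qed.

Lemma avg_bnd m n (F : R -> 'M[C]_(m, n)) ts T e : 0 <= e ->
  (forall t, t \in ts -> 0 <= t) -> \sum_(t <- ts) t <= T ->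
  (forall u, 0 <= u <= T -> bnd (F u) e) -> bnd (avg ts F 0) e.
Proof.
move=> e0 hts sT hF; apply: (@avg_ind _ _ (fun X => bnd X e) F ts 0 T) => //; last by rewrite add0r.
move=> X Y hX hY; have := bndr 2^-1 (bndD hX hY).
by rewrite gtr0_norm ?invr_gt0 // -mulr2n -(mulr_natl e) mulKf // pnatr_eq0.
Qed.

Lemma avg_lin m n p q (L : 'M[C]_(m, n) -> 'M[C]_(p, q)) (F : R -> 'M[C]_(m, n)) ts s :
  (forall a X Y, L (a%:C%C *: (X + Y)) = a%:C%C *: (L X + L Y)) ->
  L (avg ts F s) = avg ts (fun u => L (F u)) s.
Proof. by move=> hL; elim: ts s => [|t ts IH] s //=; rewrite hL !IH. Qed.

Lemma avgD m n (F G : R -> 'M[C]_(m, n)) ts s :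
  avg ts (fun u => F u + G u) s = avg ts F s + avg ts G s.
Proof. by elim: ts s => [|t ts IH] s //=; rewrite !IH -scalerDr addrACA. Qed.

Lemma avgN m n (F : R -> 'M[C]_(m, n)) ts s : avg ts (fun u => - F u) s = - avg ts F s.
Proof. by elim: ts s => [|t ts IH] s //=; rewrite !IH -opprD scalerN. Qed.

Lemma avg_cst m n (A : 'M[C]_(m, n)) ts s : avg ts (fun=> A) s = A.
Proof.
elim: ts s => [|t ts IH] s //=; rewrite !IH -mulr2n -(scaler_nat 2 A) scalerA.
rewrite (_ : _ * _ = 1) ?scale1r //; apply: complex_eqP; rewrite -(rmorph_nat (real_complex R)) -rmorphM /= //.
by rewrite mulVf // pnatr_eq0.
Qed.

Lemma avg_adj n (F : R -> 'M[C]_n) ts s : (avg ts F s)^H = avg ts (fun u => (F u)^H) s.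
Proof.
apply: (@avg_lin _ _ _ _ (fun X => X^H)) => a X Y; rewrite adjmxZ adjmxD; congr (_ *: _).
by apply: complex_eqP; rewrite /= ?oppr0.
Qed.

End Averages.

(** * The Lieb-Robinson bound by induction on layers *)

Section LiebRobinson.
Variable R : realType.
Local Notation C := R[i].

Lemma tau_cmt n (A X : 'M[C]_n) t : A^H = A -> tau A t (cmt A X) = cmt A (tau A t X).
Proof.
move=> hA; rewrite tau.unlock !cmtE mulmxBr mulmxBl !mulmxA (flow_comm hA); congr (_ - _).
rewrite -!mulmxA; do 2!congr (_ *m _).
by have /(congr1 (fun X => X^H)) := flow_comm hA t; rewrite !adjmxM hA => ->.
Qed.

Lemma mder_evol' n (A X : 'M[C]_n) t : A^H = A ->
  mder (fun s => tau A s X) ('i%C *: cmt A (tau A t X)) t.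
Proof.
move=> hA; apply: mder_eq (mder_evol X t hA) _; rewrite -tau_cmt //.
by rewrite tau.unlock -scalemxAr -scalemxAl.
Qed.

Variables (n : nat) (I : finType) (Phi : I -> 'M[C]_n) (S : pred I) (m b : R) (B : 'M[C]_n).
Variables (lay : nat -> pred I) (nbr : I -> {set I}) (c : nat).
Hypotheses (m0 : 0 <= m) (b0 : 0 <= b).
Hypothesis Phi_herm : forall i, (Phi i)^H = Phi i.
Hypothesis Phi_bnd : forall i, bnd (Phi i) m.
Hypothesis B_bnd : bnd B b.
Hypothesis lay0 : forall i, lay 0 i -> comm_mx (Phi i) B.
Hypothesis layW : forall k i, lay k.+1 i -> lay k i.
Hypothesis lay_nbr : forall k i j, lay k.+1 i -> S j -> j \in nbr i -> lay k j.
Hypothesis nbr_card : forall i, (#|nbr i| <= c)%N.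
Hypothesis nbr_comm : forall i j, j \notin nbr i -> comm_mx (Phi i) (Phi j).

Let HS := \sum_(j | S j) Phi j.

(* In the frame rotating with [HS], the derivative of [cmt (Phi i) (tau HS t B)] only involves
   the same commutator for neighbours of [i], which lie at most one layer closer to [B]. *)
Lemma lieb_robinson k i t : lay k i -> 0 <= t ->
  bnd (cmt (Phi i) (tau HS t B)) (2 * m * b * (4 * m * c%:R * t) ^+ k / k`!%:R).
Proof.
have hH : HS^H = HS by rewrite /HS adjmx_sum; apply: eq_bigr => j _.
have hc0 : 0 <= 4 * m * c%:R by rewrite !mulr_ge0.
have mb0 : 0 <= 2 * m * b by rewrite !mulr_ge0.
elim: k i t => [|k IH] i t hi t0.
  rewrite expr0 fact0 mulr1 divr1; apply: bnd_cmt => //; exact: bnd_tau.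
pose X s := cmt (Phi i) (tau HS s B).
pose D s := tauV HS s ('i%C *: cmt (cmt (Phi i) HS) (tau HS s B)).
pose f s := 2 * m * b * (4 * m * c%:R * s) ^+ k / k`!%:R.
have f0 s : 0 <= s -> 0 <= f s.
  by move=> s0; rewrite /f divr_ge0 // mulr_ge0 // exprn_ge0 // mulr_ge0.
have hd s : 0 <= s <= t -> mder (fun s => tauV HS s (X s)) (D s) s.
  move=> _; have hX := mder_cmt (Phi i) (mder_evol' B s hH).
  apply: mder_eq (mder_tauV hH hX) _; rewrite /D /X; congr (tauV _ _ _).
  by rewrite cmtZr -scalerBr (jacobi _ HS) addrK.
(* At most [c] neighbours, each worth [4 * m * f s], give this coefficient of [s ^+ k]; integrating
   it produces the next term of the exponential series. *)
pose K := 2 * m * b * (4 * m * c%:R) ^+ k.+1 / k`!%:R.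
have K0 : 0 <= K by rewrite /K divr_ge0 // mulr_ge0 // exprn_ge0.
have hb s : 0 <= s <= t -> bnd (D s) (K * s ^+ k).
  case/andP=> s0 _; apply: bnd_tauV => //; first by rewrite mulr_ge0 // exprn_ge0.
  apply: bndi; rewrite /HS cmt_sumr cmt_suml.
  rewrite (bigID (mem (nbr i))) /= [X in _ + X]big1 => [|j /andP[_ hj]]; last first.
    by rewrite (proj1 (cmt0P _ _) (nbr_comm hj)) cmt0l.
  rewrite addr0.
  have hj j : S j && (j \in nbr i) -> bnd (cmt (cmt (Phi i) (Phi j)) (tau HS s B)) (4 * m * f s).
    case/andP=> Sj ji; have fi := IH i s (layW hi) s0; have fj := IH j s (lay_nbr hi Sj ji) s0.
    (* The Jacobi identity trades the nested commutator for those of [Phi j] and of [Phi i] with the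
       evolved [B]. Both obey the induction hypothesis, whence [2 * m * f s] twice. *)
    have -> : cmt (cmt (Phi i) (Phi j)) (tau HS s B) =
       cmt (Phi i) (cmt (Phi j) (tau HS s B)) - cmt (Phi j) (cmt (Phi i) (tau HS s B)).
      by rewrite (jacobi (Phi i)) addrK.
    have -> : 4 * m * f s = 2 * m * f s + 2 * m * f s by ring.
    by apply: bndB; apply: bnd_cmt => //; apply: f0.
  apply: bndW (bnd_sum _ hj) _; rewrite sumr_const -(mulr_natl (4 * m * f s)).
  have le : (#|[pred j | S j && (j \in nbr i)]| <= c)%N.
    by apply: leq_trans (nbr_card i); apply/subset_leq_card/fintype.subsetP => j /andP[].
  have -> : K * s ^+ k = c%:R * (4 * m * f s).
    rewrite /K /f !exprMn !exprS; move: (k`!%:R^-1) => x; ring.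
  by apply: ler_wpM2r; rewrite ?ler_nat // (mulr_ge0 _ (f0 _ s0)) // mulr_ge0.
have := bnd_mder t0 K0 hd hb; rewrite (tauV0 hH (X 0)) {2}/X (tau0 hH).
have l0 : lay 0 i by elim: k.+1 hi => // k' IHk /layW.
rewrite (proj1 (cmt0P _ _) (lay0 l0)) subr0 => h.
rewrite -/(X t) -(tauVK hH t (X t)); apply: bnd_tau => //.
  by rewrite divr_ge0 // mulr_ge0 // exprn_ge0 // mulr_ge0.
apply: bndW h _; rewrite /K factS natrM invfM !exprMn !exprS.
by rewrite le_eqVlt; apply/orP; left; apply/eqP; move: (k`!%:R^-1) (k.+1%:R^-1) => x y; ring.
Qed.

End LiebRobinson.

(** * The trial state at one cut *)

Section OneSided.
Variable R : realType.
Local Notation C := R[i].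

Lemma bnd_entry (M : 'M[C]_1) e : bnd M e -> `|complex.Re (M 0 0)| <= e.
Proof.
move=> h; have n1 : nrm (1%:M : 'cV[C]_1) = 1.
  by rewrite /nrm ipE big_ord1 !mxE /= mulr1 mulr0 addr0 sqrtr1.
have := bndE 1%:M h; rewrite n1 mulr1 mulmx1 => h1.
have := ip_le (1%:M) M; have := ip_le (1%:M) (- M).
rewrite nrmN n1 mul1r ipNr /ip adjmx1 mul1mx => a b.
by rewrite ler_norml lerNl !(le_trans _ h1).
Qed.

Lemma ip_bnd n (A : 'M[C]_n) (W : 'cV[C]_n) e : W^H *m W = 1%:M -> bnd A e -> `|ip W (A *m W)| <= e.
Proof.
move=> hW hA; have b1 := bnd_iso hW; rewrite /ip mulmxA; apply: bnd_entry.
have e0 : 0 <= e.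
  have := bndE W hA; have -> : nrm W = 1 by rewrite /nrm /ip hW mxE /= sqrtr1.
  by rewrite mulr1; apply: le_trans; apply: nrm_ge0.
rewrite -(mulr1 e); apply: bndM => //; rewrite -(mul1r e); apply: bndM => //.
exact: bnd_adj.
Qed.

(** Duhamel: evolving back by [H] what was evolved by [H1] has as derivative a unitary conjugate of
    [- i [H - H1, tau H1 u J]]. So the perturbation need only be small against [J] under the
    localized dynamics [H1]. *)
Lemma dynamics_diff n (H H1 J : 'M[C]_n) (s d : R) : H^H = H -> H1^H = H1 -> 0 <= s -> 0 <= d ->
  (forall u, 0 <= u <= s -> bnd (cmt (H - H1) (tau H1 u J)) d) ->
  bnd (tau H1 s J - tau H s J) (s * d).
Proof.
move=> hH hH1 s0 d0 hb.
have hd u : 0 <= u <= s ->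
    mder (fun u => tauV H u (tau H1 u J)) (tauV H u (- ('i%C *: cmt (H - H1) (tau H1 u J)))) u.
  move=> _; apply: mder_eq (mder_tauV hH (mder_evol' J u hH1)) _; congr (tauV _ _ _).
  by rewrite cmtDl cmtNl scalerBr opprB.
have hb' u : 0 <= u <= s -> bnd (tauV H u (- ('i%C *: cmt (H - H1) (tau H1 u J)))) d.
  by move=> hu; apply: bnd_tauV => //; apply/bndN/bndi/hb.
have := bnd_mder1 s0 d0 hd hb'; rewrite tauV0 // tau0 // => h.
rewrite -(tauVK hH s (tau H1 s J)) -tauB; apply: bnd_tau => //.
by rewrite mulr_ge0.
Qed.

Lemma tauVD n (A X Y : 'M[C]_n) s : tauV A s (X + Y) = tauV A s X + tauV A s Y.
Proof. by rewrite tauV.unlock mulmxDr mulmxDl. Qed.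
Lemma tauVB n (A X Y : 'M[C]_n) s : tauV A s (X - Y) = tauV A s X - tauV A s Y.
Proof. by rewrite tauV.unlock mulmxBr mulmxBl. Qed.
Lemma tauVZ n a (A X : 'M[C]_n) s : tauV A s (a *: X) = a *: tauV A s X.
Proof. by rewrite tauV.unlock -scalemxAr -scalemxAl. Qed.

Lemma tauV_id n (A X : 'M[C]_n) s : A^H = A -> 0 <= s -> comm_mx A X -> tauV A s X = X.
Proof.
move=> hA s0 hX; rewrite tauV.unlock (comm_flowV hA s0 hX) -mulmxA flowVM // mulmx1 //.
Qed.

Lemma mder_linear m p (A : 'M[C]_(m, p)) t : mder (fun s : R => s%:C%C *: A) A t.
Proof.
split=> i j; rewrite (_ : (fun s => _) = fun s : R => (s%:C%C : C) * A i j); last by apply/funext=> s; rewrite mxE.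
have h : cder (fun s : R => (s%:C%C : C)) 1 t.
  split; first exact: is_derive_id.
  exact: is_derive_cst.
by have := cderM h (cder_cst (A i j) t); rewrite mul1r mulr0 addr0.
Qed.


Lemma comm_cmt n (A X Y : 'M[C]_n) : comm_mx A X -> comm_mx A Y -> comm_mx A (cmt X Y).
Proof. by move=> hX hY; rewrite cmtE; apply: comm_mxB; apply: comm_mxM. Qed.
Lemma comm_mxZ n a (A X : 'M[C]_n) : comm_mx A X -> comm_mx A (a *: X).
Proof. by move=> h; rewrite /comm_mx -scalemxAl -scalemxAr h. Qed.

Lemma Re_entry (A B X : 'M[C]_1) (a : R) :
  complex.Re ((A - a%:C%C *: X - B) 0 0) = complex.Re (A 0 0) - complex.Re (B 0 0) - a * complex.Re (X 0 0).
Proof. by rewrite !mxE !cReD !cReN cReM /= mul0r subr0 addrAC. Qed.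
Lemma norm_le_itv (x y b : R) : `|y| <= b -> x - b <= x + y <= x + b.
Proof. by rewrite ler_norml => /andP[h1 h2]; apply/andP; split; lra. Qed.

Lemma sandwich n p (v : 'M[C]_(n, p)) (V X : 'M[C]_n) :
  v^H *m (V^H *m X *m V) *m v = (V *m v)^H *m X *m (V *m v).
Proof. by rewrite adjmxM !mulmxA. Qed.
(** Compares the quadratic forms at [w] and [v] for small [y = w - v]: the first two terms each
    contain one factor [y]. *)
Lemma sandwich_split n p (v y w : 'M[C]_(n, p)) (X : 'M[C]_n) : w = y + v ->
  w^H *m X *m w = y^H *m X *m w + v^H *m X *m y + v^H *m X *m v.
Proof. by move=> e; rewrite {1}e adjmxD !mulmxDl -addrA; congr (_ + _); rewrite e mulmxDr. Qed.

Variables (n : nat) (H1 H2 H0 Q1 Q2 : 'M[C]_n) (Om : 'cV[C]_n).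
Let H := H1 + H0 + H2.
Let Q := Q1 + Q2.
Hypotheses (hH1 : H1^H = H1) (hH2 : H2^H = H2) (hH0 : H0^H = H0)
  (hQ1 : Q1^H = Q1) (hQ2 : Q2^H = Q2).
Hypotheses (cHH : comm_mx H1 H2) (cH1Q2 : comm_mx H1 Q2) (cH2Q1 : comm_mx H2 Q1)
  (cQQ : comm_mx Q1 Q2) (cH0Q : comm_mx H0 Q).
Let J1 := 'i%C *: cmt H1 Q1.
Let J2 := 'i%C *: cmt H2 Q2.
Variables (T d e lam h1 q1 : R) (ts : seq R).
Hypotheses (T0 : 0 <= T) (d0 : 0 <= d) (e0 : 0 <= e) (h10 : 0 <= h1) (q10 : 0 <= q1).
Hypotheses (hd1 : forall s, 0 <= s <= T -> bnd (cmt H0 (tau H1 s J1)) d)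
  (hd2 : forall s, 0 <= s <= T -> bnd (cmt H0 (tau H2 s J2)) d).
Hypotheses (ts0 : forall t, t \in ts -> 0 <= t) (tsT : \sum_(t <- ts) t <= T).
Hypotheses (HOm : H *m Om = 0) (Om1 : Om^H *m Om = 1%:M).
Hypothesis filter : bnd (avg ts (fun u => tau H u Q) 0 *m Om - lam%:C%C *: Om) e.
Hypothesis Q2_int : flow Q2 (2 * pi) = 1%:M.
Hypothesis H_pos : forall v, 0 <= ip v (H *m v).
Hypotheses (bH1 : bnd H1 h1) (bQ1 : bnd Q1 q1).

Let Qb1 := avg ts (fun u => tau H1 u Q1) 0.
Let Qb2 := avg ts (fun u => tau H2 u Q2) 0.
Let K1 := Q1 - Qb1.

Let hH : H^H = H. Proof. by rewrite /H !adjmxD hH1 hH0 hH2. Qed.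

Let hQb1 : Qb1^H = Qb1.
Proof. by rewrite /Qb1 avg_adj; congr avg; apply/funext=> u; rewrite tau_adj hQ1. Qed.
Let hQb2 : Qb2^H = Qb2.
Proof. by rewrite /Qb2 avg_adj; congr avg; apply/funext=> u; rewrite tau_adj hQ2. Qed.

Lemma comm_avg (A B X : 'M[C]_n) : A^H = A -> comm_mx A X -> comm_mx B X ->
  comm_mx (avg ts (fun u => tau A u B) 0) X.
Proof.
move=> hA hAX hBX; apply: (@avg_ind _ _ _ (fun Y => comm_mx Y X) _ ts 0 T) => //; last 2 first.
- by rewrite add0r.
- by move=> u /andP[u0 _]; apply: comm_tau.
by move=> Y Z hY hZ; rewrite /comm_mx -scalemxAl -scalemxAr mulmxDl mulmxDr hY hZ.
Qed.

(** Both sides agree at time 0, and [i[H, Q] = J1 + J2] since [H0] conserves [Q]. The dynamics are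
    compared on the currents, which nearly commute with [H0] under their own dynamics, and not on
    the charges, which need not. Two integrations give the factor [T] twice. *)
Lemma bnd_Q_tau_diff u : 0 <= u <= T ->
  bnd (tau H u Q - (tau H1 u Q1 + tau H2 u Q2)) (T * (2 * (T * d))).
Proof.
case/andP=> u0 uT.
pose G s := tau H s Q - (tau H1 s Q1 + tau H2 s Q2).
pose D s := (tau H s J1 - tau H1 s J1) + (tau H s J2 - tau H2 s J2).
have e1 : 'i%C *: cmt H Q = J1 + J2.
  rewrite /H /Q 2!cmtDl (proj1 (cmt0P _ _) cH0Q) addr0 !cmtDr.
  by rewrite (proj1 (cmt0P _ _) cH1Q2) (proj1 (cmt0P _ _) cH2Q1) addr0 add0r scalerDr.
have hG s : 0 <= s <= u -> mder G (D s) s.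
  move=> _; have := mderD (mder_evol Q1 s hH1) (mder_evol Q2 s hH2).
  move=> h; apply: mder_eq (mderB (mder_evol Q s hH) h) _.
  by rewrite e1 tauD /D addrACA opprD.
have hbD s : 0 <= s <= u -> bnd (D s) (2 * (T * d)).
  case/andP=> s0 su; have sT := le_trans su uT.
  (* [H - K] consists of [H0] and of the terms [K'] of the other cut. The latter commute with [K]
     and [J], hence with the evolved [J], so only [H0] counts. *)
  have hh (K K' J : 'M[C]_n) : K^H = K -> comm_mx K' K -> comm_mx K' J -> H - K = K' + H0 ->
      (forall s, 0 <= s <= T -> bnd (cmt H0 (tau K s J)) d) -> bnd (tau H s J - tau K s J) (T * d).
    move=> hK cK cJ eH hb; rewrite -opprB; apply: bndN; apply: bndW (_ : bnd _ (s * d)) _; last by rewrite ler_wpM2r.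
    apply: dynamics_diff => // v /andP[v0 vs]; rewrite eH cmtDl.
    rewrite (proj1 (cmt0P _ _)) ?add0r; first by apply: hb; rewrite v0 (le_trans vs).
    by apply/comm_mx_sym/comm_tau => //; apply: comm_mx_sym.
  rewrite (mulr_natl (T * d)) mulr2n; apply: bndD.
    apply: (hh _ H2) => //.
      by apply: comm_mxZ; apply: comm_cmt => //; apply: comm_mx_sym.
    by rewrite /H -(addrA H1) (addrC H1) addrK addrC.
  apply: (hh _ H1) => //.
    by apply: comm_mxZ; apply: comm_cmt.
  by rewrite /H addrK.
have Td0 : 0 <= 2 * (T * d) by rewrite !mulr_ge0.
have := bnd_mder1 u0 Td0 hG hbD; rewrite {2}/G !tau0 // subrr subr0 => h.
by apply: bndW h _; rewrite ler_wpM2r.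
Qed.

Let eps := T * (2 * (T * d)) + e.

Let eps0 : 0 <= eps. Proof. by rewrite addr_ge0 // !mulr_ge0. Qed.

Lemma bnd_Qb_Om : bnd ((Qb1 + Qb2 - lam%:C%C%:M) *m Om) eps.
Proof.
have -> : (Qb1 + Qb2 - lam%:C%C%:M) *m Om = (Qb1 + Qb2 - avg ts (fun u => tau H u Q) 0) *m Om +
   (avg ts (fun u => tau H u Q) 0 *m Om - lam%:C%C *: Om).
  by rewrite !mulmxDl !mulNmx mul_scalar_mx addrA subrK.
apply: bndD => //; rewrite -[X in bnd _ X]mulr1; apply: bndM (bnd_iso Om1); first by rewrite !mulr_ge0.
rewrite -opprB; apply: bndN; rewrite /Qb1 /Qb2 -avgD -avgN -avgD.
by apply: avg_bnd tsT bnd_Q_tau_diff => //; rewrite !mulr_ge0.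
Qed.

(** [Q1 - tau H1 u Q1] is minus the time integral of the evolved current, which nearly commutes with
    [H0] by [hd1]; [Q1] itself need not. *)
Lemma bnd_H0_K1 : bnd (cmt H0 K1) (T * d).
Proof.
have -> : K1 = avg ts (fun u => Q1 - tau H1 u Q1) 0.
  by rewrite avgD avgN avg_cst.
rewrite (avg_lin (L := cmt H0)); last by move=> a X Y; rewrite cmtZr cmtDr.
apply: avg_bnd tsT _ => //; first by rewrite mulr_ge0.
move=> u /andP[u0 uT].
have h s : 0 <= s <= u -> mder (fun s => cmt H0 (tau H1 s Q1)) (cmt H0 (tau H1 s J1)) s.
  by move=> _; apply: mder_cmt; apply: mder_evol.
have hb s : 0 <= s <= u -> bnd (cmt H0 (tau H1 s J1)) d.
  by case/andP=> s0 su; apply: hd1; rewrite s0 (le_trans su).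
have := bnd_mder1 u0 d0 h hb; rewrite tau0 // -cmtBr => h'.
by rewrite -opprB cmtNr; apply: bndN; apply: bndW h' _; rewrite ler_wpM2r.
Qed.

Let X1 := 'i%C *: cmt H1 Qb1.
Let X0 := 'i%C *: cmt H0 K1.
Let Qb2' := Qb2 - lam%:C%C%:M.
Let hQb2' : Qb2'^H = Qb2'.
Proof.
rewrite /Qb2' adjmxB hQb2; congr (_ - _); rewrite tr_scalar_mx map_scalar_mx; congr (_%:M).
by apply: complex_eqP; rewrite /= ?oppr0.
Qed.

Let cQb1H2 : comm_mx Qb1 H2. Proof. by apply: comm_avg => //; apply: comm_mx_sym. Qed.
Let cQb1Q2 : comm_mx Qb1 Q2. Proof. exact: comm_avg. Qed.
Let cQb2H1 : comm_mx Qb2 H1.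
Proof. by apply: comm_avg => //; apply: comm_mx_sym. Qed.
Let cQb2Q1 : comm_mx Qb2 Q1.
Proof. by apply: comm_avg => //; apply: comm_mx_sym. Qed.
Let cQb1Qb2' : comm_mx Qb1 Qb2'.
Proof.
apply: comm_mxB; last exact: comm_mx_scalar.
by apply: comm_avg => //; apply: comm_mx_sym => //; apply: comm_mx_sym.
Qed.

Let W s := flow Qb2' s *m flow Qb1 s.

(** [W s] is [e^{is(Qb1 + Qb2 - lam)}], whose generator nearly annihilates [Om]. Subtracting [lam]
    removes the phase that [Om] would otherwise pick up and does not affect conjugation by [W s]. *)
Lemma W_Om s : 0 <= s -> bnd (W s *m Om - Om) (s * eps).
Proof.
move=> s0.
have hW u : 0 <= u <= s -> mder (fun u => (flow Qb1 u)^H *m ((flow Qb2' u)^H *m Om))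
   (- 'i%C *: ((flow Qb1 u)^H *m ((flow Qb2' u)^H *m ((Qb1 + Qb2 - lam%:C%C%:M) *m Om)))) u.
  case/andP=> u0 _; apply: mder_eq (mderM (mder_flowV hQb1 u) (mderMr Om (mder_flowV hQb2' u))) _.
  rewrite -!scalemxAl -!scalemxAr -scalerDr; congr (_ *: _).
  rewrite -!mulmxA -mulmxDr; congr (_ *m _).
  rewrite (_ : Qb1 + Qb2 - _ = Qb1 + Qb2'); last by rewrite /Qb2' addrA.
  rewrite (mulmxDl Qb1) (mulmxDr (flow Qb2' u)^H); congr (_ + _).
  by rewrite !mulmxA (comm_flowV hQb2' u0 (comm_mx_sym cQb1Qb2')).
have hb u : 0 <= u <= s -> bnd (- 'i%C *: ((flow Qb1 u)^H *m ((flow Qb2' u)^H *m ((Qb1 + Qb2 - lam%:C%C%:M) *m Om)))) eps.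
  move=> _; rewrite scaleNr; apply/bndN/bndi; rewrite -(mul1r eps); apply: bndM => //.
    by apply: bnd_iso; rewrite adjmxK flowMV.
  rewrite -(mul1r eps); apply: bndM => //; last exact: bnd_Qb_Om.
  by apply: bnd_iso; rewrite adjmxK flowMV.
have := bnd_mder1 s0 eps0 hW hb; rewrite !flow0 // !adjmx1 !mul1mx => h.
have -> : W s *m Om - Om = - (W s *m ((flow Qb1 s)^H *m ((flow Qb2' s)^H *m Om) - Om)).
  rewrite mulmxBr opprB; congr (_ - _).
  by rewrite /W !mulmxA -(mulmxA (flow Qb2' s)) flowMV // mulmx1 flowMV // mul1mx.
apply: bndN; rewrite -(mul1r (s * eps)); apply: bndM => //.
by rewrite -(mulr1 1); apply: bndM => //; apply: bnd_iso; rewrite flowVM.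
Qed.

(** The increment of [<G>] over [[0, 2 pi]] is nonnegative, while its derivative is [<X1>] up to an
    error. In the constant, one [T * d] comes from [X0] along the flow, the other from replacing
    [<X1>] by [<J1>]; the last term comes from [W s] moving [Om]. *)
Lemma one_sided : - (2 * pi * (2 * (T * d) + 2 * (2 * pi * eps) * (2 * h1 * q1))) <= 2 * pi * ip Om (J1 *m Om).
Proof.
have pi0 : 0 <= pi :> R by exact: pi_ge0.
have tp0 : 0 <= 2 * pi :> R by rewrite mulr_ge0.
have Td0 : 0 <= T * d by rewrite mulr_ge0.
have bQb1 : bnd Qb1 q1.
  by apply: avg_bnd tsT _ => // u _; apply: bnd_tau.
have x0 : 0 <= 2 * h1 * q1 by rewrite !mulr_ge0.
have bX1 : bnd X1 (2 * h1 * q1) by apply/bndi/bnd_cmt.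
have bX0 : bnd X0 (T * d) by apply/bndi/bnd_H0_K1.
pose M := H1 + H0.
pose G s := tauV Qb1 s (tauV Q2 s M).
have hG s : 0 <= s -> mder G (tauV Qb1 s (tauV Q2 s (X1 - X0))) s.
  move=> s0; have h := mder_tauV hQ2 (mder_cst M s).
  apply: mder_eq (mder_tauV hQb1 h) _; congr (tauV _ _ _).
  have -> : cmt Qb1 (tauV Q2 s M) = tauV Q2 s (cmt Qb1 M).
    have c1 := comm_flow hQ2 s0 (comm_mx_sym cQb1Q2).
    have c2 := comm_flowV hQ2 s0 (comm_mx_sym cQb1Q2).
    rewrite tauV.unlock !cmtE mulmxBr mulmxBl; congr (_ - _).
      by rewrite !mulmxA c2.
    by rewrite -!mulmxA c1.
  rewrite -tauVZ -tauVB; congr (tauV _ _ _).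
  rewrite sub0r -opprD -scalerDr -cmtDl /X1 /X0 -scalerBr -scalerN; congr (_ *: _).
  rewrite -cmtC /M cmtDl (cmtDr Q2 Qb1 H1) (proj1 (cmt0P _ _) cH1Q2) add0r; congr (_ + _).
  (* As [H0] conserves [Q], its commutator sees only [K1]; this is the origin of [- X0]. *)
  have -> : Q2 + Qb1 = Q - K1 by rewrite /Q /K1 opprB (addrC Qb1) addrA (addrC Q1 Q2) addrK.
  by rewrite cmtBr (proj1 (cmt0P _ _) cH0Q) sub0r.
have cX1 (A : 'M[C]_n) : comm_mx A H1 -> comm_mx A Qb1 -> comm_mx A X1.
  by move=> ? ?; apply: comm_mxZ; apply: comm_cmt.
(* [X1] commutes with [Q2] and with [Qb2']: the flow of the former is dropped and that of the latter
   inserted, which leaves conjugation by [W s]. *)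
have hD s : 0 <= s -> tauV Qb1 s (tauV Q2 s (X1 - X0)) = (W s)^H *m X1 *m W s - tauV Qb1 s (tauV Q2 s X0).
  move=> s0; rewrite !tauVB; congr (_ - _).
  rewrite (tauV_id hQ2 s0); last by apply: cX1; apply: comm_mx_sym.
  rewrite -{1}(tauV_id hQb2' s0 (X := X1)); last first.
    apply: cX1; last exact: comm_mx_sym.
    by apply/comm_mx_sym/comm_mxB; [exact: comm_mx_sym|exact: comm_mx_scalar].
  by rewrite tauV.unlock /W adjmxM !mulmxA.
pose x := Om^H *m X1 *m Om.
pose g s := Om^H *m G s *m Om - s%:C%C *: x.
have hg s : 0 <= s <= 2 * pi -> mder g (Om^H *m tauV Qb1 s (tauV Q2 s (X1 - X0)) *m Om - x) s.
  by case/andP=> s0 _; apply: mderB (mder_linear x s); apply/mderMr/mderMl/hG.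
pose b := T * d + 2 * (2 * pi * eps) * (2 * h1 * q1).
have bO := bnd_iso Om1.
have bOV : bnd Om^H 1 by exact: bnd_adj.
have hb s : 0 <= s <= 2 * pi -> bnd (Om^H *m tauV Qb1 s (tauV Q2 s (X1 - X0)) *m Om - x) b.
  case/andP=> s0 sp; rewrite hD // mulmxBr mulmxBl.
  pose y := W s *m Om - Om.
  have by_ : bnd y (2 * pi * eps) by apply: bndW (W_Om s0) _; rewrite ler_wpM2r.
  have WO : W s *m Om = y + Om by rewrite subrK.
  have p0 : 0 <= 2 * pi * eps by rewrite mulr_ge0.
  rewrite sandwich (sandwich_split _ WO) -/x.
  rewrite addrAC addrK /b addrC; apply: bndD.
    apply: bndN; rewrite -(mulr1 (T * d)); apply: bndM => //; rewrite -(mul1r (T * d)); apply: bndM => //.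
    by apply: bnd_tauV => //; apply: bnd_tauV.
  have bWO : bnd (W s *m Om) 1.
    rewrite -(mulr1 1); apply: bndM => //; rewrite -(mulr1 1); apply: bndM => //; apply: bnd_iso; exact: flowVM.
  have -> : 2 * (2 * pi * eps) * (2 * h1 * q1) = (2 * pi * eps) * (2 * h1 * q1) * 1 + 1 * (2 * h1 * q1) * (2 * pi * eps).
    by move: (2 * pi * eps) (2 * h1 * q1) => u v; ring.
  apply: bndD; apply: bndM => //; rewrite ?mul1r ?mulr_ge0 //.
    by apply: bndM => //; apply: bnd_adj.
  by rewrite -(mul1r (2 * h1 * q1)); apply: bndM.
have b0 : 0 <= b by rewrite addr_ge0 // !mulr_ge0.
have /bnd_entry := bnd_mder1 tp0 b0 hg hb.
have eG0 : G 0 = M by rewrite /G !tauV0.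
have eG1 : G (2 * pi) = tauV Qb1 (2 * pi) M.
  by rewrite /G; congr (tauV _ _ _); rewrite tauV.unlock Q2_int adjmx1 mul1mx mulmx1.
have -> : complex.Re ((g (2 * pi) - g 0) 0 0) = ip Om (tauV Qb1 (2 * pi) M *m Om) - ip Om (M *m Om) - 2 * pi * ip Om (X1 *m Om).
  by rewrite /g eG0 eG1 scale0r subr0 Re_entry /ip /x !mulmxA.
have e1 : ip Om (M *m Om) = - ip Om (H2 *m Om).
  have := congr1 (ip Om) HOm; rewrite ip0r /H -/M mulmxDl ipDr => /eqP; rewrite addr_eq0 => /eqP //.
(* Nonnegativity of [H] in the trial state [e^{2 pi i Qb1} Om], where [H2] has the same expectation
   as in [Om] because it commutes with [Qb1]. *)
have e2 : - ip Om (H2 *m Om) <= ip Om (tauV Qb1 (2 * pi) M *m Om).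
  rewrite lerNl -subr_ge0 opprK -ipDr -mulmxDl.
  rewrite -{1}(tauV_id hQb1 tp0 cQb1H2) -tauVD addrC -/H.
  have := H_pos (flow Qb1 (2 * pi) *m Om).
  by rewrite tauV.unlock -!mulmxA (ip_adj (flow _ _)^H) adjmxK.
have e3 : ip Om (J1 *m Om) - T * d <= ip Om (X1 *m Om) <= ip Om (J1 *m Om) + T * d.
  have -> : ip Om (X1 *m Om) = ip Om (J1 *m Om) + ip Om (X0 *m Om).
    (* [H2] commutes with [K1], and [i[H, K1]] has zero expectation because [H] annihilates [Om]. *)
    have -> : X1 = J1 - 'i%C *: cmt H K1 + X0.
      rewrite /X1 /J1 /X0 -scalerBr -scalerDr; congr (_ *: _).
      rewrite /H 2!cmtDl (_ : cmt H2 K1 = 0) ?addr0; last first.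
        by apply/cmt0P; apply: comm_mxB => //; apply: comm_mx_sym.
      by rewrite opprD addrA subrK /K1 cmtBr opprB addrC subrK.
    rewrite mulmxDl ipDr mulmxBl ipBr; congr (_ + _).
    rewrite (_ : ip Om ('i%C *: cmt H K1 *m Om) = 0) ?subr0 //.
    rewrite cmtE scalerBr mulmxBl ipBr -!scalemxAl -(mulmxA K1) HOm mulmx0 scaler0 ip0r subr0.
    rewrite -mulmxA scalemxAr ip_adj hH HOm ipC ip0r //.
  exact: norm_le_itv (ip_bnd Om1 bX0).
rewrite e1 ler_norml => /andP[_]; move: e2 e3 tp0; rewrite /b.
move: (ip Om (tauV _ _ _ *m Om)) (ip Om (H2 *m Om)) (ip Om (X1 *m Om)) (ip Om (J1 *m Om)) => u v w z.
move: (2 * pi) (T * d) => p td; move: (2 * (p * eps) * (2 * h1 * q1)) => c.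
move=> e2 /andP[e3 e4] p0 e5.
have : p * (w - z - td) <= 0 by rewrite mulr_ge0_le0 //; lra.
move=> e6; lra.
Qed.

End OneSided.

(** * Spectral filtering, positivity and integrality *)

Section Spectral.
Variable R : realType.
Local Notation C := R[i].
Local Notation Re := (@complex.Re R).
Local Notation Im := (@complex.Im R).

Definition cnsq (z : C) : R := Re z ^+ 2 + Im z ^+ 2.
Lemma cnsqM x y : cnsq (x * y) = cnsq x * cnsq y.
Proof. by rewrite /cnsq cReM cImM; ring. Qed.
Lemma cnsq_ge0 x : 0 <= cnsq x.
Proof. by rewrite addr_ge0 ?sqr_ge0. Qed.
Lemma nrm_sqrE n (v : 'cV[C]_n) : nrm v ^+ 2 = \sum_i cnsq (v i 0).
Proof. by rewrite nrm_sqr ipE; apply: eq_bigr. Qed.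

Lemma spectral_eigen n (A : 'M[C]_n) j : A^H = A ->
  A *m col j (spectralmx A)^H = spectral_diag A 0 j *: col j (spectralmx A)^H /\
  col j (spectralmx A)^H != 0.
Proof.
move=> hA; have [h h1 h2 _] := spectral_herm hA; split.
  have e : A *m (spectralmx A)^H = (spectralmx A)^H *m diag_mx (spectral_diag A).
    by have /= := congr1 (mulmx^~ (spectralmx A)^H) h; rewrite -(mulmxA _ (spectralmx A)) h1 mulmx1.
  rewrite !colE mulmxA e -mulmxA scalemxAr; congr (_ *m _).
  by apply/colP=> i; rewrite mul_diag_mx !mxE eqxx andbT; case: eqP => [->|_]; rewrite ?mulr0.
apply/eqP=> e; have /matrixP/(_ j j) := h1; rewrite -[in RHS]/(1%:M) !mxE eqxx.
rewrite big1 => [/eqP|k _]; first by rewrite eq_sym oner_eq0.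
by have /colP/(_ k) := e; rewrite !mxE => /eqP; rewrite conjC_eq0 => /eqP ->; rewrite mul0r.
Qed.

Lemma spectral_ip n (A : 'M[C]_n) v : A^H = A ->
  ip v (A *m v) = \sum_j Re (spectral_diag A 0 j) * cnsq ((spectralmx A *m v) j 0).
Proof.
move=> hA; have [h h1 h2 h3] := spectral_herm hA.
have -> : A *m v = (spectralmx A)^H *m (diag_mx (spectral_diag A) *m (spectralmx A *m v)) by rewrite !mulmxA -h.
rewrite ip_adj adjmxK ipE; apply: eq_bigr => j _.
move: (spectralmx A *m v) => w.
have -> : (diag_mx (spectral_diag A) *m w) j 0 = ((Re (spectral_diag A 0 j))%:C%C : C) * w j 0.
  by rewrite mul_diag_mx mxE -h3.
rewrite cReM cImM /= !mul0r subr0 addr0 /cnsq; ring.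
Qed.

Lemma ip_pos n (A : 'M[C]_n) v : A^H = A -> (forall j, 0 <= Re (spectral_diag A 0 j)) ->
  0 <= ip v (A *m v).
Proof.
by move=> hA h; rewrite spectral_ip //; apply: sumr_ge0 => j _; rewrite mulr_ge0 ?cnsq_ge0.
Qed.

Lemma cis_nat k : cis (2 * pi * k%:R) = 1 :> C.
Proof.
elim: k => [|k IH]; first by rewrite mulr0 cis0.
rewrite (mulrSr 1 k) mulrDr mulr1 cisD IH mul1r; apply: complex_eqP; rewrite /= mulr_natl.
  by rewrite cos2pi.
by rewrite sin2pi.
Qed.

Lemma cisN x : cis (- x) = Num.conj (cis x) :> C.
Proof. by apply: complex_eqP; rewrite ?cRe_conj ?cIm_conj /= ?cosN ?sinN. Qed.

Lemma flow_int n (A : 'M[C]_n) : A^H = A ->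
  (forall j, exists k : nat, spectral_diag A 0 j = k%:R \/ spectral_diag A 0 j = - k%:R) ->
  flow A (2 * pi) = 1%:M.
Proof.
move=> hA hz; have [h h1 h2 h3] := spectral_herm hA.
rewrite flow.unlock (_ : diag_mx _ = 1%:M) ?mulmx1 //; apply/matrixP=> i j; rewrite !mxE.
have Rn k : Re (k%:R) = k%:R by rewrite -(rmorph_nat (real_complex R)).
have [k [->|->]] := hz i; rewrite ?cReN Rn ?mulrN ?cisN cis_nat //.
by rewrite rmorph1.
Qed.

Lemma flow_mx0 n t : flow (0 : 'M[C]_n) t = 1%:M.
Proof.
have hA : (0 : 'M[C]_n)^H = 0 by rewrite trmx0 map_mx0.
have [h h1 h2 h3] := spectral_herm hA.
rewrite flow.unlock (_ : diag_mx _ = 1%:M) ?mulmx1 //; apply/matrixP=> i j; rewrite !mxE.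
suff -> : spectral_diag (0 : 'M[C]_n) 0 i = 0 by rewrite /= mulr0 cis0.
have [e1 e2] := spectral_eigen i hA; move/eqP: e1; rewrite mul0mx eq_sym scaler_eq0.
by rewrite (negPf e2) orbF => /eqP.
Qed.

(** Commuting flows multiply, so [e^{2 pi i Q}] factors over the sites; integrality of a total
    charge follows without diagonalizing the site charges jointly. *)
Lemma flow_sum n (I : finType) (P : pred I) (F : I -> 'M[C]_n) t : 0 <= t ->
  (forall i, (F i)^H = F i) -> (forall i j, i != j -> comm_mx (F i) (F j)) ->
  (forall i, flow (F i) t = 1%:M) -> flow (\sum_(i | P i) F i) t = 1%:M.
Proof.
move=> t0 hF hc h1; elim: (index_enum I) (index_enum_uniq I) => [|i s IH] /=.
  by rewrite big_nil flow_mx0.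
case/andP=> his us; rewrite big_cons; case: ifP => Pi; last exact: IH.
rewrite flowD // ?h1 ?mul1mx ?IH //.
  by rewrite adjmx_sum; apply: eq_bigr.
rewrite big_seq_cond; apply: comm_mx_sum => j /andP[js _]; apply: hc.
by apply: contraNneq his => ->.
Qed.

(** Averaging over the times [0] and [t] multiplies an eigenvector of eigenvalue [l] by this factor
    at [x = t * l]; its modulus is that of [cos (x / 2)]. *)
Definition hlf (x : R) : C := (2^-1)%:C%C * (1 + cis x).

Lemma cnsq_hlf x : cnsq (hlf x) = (1 + cos x) / 2.
Proof.
rewrite cnsqM /cnsq cReD cImD /=.
have -> : (1 + cos x) ^+ 2 + (0 + sin x) ^+ 2 = 2 * (1 + cos x).
  by rewrite -[X in X + _]addr0 -(subrr (cos x ^+ 2 + sin x ^+ 2)) {1}cos2Dsin2; ring.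
by field.
Qed.

Lemma avg_flow n (A : 'M[C]_n) ts s : A^H = A ->
  avg ts (flow A) s = (spectralmx A)^H *m
   diag_mx (\row_j (cis (s * Re (spectral_diag A 0 j)) * \prod_(t <- ts) hlf (t * Re (spectral_diag A 0 j)))) *m spectralmx A.
Proof.
move=> hA; elim: ts s => [|t ts IH] s /=.
  rewrite flow.unlock; set r := \row_j _; set r' := \row_j _.
  suff -> : r = r' by []; by apply/rowP=> j; rewrite !mxE big_nil mulr1.
rewrite !IH -mulmxDl -mulmxDr -raddfD /= scalemxAl scalemxAr -linearZ /=.
set r := _ *: _; set r' := \row_j _.
suff -> : r = r' by []; apply/rowP=> j; rewrite !mxE big_cons mulrDl cisD /hlf; ring.
Qed.

Lemma dyadic_scale (y : R) K : pi <= y -> y <= pi * 2 ^+ K ->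
  exists2 j, (j <= K)%N & pi / 2 <= y / 2 ^+ j <= pi.
Proof.
have p0 : 0 < pi :> R by exact: pi_gt0.
elim: K => [|K IH] h1 h2.
  exists 0%N => //; rewrite expr0 divr1; rewrite expr0 mulr1 in h2; rewrite h2 andbT; lra.
have q0 : 0 < 2 ^+ K :> R by rewrite exprn_gt0.
have [h|h] := leP y (pi * 2 ^+ K); first by have [j hj ?] := IH h1 h; exists j => //; apply: leq_trans hj _.
exists K.+1 => //; apply/andP; split; last by rewrite ler_pdivrMr ?exprn_gt0.
rewrite ler_pdivlMr ?exprn_gt0 // exprS.
apply: ltW; apply: le_lt_trans h; rewrite le_eqVlt; apply/orP; left; apply/eqP; by field.
Qed.

Lemma cos_le0 (x : R) : pi / 2 <= x <= pi -> cos x <= 0.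
Proof.
case/andP=> h1 h2; rewrite -(subrK pi x) cosDpi oppr_le0; apply: cos_ge0_pihalf.
by apply/andP; split; lra.
Qed.

Lemma half_le (x : R) : x <= 0 -> (1 + x) / 2 <= 2^-1.
Proof. by move=> h; lra. Qed.

(* One sweep uses the times [pi / g / 2 ^ j], of total length at most [2 * pi / g]: an eigenvalue
   [l >= g] satisfies [cos (t * l) <= 0] at one of them, which costs a factor [1 / 2]. *)
Lemma exists_filter n (A : 'M[C]_n) (g : R) (N : nat) : 0 < g ->
  exists ts : seq R, [/\ forall t, t \in ts -> 0 <= t,
    \sum_(t <- ts) t <= 4 * pi / g * N%:R &
    forall j, g <= Re (spectral_diag A 0 j) ->
      cnsq (\prod_(t <- ts) hlf (t * Re (spectral_diag A 0 j))) <= (2^-1 ^+ N) ^+ 2].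
Proof.
move=> g0; have p0 : 0 < pi :> R by exact: pi_gt0.
pose l j := Re (spectral_diag A 0 j).
(* A crude number of halvings that suffices for every eigenvalue. Its size is harmless: the times
   form a geometric series with sum at most [2 * pi / g]. *)
pose K := \sum_j Num.bound (l j / g).
pose rd := [seq pi / g / 2 ^+ j | j <- iota 0 K.+1].
have cprod (s : seq R) x : cnsq (\prod_(t <- s) hlf (t * x)) = \prod_(t <- s) cnsq (hlf (t * x)).
  apply: (big_morph cnsq cnsqM); rewrite /cnsq /= ; ring.
have hl01 (x : R) : 0 <= cnsq (hlf x) <= 1.
  rewrite cnsq_ge0 cnsq_hlf /=; have := cos_le1 x; lra.
have hp (s : seq R) x : 0 <= \prod_(t <- s) cnsq (hlf (t * x)) <= 1.
  elim/big_rec: _ => [|t y _ /andP[y0 y1]]; first by rewrite ler01 lexx.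
  by have /andP[a b] := hl01 (t * x); rewrite mulr_ge0 // mulr_ile1.
have hrd j : g <= l j -> \prod_(t <- rd) cnsq (hlf (t * l j)) <= 2^-1.
  move=> gl; have lK : l j / g <= 2 ^+ K.
    apply: le_trans (_ : (Num.bound (l j / g))%:R <= _).
      by apply: ltW; apply: archi_boundP; rewrite divr_ge0 // ltW // (lt_le_trans g0).
    apply: le_trans (_ : K%:R <= _); first by rewrite ler_nat /K (bigD1 j) //= leq_addr.
    by rewrite -natrX ler_nat ltnW // ltn_expl.
  have [||k hk hc] := @dyadic_scale (pi * (l j / g)) K.
    by rewrite -[X in X <= _]mulr1; apply: ler_wpM2l; [exact: ltW|rewrite ler_pdivlMr // mul1r].
    by rewrite ler_wpM2l // ltW.
  (* The time that brings [l j] into the window is isolated; the other factors have modulus at most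
     1. *)
  have hperm : perm_eq rd ((pi / g / 2 ^+ k) :: rem (pi / g / 2 ^+ k) rd).
    by apply: perm_to_rem; apply/mapP; exists k; rewrite // mem_iota.
  rewrite (perm_big _ hperm) big_cons -[X in _ <= X]mulr1; apply: ler_pM; rewrite ?cnsq_ge0 //.
  - by apply: prodr_ge0 => t _; case/andP: (hl01 (t * l j)).
  - rewrite cnsq_hlf (_ : pi / g / 2 ^+ k * l j = pi * (l j / g) / 2 ^+ k); last by ring.
    exact/half_le/cos_le0.
  - by case/andP: (hp (rem (pi / g / 2 ^+ k) rd) (l j)).
(* A sweep halves the squared modulus, so [2 N] of them are needed for a factor [2^-N] in
   modulus. *)
exists (flatten (nseq (N + N) rd)); split.
- move=> t /flattenP[s]; rewrite mem_nseq => /andP[_ /eqP ->] /mapP[j _ ->].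
  by rewrite !divr_ge0 // ?ltW // exprn_gt0.
- have hs k : \sum_(t <- [seq pi / g / 2 ^+ j | j <- iota 0 k]) t = (pi / g) * (2 - 2 / 2 ^+ k).
    rewrite big_map; elim: k => [|k IH]; first by rewrite big_nil expr0 divr1 subrr mulr0.
    rewrite -addn1 iotaD big_cat /= IH big_cons big_nil addr0 addn1 exprS invfM.
    by move: (2 ^- k) => x; field; rewrite gt_eqF.
  have hs' : \sum_(t <- rd) t <= 2 * (pi / g).
    rewrite hs (mulrC (pi / g)); apply: ler_wpM2r; first by rewrite divr_ge0 // ltW.
    by rewrite gerBl divr_ge0 // exprn_ge0.
  apply: le_trans (_ : (N + N)%:R * (2 * (pi / g)) <= _); last first.
    by rewrite natrD le_eqVlt; apply/orP; left; apply/eqP; ring.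
  elim: (N + N)%N => [|k IH]; first by rewrite big_nil mul0r.
  by rewrite big_cat /= mulrS mulrDl mul1r lerD.
- move=> j gl; rewrite cprod -exprM muln2 -addnn.
  elim: (N + N)%N => [|k IH]; first by rewrite big_nil expr0.
  rewrite big_cat /= exprS; apply: ler_pM; rewrite ?hrd //.
    by have /andP[] := hp rd (l j).
  by have /andP[] := hp (flatten (nseq k rd)) (l j).
Qed.

Lemma flowV_ker n (A : 'M[C]_n) (W : 'cV[C]_n) u : A^H = A -> A *m W = 0 -> (flow A u)^H *m W = W.
Proof.
move=> hA AW; have [h h1 h2 h3] := spectral_herm hA.
have e : diag_mx (spectral_diag A) *m (spectralmx A *m W) = 0.
  have := congr1 (mulmx (spectralmx A)) AW; rewrite mulmx0 => <-.
  have -> : A *m W = (spectralmx A)^H *m (diag_mx (spectral_diag A) *m (spectralmx A *m W)).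
    by rewrite !mulmxA -h.
  by rewrite (mulmxA (spectralmx A) (spectralmx A)^H) h1 mul1mx.
rewrite flow.unlock !adjmxM adjmxK -!mulmxA.
rewrite (_ : _^H *m (spectralmx A *m W) = spectralmx A *m W); first by rewrite mulmxA h2 mul1mx.
move: (spectralmx A *m W) e => w e; rewrite tr_diag_mx map_diag_mx mul_diag_mx.
apply/colP=> j; rewrite !mxE; have /colP/(_ j) := e; rewrite mul_diag_mx !mxE => /eqP.
rewrite mulf_eq0 => /orP[/eqP -> /=|/eqP ->]; last by rewrite mulr0.
by rewrite mulr0 cis0 rmorph1 mul1r.
Qed.

Lemma herm1_Im (M : 'M[C]_1) : M^H = M -> Im (M 0 0) = 0.
Proof.
move/matrixP/(_ 0 0); rewrite !mxE => /(congr1 Im); rewrite cIm_conj.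
by move: (Im _) => x; lra.
Qed.

Lemma herm1 (M : 'M[C]_1) : M^H = M -> M = (Re (M 0 0))%:C%C *: 1%:M.
Proof.
move=> h; apply/matrixP=> i j; rewrite !ord1 [RHS]mxE [X in _ * X]mxE eqxx mulr1.
by apply: complex_eqP; rewrite //= herm1_Im.
Qed.

Lemma nrm_ortho_le n (x w : 'cV[C]_n) (a : R) : ip x w = 0 -> nrm x <= nrm (x + a%:C%C *: w).
Proof.
move=> h; rewrite -(ler_pXn2r (_ : 0 < 2)%N) ?nnegrE ?nrm_ge0 // !nrm_sqr.
rewrite ipDr !ipDl !ipZr !ipZl (ipC w x) h !mulr0 addr0 add0r lerDl.
by rewrite mulrA -expr2 mulr_ge0 ?sqr_ge0 ?ip_ge0.
Qed.

Lemma nrm_diag_le n (r : 'rV[C]_n) (w : 'cV[C]_n) (e : R) : 0 <= e ->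
  (forall j, w j 0 = 0 \/ cnsq (r 0 j) <= e ^+ 2) -> nrm (diag_mx r *m w) <= e * nrm w.
Proof.
move=> e0 h; rewrite -(ler_pXn2r (_ : 0 < 2)%N) ?nnegrE ?mulr_ge0 ?nrm_ge0 // exprMn.
rewrite !nrm_sqrE mulr_sumr; apply: ler_sum => j _; rewrite mul_diag_mx mxE cnsqM.
have [->|hj] := h j; first by rewrite /cnsq /= expr0n /= addr0 !mulr0.
by rewrite ler_wpM2r ?cnsq_ge0.
Qed.

Lemma bnd_col n (w : 'cV[C]_n) e : nrm w <= e -> bnd w e.
Proof.
move=> h; split=> v; have -> : w *m v = v 0 0 *: w.
  by apply/colP=> i; rewrite !mxE big_ord1 mulrC.
rewrite nrmZ (_ : Num.sqrt _ = nrm v); first by rewrite mulrC ler_wpM2r ?nrm_ge0.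
by rewrite /nrm ipE big_ord1 -!expr2.
Qed.

(** With [lam] the expectation of [Q] in [W], the vector [xi = Q W - lam W] is orthogonal to [W]. As
    [W] spans the kernel, [xi] lives on eigenvalues at least [g], where the filter is at most
    [2^-N]; [W] itself is fixed by the filter. *)
Lemma spectral_filter n (A Q : 'M[C]_n) (W : 'cV[C]_n) (g q : R) (N : nat) :
  0 < g -> 0 <= q -> A^H = A -> Q^H = Q -> bnd Q q -> A *m W = 0 -> W^H *m W = 1%:M ->
  (forall v : 'cV[C]_n, A *m v = 0 -> exists a, v = a *: W) ->
  (forall j, spectral_diag A 0 j = 0 \/ g <= Re (spectral_diag A 0 j)) ->
  exists ts : seq R, exists lam : R, [/\ forall t, t \in ts -> 0 <= t,
    \sum_(t <- ts) t <= 4 * pi / g * N%:R &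
    bnd (avg ts (fun u => tau A u Q) 0 *m W - lam%:C%C *: W) (2^-1 ^+ N * q)].
Proof.
move=> g0 q0 hA hQ bQ AW WW ker gap.
have [ts [ts0 tsT hf]] := exists_filter A N g0.
exists ts, (ip W (Q *m W)); split=> //.
have e0 : 0 <= 2^-1 ^+ N :> R by rewrite exprn_ge0 // invr_ge0.
move: (2^-1 ^+ N) e0 hf => e e0 hf.
have [h h1 h2 h3] := spectral_herm hA.
have FW u : (flow A u)^H *m W = W by exact: flowV_ker.
have -> : avg ts (fun u => tau A u Q) 0 *m W = avg ts (flow A) 0 *m (Q *m W).
  rewrite (avg_lin (L := fun X => X *m W)); last by move=> a X Y; rewrite -scalemxAl mulmxDl.
  rewrite (avg_lin (L := fun X => X *m (Q *m W))); last by move=> a X Y; rewrite -scalemxAl mulmxDl.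
  congr avg; apply/funext=> u; by rewrite tau.unlock -!mulmxA FW.
pose xi := Q *m W - (ip W (Q *m W))%:C%C *: W.
have xW : W^H *m xi = 0.
  rewrite /xi mulmxBr -scalemxAr WW /ip -herm1 ?subrr //.
  by rewrite !adjmxM adjmxK hQ mulmxA.
have aW : avg ts (flow A) 0 *m W = W.
  rewrite (avg_lin (L := fun X => X *m W)); last by move=> a X Y; rewrite -scalemxAl mulmxDl.
  rewrite -[RHS](avg_cst W ts 0); congr avg; apply/funext=> u.
  by rewrite -{1}(FW u) mulmxA flowMV // mul1mx.
have -> : avg ts (flow A) 0 *m (Q *m W) - (ip W (Q *m W))%:C%C *: W = avg ts (flow A) 0 *m xi.
  by rewrite /xi mulmxBr -scalemxAr aW.
have ixW : ip xi W = 0 by rewrite ipC /ip xW mxE.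
have nxi : nrm xi <= q.
  have nW : nrm W = 1 by rewrite /nrm /ip WW mxE /= sqrtr1.
  have := bndE W bQ; rewrite nW mulr1; apply: le_trans.
  have -> : Q *m W = xi + (ip W (Q *m W))%:C%C *: W by rewrite /xi subrK.
  exact: nrm_ortho_le.
apply: bnd_col; apply: le_trans (_ : e * nrm xi <= _); last by rewrite ler_wpM2l.
rewrite avg_flow // -!mulmxA nrm_iso; last by rewrite adjmxK.
rewrite -(nrm_iso xi h2); apply: nrm_diag_le => // j.
have [d0|gj] := gap j; [left|by right; rewrite mxE mul0r cis0 mul1r hf].
have [e1 _] := spectral_eigen j hA; move: e1; rewrite d0 scale0r => /ker [a ea].
have -> : (spectralmx A *m xi) j 0 = ((col j (spectralmx A)^H)^H *m xi) 0 0.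
  by rewrite !mxE; apply: eq_bigr => k _; rewrite !mxE conjCK.
by rewrite ea adjmxZ -scalemxAl xW scaler0 mxE.
Qed.

End Spectral.

(** * Lattice systems *)

Section Charges.
Variable R : realType.
Local Notation C := R[i].
Variables (n : nat) (T : finType) (Phi : {set T} -> 'M[C]_n) (Qx : T -> 'M[C]_n).

Definition QS (Y : {set T}) := \sum_(x in Y) Qx x.
Definition HS (S : pred {set T}) := \sum_(X | S X) Phi X.

Hypothesis PhiPhi : forall X Y : {set T}, [disjoint X & Y] -> comm_mx (Phi X) (Phi Y).
Hypothesis PhiQ : forall (X : {set T}) x, x \notin X -> comm_mx (Phi X) (Qx x).
Hypothesis QQ : forall x y, x != y -> comm_mx (Qx x) (Qx y).

(** Charges at sites outside [X] commute with [Phi X]. Hence [Gam] may be replaced by its part near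
    a cut, and a region by its trace on [X]. *)
Lemma cmt_QS_eq (X Y Y' : {set T}) : (forall x, x \in X -> (x \in Y) = (x \in Y')) ->
  cmt (Phi X) (QS Y) = cmt (Phi X) (QS Y').
Proof.
move=> h; rewrite /QS big_mkcond [in RHS]big_mkcond !cmt_sumr; apply: eq_bigr => x _.
have [xX|xX] := boolP (x \in X); first by rewrite h.
by do 2!case: ifP => _; rewrite ?cmt0r ?(proj1 (cmt0P _ _) (PhiQ xX)).
Qed.

Lemma comm_QS (X Y : {set T}) : (forall x, x \in X -> x \notin Y) -> comm_mx (Phi X) (QS Y).
Proof.
move=> h; apply: comm_mx_sum => x xY; apply: PhiQ; apply: contraL xY; exact: h.
Qed.

Lemma comm_QS_QS (Y Y' : {set T}) : comm_mx (QS Y) (QS Y').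
Proof.
apply: comm_mx_sum => x _; apply: comm_mx_sym; apply: comm_mx_sum => y _.
by have [->|xy] := eqVneq x y; [exact: comm_mx_refl|exact: QQ].
Qed.

Lemma comm_HS_QS (S : pred {set T}) Y : (forall X, S X -> comm_mx (Phi X) (QS Y)) -> comm_mx (HS S) (QS Y).
Proof. by move=> h; apply: comm_mx_sym; apply: comm_mx_sum => X SX; apply/comm_mx_sym/h. Qed.

Lemma comm_HS_HS (S S' : pred {set T}) : (forall X Y, S X -> S' Y -> comm_mx (Phi X) (Phi Y)) -> comm_mx (HS S) (HS S').
Proof.
move=> h; apply: comm_mx_sum => Y SY; apply: comm_mx_sym; apply: comm_mx_sum => X SX.
exact/comm_mx_sym/h.
Qed.

Hypothesis Phi_herm : forall X, (Phi X)^H = Phi X.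
Hypothesis Q_herm : forall x, (Qx x)^H = Qx x.

Lemma HS_herm S : (HS S)^H = HS S.
Proof. by rewrite adjmx_sum; apply: eq_bigr. Qed.
Lemma QS_herm Y : (QS Y)^H = QS Y.
Proof. by rewrite adjmx_sum; apply: eq_bigr. Qed.

Variables (m q : R).
Hypotheses (m0 : 0 <= m) (q0 : 0 <= q).
Hypothesis Phi_bnd : forall X, bnd (Phi X) m.
Hypothesis Q_bnd : forall x, bnd (Qx x) q.

Lemma bnd_QS Y : bnd (QS Y) (#|T|%:R * q).
Proof.
apply: bndW (bnd_sum _ (fun x _ => Q_bnd x)) _.
by rewrite sumr_const -[X in X <= _]mulr_natl ler_wpM2r // ler_nat max_card.
Qed.

Variables (small : pred {set T}) (r v w : nat).
Hypothesis small_card : forall X, small X -> (#|X| <= v)%N.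
Hypothesis small_mem : forall x, (#|[set X | small X && (x \in X)]| <= w)%N.
Hypothesis not_small : forall X, ~~ small X -> Phi X = 0.

(** Nonempty small sets are counted through the points they contain; the extra 1 is the empty
    set. *)
Lemma card_small : (#|[set X | small X]| <= 1 + #|T| * w)%N.
Proof.
have sub : [set X | small X] \subset finset.set0 |: \bigcup_x [set X | small X && (x \in X)].
  apply/fintype.subsetP => X; rewrite !inE => sX; have [->|/set0Pn[x xX]] := eqVneq X finset.set0; first by [].
  by apply/orP; right; apply/bigcupP; exists x => //; rewrite inE sX xX.
apply: leq_trans (subset_leq_card sub) _; apply: leq_trans (leq_card_setU _ _) _.
rewrite cards1 leq_add2l; apply: leq_trans (_ : \sum_(x : T) w <= _)%N; last by rewrite sum_nat_const.
apply: leq_trans (leq_sum _ _ : (\sum_x #|[set X | small X && (x \in X)]| <= _)%N); last by [].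
elim/big_rec2: _ => [|x A B _ le]; first by rewrite cards0.
by apply: leq_trans (leq_card_setU _ _) _; rewrite leq_add2l.
Qed.

Lemma bnd_HS (S : pred {set T}) : (forall X, S X -> small X) -> bnd (HS S) ((1 + #|T| * w)%:R * m).
Proof.
move=> hS; apply: bndW (bnd_sum _ (fun X _ => Phi_bnd X)) _.
rewrite sumr_const -[X in X <= _]mulr_natl ler_wpM2r // ler_nat; apply: leq_trans card_small.
by apply: subset_leq_card; apply/fintype.subsetP => X; rewrite inE; apply: hS.
Qed.

(** A set that is not small carries a vanishing term and needs no neighbours, which keeps the
    cardinality bound uniform. *)
Definition nbr (X : {set T}) : {set {set T}} :=
  if small X then [set Y | small Y && (X :&: Y != finset.set0)] else finset.set0.

Lemma nbr_card X : (#|nbr X| <= v * w)%N.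
Proof.
rewrite /nbr; case: ifP => sX; last by rewrite cards0.
have sub : [set Y | small Y && (X :&: Y != finset.set0)] \subset \bigcup_(x in X) [set Y | small Y && (x \in Y)].
  apply/fintype.subsetP => Y; rewrite !inE => /andP[sY /set0Pn[x]]; rewrite inE => /andP[xX xY].
  by apply/bigcupP; exists x => //; rewrite inE sY xY.
apply: leq_trans (subset_leq_card sub) _.
apply: leq_trans (_ : \sum_(x in X) w <= _)%N; last by rewrite sum_nat_const leq_mul2r small_card // orbT.
apply: leq_trans (leq_sum _ _ : (\sum_(x in X) #|[set Y | small Y && (x \in Y)]| <= _)%N); last by [].
elim/big_rec2: _ => [|x A B _ le]; first by rewrite cards0.
by apply: leq_trans (leq_card_setU _ _) _; rewrite leq_add2l.
Qed.

Lemma nbr_comm X Y : Y \notin nbr X -> comm_mx (Phi X) (Phi Y).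
Proof.
rewrite /nbr; case: ifP => [sX|/negbT sX]; last by rewrite (not_small sX) => _; exact: comm0mx.
rewrite inE negb_and => /orP[/not_small ->|]; first exact: comm_mx0.
by rewrite negbK setI_eq0 => ?; apply: PhiPhi.
Qed.

Variables (rho : T -> nat) (M : nat) (Gam G : {set T}).
Hypothesis rho_small : forall (X : {set T}) x y, small X -> x \in X -> y \in X -> (rho x <= rho y + r)%N.

(** [rho] is an abstract distance to one cut, so that one development serves both. The terms
    assigned to the cut reach out to [M], later a fraction of [L], while the current lives within
    [r]; the gap is what the Lieb-Robinson bound has to cross. *)
Definition Sd (X : {set T}) := small X && [exists x in X, (rho x <= M)%N].

Hypothesis Gsub : G \subset Gam.
Hypothesis Gnear : forall x, x \in Gam -> (rho x <= M + r)%N -> x \in G.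
Hypothesis cross : forall (Y : {set T}) x y z, Sd Y -> x \in Y -> x \in Gam -> y \in Y -> y \notin Gam ->
  z \in Y -> (rho z <= r)%N.
Hypothesis charge : forall X Y : {set T}, X \subset Y -> comm_mx (Phi X) (QS Y).

Lemma Sd_near (X : {set T}) x : Sd X -> x \in X -> (rho x <= M + r)%N.
Proof.
case/andP=> sX /existsP[y /andP[yX hy]] xX.
by apply: leq_trans (rho_small sX xX yX) _; rewrite leq_add2r.
Qed.

Lemma Sd_cmt X : Sd X -> cmt (Phi X) (QS G) = cmt (Phi X) (QS Gam).
Proof.
move=> SX; apply: cmt_QS_eq => x xX; apply/idP/idP => [|h]; first exact: (fintype.subsetP Gsub).
exact: Gnear (Sd_near SX xX).
Qed.

Lemma noncross (X : {set T}) : (X \subset Gam) || [disjoint X & Gam] -> comm_mx (Phi X) (QS Gam).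
Proof.
case/orP=> [|h]; first exact: charge.
by apply: comm_QS => x xX; rewrite (disjointFr h).
Qed.

(** A term inside [Gam] commutes by charge conservation and one outside by locality; what remains
    crosses the boundary of [Gam] and lies within [r] of the cut. *)
Lemma Sd_current X : Sd X -> cmt (Phi X) (QS G) = 0 \/ forall z, z \in X -> (rho z <= r)%N.
Proof.
move=> SX; have [h|] := boolP ((X \subset Gam) || [disjoint X & Gam]).
  by left; rewrite Sd_cmt //; apply/cmt0P/noncross.
rewrite negb_or => /andP[/subsetPn[y yX yG]]; rewrite -setI_eq0 => /set0Pn[x]; rewrite inE => /andP[xX xG].
by right=> z; apply: (cross SX xX xG yX yG).
Qed.

Let J : 'M[C]_n := 'i%C *: cmt (HS Sd) (QS G).

(** In each nonzero term of [J] the charge can be cut down to the support [Y] of that term, and [Y]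
    is disjoint from [X]. *)
Lemma far_comm (X : {set T}) : (forall x, x \in X -> (r < rho x)%N) -> comm_mx (Phi X) J.
Proof.
move=> hX; apply: comm_mxZ; rewrite /HS cmt_suml; apply: comm_mx_sum => Y SY.
have [->|hY] := Sd_current SY; first exact: comm_mx0.
have nXY z : z \in Y -> z \notin X.
  by move=> zY; apply/negP=> /hX; rewrite ltnNge hY.
rewrite (@cmt_QS_eq Y G (G :&: Y)); last by move=> x xY; rewrite inE xY andbT.
apply: comm_cmt; first by apply/comm_mx_sym/PhiPhi; rewrite disjoint_subset; apply/fintype.subsetP=> z /nXY.
by apply: comm_QS => x xX; rewrite inE negb_and; apply/orP; right; apply: contraL xX; apply: nXY.
Qed.

(** A neighbour is closer to the cut by at most [r], so with layers of width [r.+1] each step loses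
    at most one layer; layer 0 is already beyond the reach of the current. *)
Definition lay k (X : {set T}) := [forall x in X, (r.+1 * k.+1 < rho x)%N].

Lemma layP k (X : {set T}) : reflect (forall x, x \in X -> (r.+1 * k.+1 < rho x)%N) (lay k X).
Proof. exact: forall_inP. Qed.

Let hP := ((1 + #|T| * w)%:R * m).
Let qP := (#|T|%:R * q).

Lemma bnd_J : bnd J (2 * hP * qP).
Proof.
apply: bndi; apply: bnd_cmt; rewrite ?mulr_ge0 //; last exact: bnd_QS.
by apply: bnd_HS => X /andP[].
Qed.

Lemma side_bound (S0 : pred {set T}) k t : 0 <= t ->
  (forall X, S0 X -> small X) ->
  (forall (X : {set T}) x, S0 X -> x \in X -> (M < rho x)%N) -> (r.+1 * k.+1 <= M)%N ->
  bnd (cmt (HS S0) (tau (HS Sd) t J))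
    ((1 + #|T| * w)%:R * (2 * m * (2 * hP * qP) * (4 * m * (v * w)%:R * t) ^+ k / k`!%:R)).
Proof.
move=> t0 hS0 far hk; rewrite cmt_suml.
have b0 : 0 <= 2 * hP * qP by rewrite !mulr_ge0.
have lr X : S0 X -> bnd (cmt (Phi X) (tau (HS Sd) t J)) (2 * m * (2 * hP * qP) * (4 * m * (v * w)%:R * t) ^+ k / k`!%:R).
  move=> SX; apply: (lieb_robinson (lay := lay) (nbr := nbr)) => //.
  - exact: bnd_J.
  - move=> Y /layP hY; apply: far_comm => x /hY; apply: leq_trans; by rewrite muln1.
  - move=> j Y /layP hY; apply/layP => x /hY; apply: leq_trans; by rewrite ltnS leq_mul2l leqnSn orbT.
  - move=> j Y Z /layP hY _; rewrite /nbr; case: ifP => // sY; rewrite inE ?in_set0 // => /andP[sZ /set0Pn[y]].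
    rewrite inE => /andP[yY yZ]; apply/layP => z zZ.
    have := hY _ yY; have := rho_small sZ yZ zZ; rewrite (mulnS _ j.+1) => a b.
    by move: a b; clear; lia.
  - exact: nbr_card.
  - exact: nbr_comm.
  - by apply/layP=> x xX; apply: leq_ltn_trans hk _; apply: far xX.
apply: bndW (bnd_sum _ lr) _.
rewrite sumr_const -[X in X <= _]mulr_natl ler_wpM2r //.
  by rewrite divr_ge0 // !mulr_ge0 // exprn_ge0 // !mulr_ge0.
rewrite ler_nat; apply: leq_trans card_small; apply: subset_leq_card; apply/fintype.subsetP => X; rewrite inE; exact: hS0.
Qed.

End Charges.

(* [V] sites; a set of small diameter has at most [v] points and a point lies in at most [w] of
   them; the cuts are [k] interaction ranges away from [H0]; the filter makes [2 N] sweeps. *)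
Definition current_bound (R : realType) (m q g : R) (V v w k N : nat) : R :=
  let hP := (1 + V * w)%:R * m in let qP := V%:R * q in
  let Tm := 4 * pi / g * N%:R in
  let d := (1 + V * w)%:R * (2 * m * (2 * hP * qP) * (4 * m * (v * w)%:R * Tm) ^+ k / k`!%:R) in
  let eps := Tm * (2 * (Tm * d)) + 2^-1 ^+ N * qP in
  2 * (Tm * d) + 2 * (2 * pi * eps) * (2 * hP * qP).

Lemma norm_le_opp (R : realType) (x y b : R) : - b <= x -> - b <= y -> x + y = 0 -> `|x| <= b.
Proof. by move=> hx hy e; rewrite ler_norml; apply/andP; split; lra. Qed.

(** * Splitting the system at both cuts *)

Section TwoSided.
Variable R : realType.
Local Notation C := R[i].
Variables (n : nat) (T : finType) (Phi : {set T} -> 'M[C]_n) (Qx : T -> 'M[C]_n).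
Hypothesis PhiPhi : forall X Y : {set T}, [disjoint X & Y] -> comm_mx (Phi X) (Phi Y).
Hypothesis PhiQ : forall (X : {set T}) x, x \notin X -> comm_mx (Phi X) (Qx x).
Hypothesis QQ : forall x y, x != y -> comm_mx (Qx x) (Qx y).
Hypothesis Phi_herm : forall X, (Phi X)^H = Phi X.
Hypothesis Q_herm : forall x, (Qx x)^H = Qx x.
Variables (m q g : R).
Hypotheses (m0 : 0 <= m) (q0 : 0 <= q) (g0 : 0 < g).
Hypothesis Phi_bnd : forall X, bnd (Phi X) m.
Hypothesis Q_bnd : forall x, bnd (Qx x) q.
Hypothesis Q_int : forall x, flow (Qx x) (2 * pi) = 1%:M.
Hypothesis charge : forall X Y : {set T}, X \subset Y -> comm_mx (Phi X) (QS Qx Y).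
Variables (small : pred {set T}) (r v w : nat).
Hypothesis small_card : forall X, small X -> (#|X| <= v)%N.
Hypothesis small_mem : forall x, (#|[set X | small X && (x \in X)]| <= w)%N.
Hypothesis not_small : forall X, ~~ small X -> Phi X = 0.
Variables (rho1 rho2 : T -> nat) (M h : nat) (Gam : {set T}).
Hypothesis rho_sum : forall x, (rho1 x + rho2 x = h)%N.
Hypothesis rho1_small : forall (X : {set T}) x y, small X -> x \in X -> y \in X -> (rho1 x <= rho1 y + r)%N.
Hypothesis rho2_small : forall (X : {set T}) x y, small X -> x \in X -> y \in X -> (rho2 x <= rho2 y + r)%N.
Hypothesis cross : forall (X : {set T}) x y, small X -> x \in X -> x \in Gam -> y \in X -> y \notin Gam ->
  (forall z, z \in X -> (rho1 z <= r)%N) \/ (forall z, z \in X -> (rho2 z <= r)%N).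
Hypothesis Mh : (M + r + (M + r) < h)%N.
Hypothesis rM : (r <= M)%N.
Variable Om : 'cV[C]_n.
Let H := \sum_X Phi X.
Hypotheses (HOm : H *m Om = 0) (Om1 : Om^H *m Om = 1%:M).
Hypothesis ker : forall u : 'cV[C]_n, H *m u = 0 -> exists a, u = a *: Om.
Hypothesis gap : forall j, spectral_diag H 0 j = 0 \/ g <= complex.Re (spectral_diag H 0 j).

Let S1 := Sd small rho1 M.
Let S2 := Sd small rho2 M.
Let S0 X := [&& small X, ~~ S1 X & ~~ S2 X].
(** [Gam] is divided according to the nearer cut, so that terms near one cut never meet the charge
    of the other. *)
Let G1 := [set x in Gam | (rho1 x < rho2 x)%N].
Let G2 := [set x in Gam | ~~ (rho1 x < rho2 x)%N].
Let H1 := HS Phi S1.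
Let H2 := HS Phi S2.
Let H0 := HS Phi S0.
Let Q1 := QS Qx G1.
Let Q2 := QS Qx G2.

Let near1 (X : {set T}) x : S1 X -> x \in X -> (rho1 x <= M + r)%N.
Proof. exact: Sd_near. Qed.
Let near2 (X : {set T}) x : S2 X -> x \in X -> (rho2 x <= M + r)%N.
Proof. exact: Sd_near. Qed.

Let S12 X : S1 X -> ~~ S2 X.
Proof.
move=> s1; apply/negP => s2; have /andP[_ /existsP[x /andP[xX hx]]] := s1.
have := near2 s2 xX; have := rho_sum x; move: Mh hx; clear; lia.
Qed.

Let HE : H = H1 + H0 + H2.
Proof.
rewrite /H (bigID S1) /=; rewrite -addrA; congr (_ + _).
rewrite (bigID S2) /= addrC; congr (_ + _).
  rewrite [RHS]big_mkcond [LHS]big_mkcond; apply: eq_bigr => X _ /=.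
  rewrite /S0; case: (boolP (small X)) => //= sX; rewrite (not_small sX); by case: ifP.
apply: eq_bigl => X; case: (boolP (S2 X)) => [s2|]; rewrite ?andbF // andbT.
by apply/negP => /S12; rewrite s2.
Qed.

Let QE : QS Qx Gam = Q1 + Q2.
Proof.
rewrite /QS (bigID (fun x => rho1 x < rho2 x)%N) /=; congr (_ + _).
  by apply: eq_bigl => x; rewrite inE.
by apply: eq_bigl => x; rewrite inE.
Qed.

Let cHH : comm_mx H1 H2.
Proof.
apply: comm_HS_HS => X Y s1 s2; apply: PhiPhi; rewrite disjoint_subset; apply/fintype.subsetP => x xX.
apply/negP => xY; have := near1 s1 xX; have := near2 s2 xY; have := rho_sum x; move: Mh; clear; lia.
Qed.
Let cH1Q2 : comm_mx H1 Q2.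
Proof.
apply: comm_HS_QS => X s1; apply: comm_QS => // x xX; rewrite inE negb_and negbK.
have := near1 s1 xX; have := rho_sum x; move: Mh; clear => a b c; apply/orP; right; lia.
Qed.
Let cH2Q1 : comm_mx H2 Q1.
Proof.
apply: comm_HS_QS => X s2; apply: comm_QS => // x xX; rewrite inE negb_and.
have := near2 s2 xX; have := rho_sum x; move: Mh; clear => a b c; apply/orP; right; lia.
Qed.
Let cQQ : comm_mx Q1 Q2.
Proof. exact: comm_QS_QS. Qed.

Let noncross0 (X : {set T}) : small X -> ~~ S1 X -> ~~ S2 X -> (X \subset Gam) || [disjoint X & Gam].
Proof.
move=> sX s1 s2; apply/negPn; rewrite negb_or; apply/negP.
case/andP=> /subsetPn[y yX yG]; rewrite -setI_eq0 => /set0Pn[x]; rewrite inE => /andP[xX xG].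
have [h'|h'] := cross sX xX xG yX yG.
  by case/negP: s1; rewrite /S1 /Sd sX; apply/existsP; exists x; rewrite xX /= (leq_trans (h' _ xX)).
by case/negP: s2; rewrite /S2 /Sd sX; apply/existsP; exists x; rewrite xX /= (leq_trans (h' _ xX)).
Qed.

Let cH0Q : comm_mx H0 (Q1 + Q2).
Proof.
rewrite -QE; apply: comm_HS_QS => X /and3P[sX s1 s2].
by apply: noncross => //; apply: noncross0.
Qed.

Let Gnear1 x : x \in Gam -> (rho1 x <= M + r)%N -> x \in G1.
Proof. by rewrite inE => -> /=; have := rho_sum x; move: Mh; clear; lia. Qed.
Let Gnear2 x : x \in Gam -> (rho2 x <= M + r)%N -> x \in G2.
Proof. by rewrite inE => -> /=; have := rho_sum x; move: Mh; clear; lia. Qed.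

Let cross1 (Y : {set T}) x y z : S1 Y -> x \in Y -> x \in Gam -> y \in Y -> y \notin Gam ->
  z \in Y -> (rho1 z <= r)%N.
Proof.
move=> s1 xY xG yY yG zY; have /andP[sY _] := s1.
have [h'|h'] := cross sY xY xG yY yG; first exact: h'.
have := near1 s1 xY; have := h' _ xY; have := rho_sum x; move: Mh; clear; lia.
Qed.
Let cross2 (Y : {set T}) x y z : S2 Y -> x \in Y -> x \in Gam -> y \in Y -> y \notin Gam ->
  z \in Y -> (rho2 z <= r)%N.
Proof.
move=> s2 xY xG yY yG zY; have /andP[sY _] := s2.
have [h'|h'] := cross sY xY xG yY yG; last exact: h'.
have := near2 s2 xY; have := h' _ xY; have := rho_sum x; move: Mh; clear; lia.
Qed.

(** The identity is exact although [S1] reaches out to [M] and the strip only to [r]: a set in [S1]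
    missing the strip does not cross the boundary of [Gam], so its commutator vanishes, and a small
    set meeting the strip is in [S1] because [r <= M]. *)
Lemma current_strip (St : {set T}) : (forall x, (x \in St) = (rho1 x <= r)%N) ->
  'i%C *: \sum_(X | X :&: St != finset.set0) cmt (Phi X) (QS Qx Gam) = 'i%C *: cmt H1 Q1.
Proof.
move=> hSt; congr (_ *: _); rewrite /H1 /HS cmt_suml big_mkcond [RHS]big_mkcond; apply: eq_bigr => X _.
have [sX|sX] := boolP (small X); last by rewrite not_small // !cmt0l; do 2!case: ifP.
have [s1|s1] := boolP (S1 X).
  have -> : cmt (Phi X) Q1 = cmt (Phi X) (QS Qx Gam).
    apply: (@Sd_cmt _ _ _ _ _ PhiQ small r rho1 M Gam G1) => //.
    by apply/fintype.subsetP => x; rewrite inE => /andP[].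
  case: ifP => // /negbT; rewrite negbK => /eqP e; apply/esym/cmt0P/noncross => //.
  apply/negPn; rewrite negb_or; apply/negP.
  case/andP=> /subsetPn[y yX yG]; rewrite -setI_eq0 => /set0Pn[x]; rewrite inE => /andP[xX xG].
  have := cross1 s1 xX xG yX yG xX; rewrite -hSt => xS.
  by have : x \in X :&: St; [rewrite inE xX xS|rewrite e inE].
case: ifP => // /set0Pn[x]; rewrite inE => /andP[xX]; rewrite hSt => hx.
by case/negP: s1; rewrite /S1 /Sd sX; apply/existsP; exists x; rewrite xX /= (leq_trans hx).
Qed.

Lemma two_sided (k N : nat) : (r.+1 * k.+1 <= M)%N ->
  `|ip Om ('i%C *: cmt H1 Q1 *m Om)| <= current_bound m q g #|T| v w k N.
Proof.
move=> hk; pose hP := (1 + #|T| * w)%:R * m; pose qP := #|T|%:R * q; pose Tm := 4 * pi / g * N%:R.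
pose d := (1 + #|T| * w)%:R * (2 * m * (2 * hP * qP) * (4 * m * (v * w)%:R * Tm) ^+ k / k`!%:R).
pose eps := Tm * (2 * (Tm * d)) + 2^-1 ^+ N * qP.
rewrite (_ : current_bound _ _ _ _ _ _ _ _ = 2 * (Tm * d) + 2 * (2 * pi * eps) * (2 * hP * qP)) //.
have pi0 : 0 < pi :> R by exact: pi_gt0.
have Tm0 : 0 <= Tm by rewrite mulr_ge0 // divr_ge0 ?(ltW g0) // mulr_ge0 // ltW.
have hP0 : 0 <= hP by rewrite mulr_ge0.
have qP0 : 0 <= qP by rewrite mulr_ge0.
(* The Lieb-Robinson error grows with time; its value at the longest averaging time serves as the
   uniform [d]. *)
have dmono t : 0 <= t <= Tm -> (1 + #|T| * w)%:R * (2 * m * (2 * hP * qP) * (4 * m * (v * w)%:R * t) ^+ k / k`!%:R) <= d.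
  case/andP=> t0 tT; apply: ler_wpM2l => //; apply: ler_wpM2r; first by rewrite invr_ge0.
  apply: ler_wpM2l; first by rewrite !mulr_ge0.
  have c0 : 0 <= 4 * m * (v * w)%:R by rewrite !mulr_ge0.
  by apply: lerXn2r; rewrite ?nnegrE ?(mulr_ge0 c0) //; apply: ler_wpM2l.
have d0 : 0 <= d.
  apply: mulr_ge0 => //; apply: divr_ge0 => //; apply: mulr_ge0; first by rewrite !mulr_ge0.
  by apply: exprn_ge0; apply: mulr_ge0 => //; rewrite !mulr_ge0.
have S0s X : S0 X -> small X by case/and3P.
have hd1 s : 0 <= s <= Tm -> bnd (cmt H0 (tau H1 s ('i%C *: cmt H1 Q1))) d.
  move=> hs; have s0 : 0 <= s by case/andP: hs.
  apply: bndW (dmono s hs).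
  apply: (@side_bound _ _ _ _ _ PhiPhi PhiQ Phi_herm m q m0 q0 Phi_bnd Q_bnd small r v w
     small_card small_mem not_small rho1 M Gam G1 rho1_small _ Gnear1 cross1 charge S0 k s s0 S0s _ hk).
    by apply/fintype.subsetP => x; rewrite inE => /andP[].
  move=> X x /and3P[sX s1 _] xX; rewrite ltnNge; apply/negP => hx.
  by case/negP: s1; rewrite /S1 /Sd sX; apply/existsP; exists x; rewrite xX.
have hd2 s : 0 <= s <= Tm -> bnd (cmt H0 (tau H2 s ('i%C *: cmt H2 Q2))) d.
  move=> hs; have s0 : 0 <= s by case/andP: hs.
  apply: bndW (dmono s hs).
  apply: (@side_bound _ _ _ _ _ PhiPhi PhiQ Phi_herm m q m0 q0 Phi_bnd Q_bnd small r v w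
     small_card small_mem not_small rho2 M Gam G2 rho2_small _ Gnear2 cross2 charge S0 k s s0 S0s _ hk).
    by apply/fintype.subsetP => x; rewrite inE => /andP[].
  move=> X x /and3P[sX _ s2] xX; rewrite ltnNge; apply/negP => hx.
  by case/negP: s2; rewrite /S2 /Sd sX; apply/existsP; exists x; rewrite xX.
have hH : H^H = H by rewrite /H adjmx_sum; apply: eq_bigr.
have hQ : (Q1 + Q2)^H = Q1 + Q2 by rewrite -QE; apply: QS_herm.
have bQ : bnd (Q1 + Q2) qP by rewrite -QE; apply: bnd_QS.
have [ts [lam [ts0 tsT hf]]] := spectral_filter N g0 qP0 hH hQ bQ HOm Om1 ker gap.
have pos u : 0 <= ip u (H *m u).
  apply: ip_pos => // j; have [->|] := gap j; first by [].
  by apply: le_trans; exact: ltW.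
have flow_QS Y : flow (QS Qx Y) (2 * pi) = 1%:M.
  by apply: flow_sum => //; rewrite mulr_ge0 // ltW.
have e0 : 0 <= 2^-1 ^+ N * qP by rewrite mulr_ge0 // exprn_ge0 // invr_ge0.
have hh1 : bnd H1 hP by apply: (bnd_HS m0 Phi_bnd small_mem) => X /andP[].
have hh2 : bnd H2 hP by apply: (bnd_HS m0 Phi_bnd small_mem) => X /andP[].
have q1 : bnd Q1 qP by apply: bnd_QS.
have q2 : bnd Q2 qP by apply: bnd_QS.
have hH1 : H1^H = H1 by apply: HS_herm.
have hH2 : H2^H = H2 by apply: HS_herm.
have hH0 : H0^H = H0 by apply: HS_herm.
have hQ1 : Q1^H = Q1 by apply: QS_herm.
have hQ2 : Q2^H = Q2 by apply: QS_herm.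
have HE' : H = H2 + H0 + H1 by rewrite HE addrC addrA addrAC (addrC H2) addrAC (addrC _ H2) addrA.
have e1 := @one_sided _ n H1 H2 H0 Q1 Q2 Om hH1 hH2 hH0 hQ1 hQ2 cHH cH1Q2 cH2Q1 cQQ cH0Q
  Tm d (2^-1 ^+ N * qP) lam hP qP ts Tm0 d0 e0 hP0 qP0 hd1 hd2 ts0 tsT.
have e2 := @one_sided _ n H2 H1 H0 Q2 Q1 Om hH2 hH1 hH0 hQ2 hQ1 (comm_mx_sym cHH) cH2Q1 cH1Q2 (comm_mx_sym cQQ).
rewrite (addrC Q2) in e2.
have {}e2 := e2 cH0Q Tm d (2^-1 ^+ N * qP) lam hP qP ts Tm0 d0 e0 hP0 qP0 hd2 hd1 ts0 tsT.
rewrite -HE in e1; rewrite -HE' in e2.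
have {}e1 := e1 HOm Om1 hf (flow_QS G2) pos hh1 q1.
have {}e2 := e2 HOm Om1 hf (flow_QS G1) pos hh2 q2.
have e3 : ip Om ('i%C *: cmt H1 Q1 *m Om) + ip Om ('i%C *: cmt H2 Q2 *m Om) = 0.
  have e : 'i%C *: cmt H1 Q1 + 'i%C *: cmt H2 Q2 = 'i%C *: cmt H (Q1 + Q2).
    rewrite HE 2!cmtDl (proj1 (cmt0P _ _) cH0Q) addr0 !cmtDr.
    by rewrite (proj1 (cmt0P _ _) cH1Q2) (proj1 (cmt0P _ _) cH2Q1) addr0 add0r scalerDr.
  rewrite -ipDr -mulmxDl e cmtE scalerBr mulmxBl ipBr -!scalemxAl -(mulmxA _ H) HOm mulmx0 scaler0 ip0r subr0.
  by rewrite -mulmxA scalemxAr ip_adj hH HOm ipC ip0r.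
move: e1 e2 e3; rewrite -/eps.
move: (ip Om _) (ip Om _) => x y e1 e2 e3.
have tp : 0 < 2 * pi :> R by rewrite mulr_gt0.
move: (2 * (Tm * d) + _) e1 e2 => b; rewrite -!mulrN !ler_pM2l // => e1 e2.
exact: norm_le_opp e1 e2 e3.
Qed.

End TwoSided.

(** * Exponential smallness of the error *)

Section Decay.
Variable R : realType.

(** With [i] the integer part of [N / (p + 1)], one has [N + 1 <= (p + 1) (i + 1) <= (p + 1) 2^i];
    raise this to the power [p + 1]. *)
Lemma poly_le_exp p N : (N.+1 ^ p.+1 <= p.+1 ^ p.+1 * 2 ^ N)%N.
Proof.
set i := (N %/ p.+1)%N.
have h1 : (N.+1 <= p.+1 * 2 ^ i)%N.
  apply: leq_trans (_ : p.+1 * i.+1 <= _)%N; first by rewrite mulnC ltn_ceil.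
  by rewrite leq_mul2l ltn_expl.
apply: leq_trans (_ : (p.+1 * 2 ^ i) ^ p.+1 <= _)%N; first by rewrite leq_exp2r.
rewrite expnMn leq_mul2l -expnM leq_exp2l // leq_trunc_div orbT //.
Qed.

(** Undoes the three roundings in the choice of [N] as a fraction of [L]. *)
Lemma chain_le r D L K k N : (k < D * N.+1)%N -> (K < r.+1 * k.+2)%N -> (L < 8 * K.+1)%N ->
  (L <= 16 * r.+1 * D.+1 * N.+1)%N.
Proof.
move=> h1 h2 h3.
have h4 : (k.+2 <= 2 * (D.+1 * N.+1))%N by nia.
have h5 : (r.+1 * k.+2 <= r.+1 * (2 * (D.+1 * N.+1)))%N by rewrite leq_mul2l h4 orbT.
have -> : (16 * r.+1 * D.+1 * N.+1 = 8 * (r.+1 * (2 * (D.+1 * N.+1))))%N by ring.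
lia.
Qed.

(** [k^k / k!] is a term of the series of [e^k], so [x <= k / (2 e)] leaves [2^-k]. *)
Lemma pow_fact_le (x : R) k : 0 <= x -> x * (2 * expR 1) <= k%:R -> x ^+ k / k`!%:R <= 2^-1 ^+ k.
Proof.
move=> x0 hx; have E0 : 0 < expR 1 :> R := expR_gt0 _.
have hk : k%:R ^+ k / k`!%:R <= expR 1 ^+ k :> R.
  rewrite -expRM_natl mulr1; case: k {hx} => [|k]; first by rewrite expr0 fact0 divr1 expR0.
  apply: le_trans (expR_ge1Dxn k _); last by [].
  by rewrite lerDr.
have h : x <= k%:R / (2 * expR 1) by rewrite ler_pdivlMr // mulr_gt0.
apply: le_trans (_ : (k%:R / (2 * expR 1)) ^+ k / k`!%:R <= _).
  by rewrite ler_wpM2r ?invr_ge0 // lerXn2r // ?nnegrE // divr_ge0 // mulr_ge0 // ltW.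
have -> : (k%:R / (2 * expR 1)) ^+ k / k`!%:R = k%:R ^+ k / k`!%:R * (expR 1 ^+ k)^-1 * 2^-1 ^+ k :> R.
  rewrite invfM !exprMn !exprVn.
  by move: (k%:R ^+ k) (k`!%:R^-1) ((expR 1 ^+ k)^-1) (2 ^- k) => a b c d; ring.
rewrite -[X in _ <= X]mul1r ler_wpM2r ?exprn_ge0 ?invr_ge0 //.
by rewrite ler_pdivrMr ?exprn_gt0 // mul1r.
Qed.

(** [P] bounds the number of small sets, [X] is the Lieb-Robinson factor and [z] the filter factor.
    In [d] one volume counts the terms of [H0] and two come from the norm of the current; [eps] adds
    [L^2] from the two time integrations, and the final norms add two more volumes: [L^2 V^5] in
    all. *)
Lemma bound_arith (m q w1 c2 P X z V L N : R) : 0 <= m -> 0 <= q -> 0 <= w1 -> 0 <= c2 ->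
  0 <= P -> 0 <= X -> 0 <= z -> 0 <= N -> 1 <= V -> 1 <= L -> N <= L -> P <= w1 * V -> X <= z ->
  forall c1 c3 d eps : R, c1 = w1 * (2 * m * (2 * (w1 * m) * q)) -> c3 = 2 * c2 ^+ 2 * c1 + q ->
  d = P * (2 * m * (2 * (P * m) * (V * q)) * X) -> eps = c2 * N * (2 * (c2 * N * d)) + z * (V * q) ->
  2 * (c2 * N * d) + 2 * (2 * pi * eps) * (2 * (P * m) * (V * q)) <=
  (2 * c2 * c1 + 2 * (2 * pi * c3) * (2 * (w1 * m) * q)) * L ^+ 2 * V ^+ 5 * z.
Proof.
move=> m0 q0 w10 c20 P0 X0 z0 N0 V1 L1 NL PV Xz c1 c3 d eps Ec1 Ec3 Ed Ee.
have pi0 : 0 <= pi :> R := pi_ge0 R.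
have V0 : 0 <= V by apply: le_trans V1.
have L0 : 0 <= L by apply: le_trans L1.
have c10 : 0 <= c1 by rewrite Ec1 !mulr_ge0.
have d0 : 0 <= d by rewrite Ed !mulr_ge0.
have V35 : V ^+ 3 <= V ^+ 5 by rewrite ler_weXn2l.
have V13 : V <= V ^+ 3 by rewrite -[X in X <= _]expr1 ler_weXn2l.
have L12 : L <= L ^+ 2 by rewrite -[X in X <= _]expr1 ler_weXn2l.
have L02 : 1 <= L ^+ 2 by rewrite exprn_ege1.
have b0 : 0 <= 2 * (P * m) * (V * q) by rewrite !mulr_ge0.
have hb : 2 * (P * m) * (V * q) <= 2 * (w1 * m) * q * V ^+ 2.
  rewrite (_ : _ * _ * V ^+ 2 = 2 * (w1 * V * m) * (V * q)); last by ring.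
  by apply: ler_wpM2r; [rewrite mulr_ge0|apply: ler_wpM2l => //; apply: ler_wpM2r].
have hd : d <= c1 * V ^+ 3 * z.
  rewrite (_ : c1 * V ^+ 3 * z = w1 * V * (2 * m * (2 * (w1 * m) * q * V ^+ 2) * z)); last by rewrite Ec1; ring.
  rewrite Ed;  apply: ler_pM => //; first by rewrite !mulr_ge0.
  apply: ler_pM => //; first by rewrite !mulr_ge0.
  by apply: ler_wpM2l => //; rewrite mulr_ge0.
have hT : c2 * N <= c2 * L by apply: ler_wpM2l.
have T0 : 0 <= c2 * N by rewrite mulr_ge0.
have hTd : c2 * N * d <= c2 * L * (c1 * V ^+ 3 * z) by apply: ler_pM.
have he : eps <= c3 * L ^+ 2 * V ^+ 3 * z.
  rewrite (_ : c3 * L ^+ 2 * V ^+ 3 * z = c2 * L * (2 * (c2 * L * (c1 * V ^+ 3 * z))) + L ^+ 2 * (V ^+ 3 * q) * z); last by rewrite Ec3; ring.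
  rewrite Ee;  apply: lerD; first by apply: ler_pM => //; [rewrite !mulr_ge0|apply: ler_wpM2l].
  rewrite mulrC ler_wpM2r // -[X in X <= _]mul1r; apply: ler_pM => //; first by rewrite mulr_ge0.
  by rewrite ler_wpM2r.
have e0 : 0 <= eps by rewrite Ee addr_ge0 // !mulr_ge0.
rewrite (_ : (_ + _) * L ^+ 2 * V ^+ 5 * z = 2 * (c2 * L ^+ 2 * (c1 * V ^+ 5 * z)) + 2 * (2 * pi * (c3 * L ^+ 2 * V ^+ 3 * z)) * (2 * (w1 * m) * q * V ^+ 2)); last by ring.
apply: lerD.
  apply: ler_wpM2l => //; apply: le_trans hTd _; apply: ler_pM; rewrite ?mulr_ge0 ?exprn_ge0 //.
    exact: ler_wpM2l.
  by rewrite ler_wpM2r // ler_wpM2l.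
apply: ler_pM => //; first by rewrite !mulr_ge0.
by apply: ler_wpM2l => //; apply: ler_wpM2l => //; rewrite mulr_ge0.
Qed.

Lemma current_bound_le (m q g : R) (V v w k N L : nat) : 0 <= m -> 0 <= q -> 0 < g ->
  (0 < V)%N -> (0 < L)%N -> (N <= L)%N ->
  (4 * m * (v * w)%:R * (4 * pi / g * N%:R)) ^+ k / k`!%:R <= 2^-1 ^+ N ->
  forall w1 c2 c1 c3 : R, w1 = (1 + w)%:R -> c2 = 4 * pi / g ->
  c1 = w1 * (2 * m * (2 * (w1 * m) * q)) -> c3 = 2 * c2 ^+ 2 * c1 + q ->
  current_bound m q g V v w k N <= (2 * c2 * c1 + 2 * (2 * pi * c3) * (2 * (w1 * m) * q)) * L%:R ^+ 2 * V%:R ^+ 5 * 2^-1 ^+ N.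
Proof.
move=> m0 q0 g0 V0 L0 NL; set X := (_ ^+ k) => hx w1 c2 c1 c3 Ew1 Ec2 Ec1 Ec3.
have p0 : 0 < pi :> R := pi_gt0 R.
have c20 : 0 <= c2 by rewrite Ec2 divr_ge0 ?(ltW g0) // mulr_ge0 // ltW.
have w10 : 0 <= w1 by rewrite Ew1.
rewrite /current_bound -/X -Ec2.
set P : R := (1 + V * w)%:R; set z := 2^-1 ^+ N.
have z0 : 0 <= z by rewrite exprn_ge0 // invr_ge0.
have V1 : 1 <= V%:R :> R by rewrite ler1n.
have L1 : 1 <= L%:R :> R by rewrite ler1n.
have hP : P <= w1 * V%:R.
  by rewrite /P Ew1 -natrM ler_nat mulnDl mul1n leq_add // mulnC.
have P0 : 0 <= P by [].
have NL' : N%:R <= L%:R :> R by rewrite ler_nat.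
have Vn0 : 0 <= V%:R :> R by [].
have Nn0 : 0 <= N%:R :> R by [].
have X0 : 0 <= X / k`!%:R.
  by rewrite divr_ge0 // exprn_ge0 // -Ec2 !mulr_ge0.
rewrite -!(mulrA _ X); move: (X / k`!%:R) X0 hx => {}X X0 hx.
move: (V%:R) (L%:R) (N%:R) => v' l n' in V1 L1 NL' Vn0 Nn0 hP *.
exact: bound_arith Ec1 Ec3 (erefl _) (erefl _).
Qed.

Lemma current_bound_decay (m q g : R) (d v w r K : nat) : 0 <= m -> 0 <= q -> 0 < g ->
  exists Cst : R, forall L, (16 * r.+1 <= L)%N -> exists k N : nat,
    (r.+1 * k.+1 <= L %/ 8)%N /\ current_bound m q g (L ^ d) v w k N * L%:R ^+ K <= Cst.
Proof.
move=> m0 q0 g0; have p0 : 0 < pi :> R := pi_gt0 R.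
pose c2 := 4 * pi / g; pose kap := 4 * m * (v * w)%:R * c2 * (2 * expR 1).
have c20 : 0 <= c2 by rewrite divr_ge0 ?(ltW g0) // mulr_ge0 // ltW.
have E0 : 0 <= expR 1 :> R := expR_ge0 _.
have kap0 : 0 <= kap by apply: mulr_ge0; [apply: mulr_ge0 => //; rewrite !mulr_ge0|rewrite mulr_ge0].
(* With [N] the integer part of [k / D], the base of the Lieb-Robinson power is at most [k / (2 e)],
   as [pow_fact_le] asks. The successor keeps the divisor positive. *)
pose D := (Num.bound kap).+1.
have hD : kap <= D%:R by apply: ltW; apply: lt_le_trans (archi_boundP kap0) _; rewrite ler_nat.
pose w1 : R := (1 + w)%:R.
pose c1 := w1 * (2 * m * (2 * (w1 * m) * q)).
pose c3 := 2 * c2 ^+ 2 * c1 + q.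
pose c4 := 2 * c2 * c1 + 2 * (2 * pi * c3) * (2 * (w1 * m) * q).
have c10 : 0 <= c1 by rewrite !mulr_ge0.
have c30 : 0 <= c3 by rewrite addr_ge0 // mulr_ge0 // mulr_ge0 // exprn_ge0.
have c40 : 0 <= c4.
  apply: addr_ge0; first by apply: mulr_ge0 => //; apply: mulr_ge0.
  apply: mulr_ge0; last by rewrite !mulr_ge0.
  apply: mulr_ge0 => //; apply: mulr_ge0 => //; apply: mulr_ge0 => //; exact: ltW.
(* [p.+1] collects the powers of [L]: two from time, [5 * d] from the volume, [K] from the claimed
   rate. *)
pose p := (1 + 5 * d + K)%N.
pose c5 := (16 * r.+1 * D.+1)%N.
exists (c4 * (c5 ^ p.+1 * p.+1 ^ p.+1)%:R) => L hL.
pose k := ((L %/ 8) %/ r.+1).-1; pose N := (k %/ D)%N.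
have q1 : (0 < (L %/ 8) %/ r.+1)%N by rewrite divn_gt0 // leq_divRL //; move: hL; clear; lia.
have hk : (r.+1 * k.+1 <= L %/ 8)%N by rewrite /k prednK // mulnC leq_trunc_div.
exists k, N; split=> //.
have Nk : (N <= k)%N by apply: leq_div.
have kL : (k <= L)%N.
  apply: leq_trans (leq_pred _) _; apply: leq_trans (leq_div _ _) _; exact: leq_div.
have hx : (4 * m * (v * w)%:R * (4 * pi / g * N%:R)) ^+ k / k`!%:R <= 2^-1 ^+ N.
  apply: le_trans (_ : 2^-1 ^+ k <= _); last first.
    by rewrite ler_wiXn2l // ?invr_ge0 // invf_le1 // ler1n.
  apply: pow_fact_le; first by apply: mulr_ge0; [rewrite !mulr_ge0|rewrite -/c2 mulr_ge0].
  rewrite (_ : _ * _ = kap * N%:R); last by rewrite /kap /c2; ring.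
  apply: le_trans (_ : D%:R * N%:R <= _); first by rewrite ler_wpM2r.
  by rewrite -natrM ler_nat mulnC leq_trunc_div.
have L0 : (0 < L)%N by move: hL; clear; lia.
have V0 : (0 < L ^ d)%N by rewrite expn_gt0 L0.
have := current_bound_le m0 q0 g0 V0 L0 (leq_trans Nk kL) hx (erefl w1) (erefl c2) (erefl c1) (erefl c3); rewrite -/c4 => hb.
apply: le_trans (_ : c4 * L%:R ^+ 2 * (L ^ d)%:R ^+ 5 * 2^-1 ^+ N * L%:R ^+ K <= _).
  by rewrite ler_wpM2r // exprn_ge0.
have -> : c4 * L%:R ^+ 2 * (L ^ d)%:R ^+ 5 * 2^-1 ^+ N * L%:R ^+ K = c4 * ((L ^ p.+1)%:R * 2^-1 ^+ N).
  have -> : p.+1 = (2 + d * 5 + K)%N by rewrite /p; clear; lia.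
  rewrite !natrX -exprM !exprD.
  by move: (2^-1 ^+ N) => z; ring.
rewrite ler_wpM2l // exprVn ler_pdivrMr ?exprn_gt0 // -natrX -natrM ler_nat.
have hLN : (L <= c5 * N.+1)%N.
  have e1 : (k < D * N.+1)%N by rewrite mulnC ltn_ceil.
  have e2 : (L %/ 8 < r.+1 * k.+2)%N by rewrite mulnC /k -[(_ %/ _).-1.+1]/(_.-1.+1) prednK // ltn_ceil.
  have e3 : (L < 8 * (L %/ 8).+1)%N by rewrite mulnC ltn_ceil.
  by rewrite /c5; move: e1 e2 e3; clear; exact: chain_le.
apply: leq_trans (_ : (c5 * N.+1) ^ p.+1 <= _)%N; first by rewrite leq_exp2r.
by rewrite expnMn -mulnA leq_mul2l poly_le_exp orbT.
Qed.

End Decay.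

(** * Geometry of the torus *)

Local Close Scope ring_scope.

Section Torus.
Variables (d L : nat).
Local Notation site := {ffun 'I_d -> 'I_L}.

Lemma cdist_le_dist (x y : site) i : cdist (x i) (y i) <= dist x y.
Proof. by rewrite /dist (bigD1 i) //= leq_addr. Qed.

Lemma dist_diam (X : {set site}) x y : x \in X -> y \in X -> dist x y <= diam X.
Proof.
move=> xX yX; apply: leq_trans (leq_bigmax_cond (F := fun x => \max_(y in X) dist x y) x xX).
exact: (leq_bigmax_cond (F := fun y => dist x y) y yX).
Qed.

Lemma card_cdist_ball (a : 'I_L) r : #|[set b | cdist a b <= r]| <= 4 * r + 2.
Proof.
(* An interval around [a] and the wrapped parts at the two ends of the cycle. *)
pose s := iota (a - r) (2 * r + 1) ++ iota 0 r ++ iota (L - r) r.+1.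
have -> : 4 * r + 2 = size s by rewrite !size_cat !size_iota; lia.
rewrite cardE -(size_map val); apply: uniq_leq_size; first by rewrite map_inj_uniq ?enum_uniq //; apply: val_inj.
move=> c /mapP[b]; rewrite mem_enum inE /cdist => h ->; rewrite /s !mem_cat !mem_iota /=.
have := ltn_ord a; have := ltn_ord b; move: h; move: (nat_of_ord a) (nat_of_ord b) => x y; clear.
by case: ifP; lia.
Qed.

Definition ball r (x : site) := [set y | dist x y <= r].

Lemma card_ball r x : #|ball r x| <= (4 * r + 2) ^ d.
Proof.
pose F i := [set b | cdist (x i) b <= r].
have sub : ball r x \subset family (fun i => mem (F i)).
  apply/fintype.subsetP => y; rewrite inE => h; apply/familyP => i; rewrite inE.
  by apply: leq_trans (cdist_le_dist x y i) h.
apply: leq_trans (subset_leq_card sub) _; rewrite card_family.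
rewrite -[X in _ ^ X](size_enum_ord d) /image_mem; elim: (enum 'I_d) => //= i s IH.
by rewrite expnS leq_mul // card_cdist_ball.
Qed.

Variable r : nat.
Definition small (X : {set site}) := diam X <= r.

Lemma small_ball (X : {set site}) x : small X -> x \in X -> X \subset ball r x.
Proof. by move=> sX xX; apply/fintype.subsetP => y yX; rewrite inE; apply: leq_trans (dist_diam xX yX) sX. Qed.

Lemma small_card X : small X -> #|X| <= (4 * r + 2) ^ d.
Proof.
move=> sX; have [->|/set0Pn[x xX]] := eqVneq X finset.set0; first by rewrite cards0.
exact: leq_trans (subset_leq_card (small_ball sX xX)) (card_ball r x).
Qed.

Lemma small_mem (x : site) : #|[set X | small X && (x \in X)]| <= 2 ^ ((4 * r + 2) ^ d).
Proof.
apply: leq_trans (_ : #|powerset (ball r x)| <= _); last by rewrite card_powerset leq_exp2l // card_ball.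
by apply/subset_leq_card/fintype.subsetP => X; rewrite !inE => /andP[sX xX]; apply: small_ball.
Qed.

End Torus.

Section Signed.
Variables (d L : nat) (hd : 0 < d).
Local Notation site := {ffun 'I_d -> 'I_L}.

Lemma absx1_half (x : site) : ~~ odd L -> absx1 hd x <= L./2.
Proof. by rewrite /absx1; have := ltn_ord (x (Ordinal hd)); case: ifP; lia. Qed.

Lemma absx1_lip (x y : site) : absx1 hd x <= absx1 hd y + dist x y.
Proof.
apply: leq_trans (_ : absx1 hd y + cdist (x (Ordinal hd)) (y (Ordinal hd)) <= _); last first.
  by rewrite leq_add2l cdist_le_dist.
rewrite /absx1 /cdist; have := ltn_ord (x (Ordinal hd)); have := ltn_ord (y (Ordinal hd)).
by move: (nat_of_ord (x _)) (nat_of_ord (y _)) => a b; do 3!case: ifP; lia.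
Qed.

Lemma absx1_lip' (x y : site) : ~~ odd L -> L./2 - absx1 hd x <= L./2 - absx1 hd y + dist x y.
Proof.
move=> oL; apply: leq_trans (_ : L./2 - absx1 hd y + cdist (x (Ordinal hd)) (y (Ordinal hd)) <= _); last first.
  by rewrite leq_add2l cdist_le_dist.
rewrite /absx1 /cdist; have := ltn_ord (x (Ordinal hd)); have := ltn_ord (y (Ordinal hd)).
by move: (nat_of_ord (x _)) (nat_of_ord (y _)) oL => a b; do 3!case: ifP; lia.
Qed.

(** A path between the two halves of the cycle passes through one of the cuts, so it is at least as
    long as the two distances to that cut together. *)
Lemma absx1_cross (x y : site) : ~~ odd L -> x \in Gamma L hd -> y \notin Gamma L hd ->
  absx1 hd x + absx1 hd y <= dist x y \/ (L./2 - absx1 hd x) + (L./2 - absx1 hd y) <= dist x y.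
Proof.
rewrite !inE => oL hx hy.
have h : absx1 hd x + absx1 hd y <= cdist (x (Ordinal hd)) (y (Ordinal hd)) \/
   (L./2 - absx1 hd x) + (L./2 - absx1 hd y) <= cdist (x (Ordinal hd)) (y (Ordinal hd)).
  move: hx hy; rewrite /absx1 /cdist; have := ltn_ord (x (Ordinal hd)); have := ltn_ord (y (Ordinal hd)).
  by move: (nat_of_ord (x _)) (nat_of_ord (y _)) oL => a b; do 3!case: ifP; lia.
by have le := cdist_le_dist x y (Ordinal hd); case: h => h; [left|right]; apply: leq_trans le.
Qed.

(** Each point of [X] is compared with one on the other side of the boundary, hence lies within [r]
    of some cut. All choose the same cut: points near different cuts would be at least [L/2 - 2 r]
    apart, which exceeds [r]. *)
Lemma small_cross r (X : {set site}) x y : ~~ odd L -> 3 * r < L./2 -> small r X ->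
  x \in X -> x \in Gamma L hd -> y \in X -> y \notin Gamma L hd ->
  (forall z, z \in X -> absx1 hd z <= r) \/ (forall z, z \in X -> L./2 - absx1 hd z <= r).
Proof.
move=> oL hL sX xX xG yX yG.
have D u u' : u \in X -> u' \in X -> dist u u' <= r.
  by move=> uX u'X; apply: leq_trans (dist_diam uX u'X) sX.
have alt z : z \in X -> absx1 hd z <= r \/ L./2 - absx1 hd z <= r.
  move=> zX; have [zG|zG] := boolP (z \in Gamma L hd).
    by have := absx1_cross oL zG yG; have := D _ _ zX yX; lia.
  by have := absx1_cross oL xG zG; have := D _ _ xX zX; lia.
have [hx|hx] := alt x xX; [left|right] => z zX; have := alt z zX; have := D _ _ zX xX; have := D _ _ xX zX.
  by have := absx1_lip z x; have := absx1_half z oL; move: hL hx; clear; lia.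
by have := absx1_lip x z; have := absx1_half z oL; move: hL hx; clear; lia.
Qed.

End Signed.

Local Open Scope ring_scope.

(** * Operators as matrices *)

Section OpMatrix.
Local Notation C := (complex R).

Definition toC (z : Cplx) : C := Complex (Cre z) (Cim z).
Definition ofC (z : C) : Cplx := mkC (complex.Re z) (complex.Im z).

Lemma toCK : cancel toC ofC. Proof. by case. Qed.
Lemma ofCK : cancel ofC toC. Proof. by case. Qed.
Lemma toC_inj : injective toC. Proof. exact: can_inj toCK. Qed.
Lemma toCD a b : toC (Cadd a b) = toC a + toC b. Proof. by []. Qed.
Lemma toCM a b : toC (Cmul a b) = toC a * toC b. Proof. by []. Qed.
Lemma toC0 : toC C0 = 0. Proof. by []. Qed.
Lemma toC1 : toC C1 = 1. Proof. by []. Qed.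
Lemma toCN a : toC (Copp a) = - toC a. Proof. by []. Qed.
Lemma toC_conj a : toC (Cconj a) = Num.conj (toC a). Proof. by []. Qed.
Lemma toC_sum (I : Type) (r : seq I) (P : pred I) (F : I -> Cplx) :
  toC (\big[Cadd/C0]_(i <- r | P i) F i) = \sum_(i <- r | P i) toC (F i).
Proof. exact: (big_morph toC toCD toC0). Qed.

Variable B : finType.
Implicit Types (A : Op B) (v : Vec B).

Definition mxop A : 'M[C]_#|B| := \matrix_(i, j) toC (A (enum_val i) (enum_val j)).
Definition cvec v : 'cV[C]_#|B| := \col_i toC (v (enum_val i)).

Lemma sum_enum_val (F : B -> C) : \sum_(b : B) F b = \sum_(i < #|B|) F (enum_val i).
Proof. by rewrite (reindex (@enum_val B predT)) //; apply: onW_bij; apply: enum_val_bij. Qed.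

Lemma mxop_ext A A' : (forall b b', A b b' = A' b b') <-> mxop A = mxop A'.
Proof.
split=> [h|/matrixP h b b']; first by apply/matrixP=> i j; rewrite !mxE h.
by apply: toC_inj; have := h (enum_rank b) (enum_rank b'); rewrite !mxE !enum_rankK.
Qed.
Lemma mxop_mul A A' : mxop (opmul A A') = mxop A *m mxop A'.
Proof.
by apply/matrixP=> i j; rewrite !mxE toC_sum sum_enum_val; apply: eq_bigr => k _; rewrite !mxE.
Qed.
Lemma mxop_app A v : cvec (app A v) = mxop A *m cvec v.
Proof.
by apply/colP=> i; rewrite !mxE toC_sum sum_enum_val; apply: eq_bigr => k _; rewrite !mxE.
Qed.
Lemma mxop_add A A' : mxop (opadd A A') = mxop A + mxop A'.
Proof. by apply/matrixP=> i j; rewrite !mxE. Qed.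
Lemma mxop_scale a A : mxop (opscale a A) = toC a *: mxop A.
Proof. by apply/matrixP=> i j; rewrite !mxE. Qed.
Lemma mxop_comm A A' : mxop (comm A A') = cmt (mxop A) (mxop A').
Proof.
rewrite /comm /opsub mxop_add mxop_scale !mxop_mul cmtE; congr (_ + _).
by rewrite toCN scaleN1r.
Qed.
Lemma mxop_zero : mxop (@opzero B) = 0.
Proof. by apply/matrixP=> i j; rewrite !mxE. Qed.
Lemma mxop_id : mxop (@opid B) = 1%:M.
Proof. by apply/matrixP=> i j; rewrite !mxE /opid (inj_eq enum_val_inj); case: eqP. Qed.
Lemma mxop_adj A : mxop (adj A) = (mxop A)^H.
Proof. by apply/matrixP=> i j; rewrite !mxE. Qed.
Lemma mxop_herm A : selfadj A -> (mxop A)^H = mxop A.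
Proof. by move=> h; rewrite -mxop_adj; apply/esym/mxop_ext. Qed.
Lemma mxop_sum (I : finType) (P : pred I) (F : I -> Op B) :
  mxop (opsum P F) = \sum_(i | P i) mxop (F i).
Proof.
by apply/matrixP=> i j; rewrite mxE toC_sum summxE; apply: eq_bigr => k _; rewrite mxE.
Qed.

Lemma cvec_surj (w : 'cV[C]_#|B|) : cvec (fun b => ofC (w (enum_rank b) 0)) = w.
Proof. by apply/colP=> i; rewrite !mxE enum_valK ofCK. Qed.
Lemma cvec_ext v v' : (forall b, v b = v' b) <-> cvec v = cvec v'.
Proof.
split=> [h|/colP h b]; first by apply/colP=> i; rewrite !mxE h.
by apply: toC_inj; have := h (enum_rank b); rewrite !mxE !enum_rankK.
Qed.

Lemma toC_inner v v' : toC (inner v v') = ((cvec v)^H *m cvec v') 0 0.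
Proof. by rewrite toC_sum sum_enum_val mxE; apply: eq_bigr => i _; rewrite !mxE. Qed.
Lemma norm2E v : norm2 v = nrm (cvec v) ^+ 2.
Proof. by rewrite nrm_sqr /ip -toC_inner. Qed.

Lemma mxop_bnd A (m : R) : 0 <= m -> opnorm_le A m -> bnd (mxop A) m.
Proof.
move=> m0 h; split=> w; rewrite -(cvec_surj w) -mxop_app.
have /RleP := h (fun b => ofC (w (enum_rank b) 0)); rewrite !norm2E => le.
rewrite -(ler_pXn2r (_ : 0 < 2)%N) ?nnegrE ?mulr_ge0 ?nrm_ge0 //.
by rewrite exprMn; move: le; rewrite RmultE RpowE.
Qed.

Lemma spectral_eigenvalue A j : (mxop A)^H = mxop A ->
  eigenvalue A (ofC (spectral_diag (mxop A) 0 j)).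
Proof.
move=> hA; have [e nz] := spectral_eigen j hA.
set w := col j _ in e nz; exists (fun b => ofC (w (enum_rank b) 0)); split.
  have /cV0Pn[i hi] : w != 0 by [].
  exists (enum_val i); rewrite enum_valK => /(congr1 toC); rewrite ofCK toC0 => /eqP.
  by rewrite (negPf hi).
move=> b; apply: toC_inj; rewrite toCM !ofCK.
have /colP/(_ (enum_rank b)) := mxop_app A (fun b => ofC (w (enum_rank b) 0)).
by rewrite cvec_surj e !mxE enum_rankK.
Qed.

End OpMatrix.

(** * Locality of spins and fermions *)

Section SpinLocality.
Local Notation C := (complex R).
Variables (d L n : nat).
Local Notation site := {ffun 'I_d -> 'I_L}.

Lemma srest_eqP (X : {set site}) (b b' : sconf d L n) :
  reflect (forall y, y \in X -> b y = b' y) (srest X b == srest X b').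
Proof.
apply: (iffP eqP) => [/ffunP h y yX|h]; first by have := h y; rewrite !ffunE yX => -[].
by apply/ffunP=> y; rewrite !ffunE; case: ifP => // yX; rewrite h.
Qed.

(** Only one intermediate configuration contributes, equal to [b''] on [X] and to [b] elsewhere. The
    resulting kernel is symmetric in the two factors, which gives commutation. *)
Lemma spin_local_mul (X Y : {set site}) (A A' : Op (sconf d L n)) OX OY :
  [disjoint X & Y] ->
  (forall b b', A b b' = if srest (~: X) b == srest (~: X) b' then OX (srest X b) (srest X b') else C0) ->
  (forall b b', A' b b' = if srest (~: Y) b == srest (~: Y) b' then OY (srest Y b) (srest Y b') else C0) ->
  forall b b'', toC (opmul A A' b b'') =
    if srest (~: (X :|: Y)) b == srest (~: (X :|: Y)) b''
    then toC (OX (srest X b) (srest X b'')) * toC (OY (srest Y b) (srest Y b'')) else 0.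
Proof.
move=> dXY hA hA' b b''.
have XY y : y \in Y -> y \in X = false by move=> yY; rewrite disjoint_sym in dXY; exact: disjointFr dXY yY.
pose c : sconf d L n := [ffun y => if y \in X then b'' y else b y].
rewrite toC_sum (bigD1 c) //= big1 => [|c' cc']; last first.
  rewrite toCM hA hA'; case: srest_eqP => [h1|_]; last by rewrite toC0 mul0r.
  case: srest_eqP => [h2|_]; last by rewrite toC0 mulr0.
  case/eqP: cc'; apply/ffunP=> y; rewrite ffunE; case: ifP => yX.
    by apply: h2; rewrite inE (disjointFr dXY yX).
  by rewrite h1 // inE yX.
rewrite addr0 toCM hA hA'.
have -> : srest (~: X) b == srest (~: X) c.
  by apply/srest_eqP => y; rewrite inE ffunE => /negPf ->.
have -> : srest X c = srest X b'' by apply/eqP/srest_eqP => y yX; rewrite ffunE yX.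
have -> : srest Y c = srest Y b by apply/eqP/srest_eqP => y yY; rewrite ffunE XY.
have -> : (srest (~: Y) c == srest (~: Y) b'') = (srest (~: (X :|: Y)) b == srest (~: (X :|: Y)) b'').
  apply/srest_eqP/srest_eqP => h y; rewrite !inE.
    by rewrite negb_or => /andP[yX yY]; have := h y; rewrite inE ffunE (negPf yX) => ->.
  move=> yY; rewrite ffunE; case: ifP => // yX; apply: h; by rewrite !inE yX.
by case: ifP => //; rewrite toC0 mulr0.
Qed.

Lemma spin_local_comm (X Y : {set site}) (A A' : Op (sconf d L n)) : [disjoint X & Y] ->
  spin_local X A -> spin_local Y A' -> comm_mx (mxop A) (mxop A').
Proof.
move=> dXY [OX hA] [OY hA']; rewrite /comm_mx -!mxop_mul; apply/mxop_ext => b b''; apply: toC_inj.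
rewrite (spin_local_mul dXY hA hA'); rewrite disjoint_sym in dXY.
by rewrite (spin_local_mul dXY hA' hA) finset.setUC mulrC.
Qed.

End SpinLocality.

Section FermionLocality.
Local Notation C := (complex R).
Variables (d L n : nat).
Local Notation site := {ffun 'I_d -> 'I_L}.
Local Notation mode := (site * 'I_n)%type.
Local Notation conf := (fconf d L n).

(* [ladder true j] and [ladder false j] are the annihilation and creation operators; the
   unified form makes all the anticommutation relations a single computation. *)
Definition ladder (t : bool) (j : mode) : Op conf :=
  fun b b' => if (b' j == t) && (b == fflip b' j) then fsign b' j else C0.

Lemma fflipK j : involutive (fun b : conf => fflip b j).
Proof. by move=> b; apply/ffunP=> k; rewrite !ffunE; case: eqP => // _; rewrite negbK. Qed.
Lemma fflipE (b : conf) j : fflip b j j = ~~ b j.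
Proof. by rewrite ffunE eqxx. Qed.
Lemma fflip_neq (b : conf) j k : k != j -> fflip b j k = b k.
Proof. by rewrite ffunE => /negPf ->. Qed.
Lemma fflipC (b : conf) j k : fflip (fflip b j) k = fflip (fflip b k) j.
Proof. by apply/ffunP=> i; rewrite !ffunE; do 2!case: eqP. Qed.

Lemma odd_card_flip (A A' : {set mode}) k : (forall i, i != k -> (i \in A) = (i \in A')) ->
  odd #|A| = (k \in A) (+) (k \in A') (+) odd #|A'|.
Proof.
move=> h; rewrite (cardsD1 k A) (cardsD1 k A').
have -> : A :\ k = A' :\ k by apply/setP=> i; rewrite !inE; case: eqP => //= /eqP; apply: h.
by rewrite !oddD !oddb; case: (k \in A); case: (k \in A') => /=; case: (odd _).
Qed.

Lemma toC_fsign (b : conf) j :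
  toC (fsign b j) = (-1) ^+ odd #|[set j' | (enum_rank j' < enum_rank j)%N && b j']|.
Proof. by rewrite /fsign; case: ifP => _; rewrite ?expr1 ?expr0. Qed.

Lemma fsign_flip (b : conf) j k :
  toC (fsign (fflip b k) j) = (-1) ^+ (enum_rank k < enum_rank j)%N * toC (fsign b j).
Proof.
rewrite !toC_fsign -signr_addb; congr (_ ^+ _); congr nat_of_bool.
rewrite (odd_card_flip (A' := [set j' | (enum_rank j' < enum_rank j)%N && b j']) (k := k)).
  by rewrite !inE fflipE; case: (_ < _)%N => //=; case: (b k).
by move=> i ik; rewrite !inE fflip_neq.
Qed.

Lemma annihE j : mxop (annih j) = mxop (ladder true j).
Proof. by apply/mxop_ext => b b'; rewrite /annih /ladder; case: (b' j). Qed.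

Lemma adj_annihE j : mxop (adj (annih j)) = mxop (ladder false j).
Proof.
apply/mxop_ext => b b'; apply: toC_inj; rewrite /adj toC_conj /annih /ladder.
have -> : b j && (b' == fflip b j) = (b' j == false) && (b == fflip b' j).
  apply/andP/andP => -[h /eqP e]; split.
  - by rewrite e fflipE h.
  - by rewrite e fflipK.
  - by rewrite e fflipE (eqP h).
  - by rewrite e fflipK.
case: ifP => [/andP[_ /eqP ->]|_]; last by rewrite toC0 rmorph0.
by rewrite fsign_flip ltnn mul1r toC_fsign rmorph_sign.
Qed.

Lemma ladder_mul t t' (j k : mode) b b'' : toC (opmul (ladder t j) (ladder t' k) b b'') =
  if [&& b'' k == t', fflip b'' k j == t & b == fflip (fflip b'' k) j]
  then toC (fsign (fflip b'' k) j) * toC (fsign b'' k) else 0.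
Proof.
rewrite toC_sum (bigD1 (fflip b'' k)) //= big1 => [|c hc]; last first.
  by rewrite toCM /ladder (negPf hc) andbF toC0 mulr0.
rewrite addr0 toCM /ladder eqxx andbT.
by case: (b'' k == t') => /=; rewrite ?toC0 ?mulr0 //; case: ifP => _ //; rewrite toC0 mul0r.
Qed.

(** Both orders flip the same two modes under the same conditions. Exactly one of the modes precedes
    the other, so the Jordan-Wigner signs of the two orders are opposite. *)
Lemma ladder_anticomm t t' (j k : mode) : j != k ->
  mxop (ladder t j) *m mxop (ladder t' k) = - (mxop (ladder t' k) *m mxop (ladder t j)).
Proof.
move=> jk; rewrite -!mxop_mul -scaleN1r -[-1]/(toC (Copp C1)) -mxop_scale; apply/mxop_ext => b b''.
apply: toC_inj; rewrite ladder_mul [RHS]toCM ladder_mul toCN toC1.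
have kj : k != j by rewrite eq_sym.
rewrite (fflip_neq b'' jk) (fflip_neq b'' kj) (fflipC b'' k j).
have -> : [&& b'' k == t', b'' j == t & b == fflip (fflip b'' j) k] = [&& b'' j == t, b'' k == t' & b == fflip (fflip b'' j) k].
  by rewrite !andbA (andbC (b'' k == _)).
case: ifP => _; last by rewrite mulr0.
rewrite !fsign_flip.
have rk : enum_rank j != enum_rank k :> nat.
  by apply: contra_neq jk => /val_inj/enum_rank_inj.
have -> : (enum_rank k < enum_rank j)%N = ~~ (enum_rank j < enum_rank k)%N.
  by move: rk; case: ltngtP.
rewrite signrN; move: (_ ^+ _) (toC (fsign b'' j)) (toC (fsign b'' k)) => x y z; ring.
Qed.

Let Pi := mxop (@parity d L n).

Lemma parityE i j : Pi i j = if i == j then (-1) ^+ odd #|[set k | (enum_val i : conf) k]| else 0.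
Proof.
by rewrite mxE /parity (inj_eq enum_val_inj); case: eqP => // _; case: ifP => _; rewrite ?expr1 ?expr0.
Qed.

Lemma parity_diag : Pi = diag_mx (\row_i (-1) ^+ odd #|[set k | (enum_val i : conf) k]|).
Proof. by apply/matrixP=> i j; rewrite parityE !mxE; case: eqP => [->|]. Qed.

Lemma parity2 : Pi *m Pi = 1%:M.
Proof.
rewrite parity_diag mulmx_diag; apply/matrixP=> i j; rewrite !mxE.
by case: eqP => // _; rewrite -signr_addb addbb.
Qed.

Lemma parity_ladder t j : Pi *m mxop (ladder t j) *m Pi = - mxop (ladder t j).
Proof.
rewrite parity_diag; apply/matrixP=> i k; rewrite mul_mx_diag mul_diag_mx !mxE /ladder.
case: ifP => [/andP[_ /eqP e]|_]; last by rewrite toC0 mulr0 mul0r oppr0.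
rewrite mulrAC -signr_addb e.
rewrite (odd_card_flip (A := [set k0 | _]) (A' := [set k0 | (enum_val k : conf) k0]) (k := j)); last first.
  by move=> i' hi; rewrite !inE fflip_neq.
by rewrite !inE fflipE -addbA addbb addbF; case: ((enum_val k : conf) j); rewrite /= mulN1r.
Qed.

Lemma twist_mul N (p c a a' : 'M[C]_N) : p *m p = 1%:M ->
  c *m a = (p *m a *m p) *m c -> c *m a' = (p *m a' *m p) *m c ->
  c *m (a *m a') = (p *m (a *m a') *m p) *m c.
Proof.
move=> hp h1 h2; rewrite mulmxA h1 -(mulmxA _ c a') h2 !mulmxA.
by rewrite -(mulmxA (p *m a) p p) hp mulmx1.
Qed.

(** The generators are odd, so plain commutation cannot be carried through an induction on [fgen].
    The relation twisted by parity can, since conjugation by parity is multiplicative, and for even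
    [A] it becomes commutation. *)
Lemma ladder_fgen t (j : mode) (X : {set site}) (A : Op conf) : fgen X A -> j.1 \notin X ->
  mxop (ladder t j) *m mxop A = (Pi *m mxop A *m Pi) *m mxop (ladder t j).
Proof.
move=> fA jX.
have jk (k : mode) : k.1 \in X -> j != k by move=> kX; apply: contraNneq jX => ->.
elim: fA => {A} [k kX|k kX||A A' _ IH _ IH'|A A' _ IH _ IH'|a A _ IH].
- by rewrite annihE parity_ladder mulNmx ladder_anticomm ?jk.
- by rewrite adj_annihE parity_ladder mulNmx ladder_anticomm ?jk.
- by rewrite mxop_id mulmx1 mulmx1 parity2 mul1mx.
- by rewrite mxop_add !mulmxDr !mulmxDl IH IH'.
- rewrite mxop_mul; exact: twist_mul parity2 IH IH'.
- by rewrite mxop_scale -!scalemxAr -!scalemxAl IH.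
Qed.

Lemma ferm_local_comm (X Y : {set site}) (A A' : Op conf) : [disjoint X & Y] ->
  ferm_local X A -> ferm_local Y A' -> comm_mx (mxop A) (mxop A').
Proof.
move=> dXY [fA pA] [fA' _].
have eA : Pi *m mxop A *m Pi = mxop A by rewrite -mulmxA -!mxop_mul; apply/mxop_ext.
have cl t (j : mode) : j.1 \in Y -> comm_mx (mxop A) (mxop (ladder t j)).
  move=> jY; apply: comm_mx_sym; rewrite /comm_mx (ladder_fgen t fA) ?eA //.
  by rewrite disjoint_sym in dXY; rewrite (disjointFr dXY jY).
elim: fA' => {A'} [k kY|k kY||B B' _ IH _ IH'|B B' _ IH _ IH'|a B _ IH].
- by rewrite annihE; apply: cl.
- by rewrite adj_annihE; apply: cl.
- by rewrite mxop_id; apply: comm_mx1.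
- by rewrite mxop_add; apply: comm_mxD.
- by rewrite mxop_mul; apply: comm_mxM.
- by rewrite mxop_scale; apply: comm_mxZ.
Qed.

End FermionLocality.

Lemma local_comm (f : bool) d L n (X Y : {set site d L}) (A A' : Op (Conf f d L n)) :
  [disjoint X & Y] -> local X A -> local Y A' -> comm_mx (mxop A) (mxop A').
Proof. by case: f A A' => A A'; [apply: ferm_local_comm|apply: spin_local_comm]. Qed.

(** * The decay of the current *)

Lemma IZR_nat (z : Z) : exists k : nat, IZR z = k%:R \/ IZR z = - k%:R.
Proof.
exists (Z.abs_nat z); rewrite -INRE; have [h|h] := Z.le_ge_cases 0 z.
  by left; rewrite INR_IZR_INZ Nat2Z.inj_abs_nat Z.abs_eq.
by right; rewrite INR_IZR_INZ Nat2Z.inj_abs_nat Z.abs_neq // opp_IZR RoppE opprK.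
Qed.

Lemma Cmod_real (a : Cplx) : Cim a = 0 -> Cmod a = `|Cre a|.
Proof.
by move=> e; rewrite /Cmod RsqrtE RplusE !RpowE e expr0n addr0 sqrtr_sqr.
Qed.

Lemma current_le (f : bool) (d L n : nat) (hd : (0 < d)%N) (Rr m g q : R)
  (Phi : {set site d L} -> Op (Conf f d L n)) (Qx : site d L -> Op (Conf f d L n))
  (Omega : Vec (Conf f d L n)) (r k N : nat) :
  0 < m -> 0 < g -> 0 < q -> ~~ odd L -> (forall j, (INR j <= Rr) = (j <= r)%N) ->
  (16 * r.+1 <= L)%N -> (r.+1 * k.+1 <= L %/ 8)%N ->
  (forall X : {set site d L},
     [/\ selfadj (Phi X), local X (Phi X),
         (Rr < INR (diam X))%coqR -> forall b b', Phi X b b' = C0,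
         opnorm_le (Phi X) m &
         forall Y : {set site d L}, X \subset Y ->
           forall b b', comm (Phi X) (chargeY Qx Y) b b' = C0]) ->
  (forall x : site d L,
     [/\ selfadj (Qx x), local [set x] (Qx x),
         (forall l, eigenvalue (Qx x) l -> exists z : Z, l = RtoC (IZR z)) &
         opnorm_le (Qx x) q]) ->
  (forall b, app (hamiltonian Phi) Omega b = C0) -> norm2 Omega = 1 ->
  (forall v : Vec (Conf f d L n), (forall b, app (hamiltonian Phi) v b = C0) ->
     exists a : Cplx, forall b, v b = Cmul a (Omega b)) ->
  (forall l, eigenvalue (hamiltonian Phi) l -> l = C0 \/ (Cim l = 0 /\ g <= Cre l)%coqR) ->
  Cmod (inner Omega (app (Jminus hd Rr Phi Qx) Omega)) <=
    current_bound m q g (L ^ d) ((4 * r + 2) ^ d) (2 ^ ((4 * r + 2) ^ d)) k N.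
Proof.
move=> m0 g0 q0 oL rP hL hk hPhi hQ hOm nOm hker hgap.
pose P X := mxop (Phi X); pose Qm x := mxop (Qx x); pose Om := cvec Omega.
have P_herm X : (P X)^H = P X by apply: mxop_herm; case: (hPhi X).
have Q_herm x : (Qm x)^H = Qm x by apply: mxop_herm; case: (hQ x).
have PP (X Y : {set site d L}) : [disjoint X & Y] -> comm_mx (P X) (P Y).
  by move=> dXY; apply: local_comm dXY _ _; [case: (hPhi X)|case: (hPhi Y)].
have PQ (X : {set site d L}) x : x \notin X -> comm_mx (P X) (Qm x).
  move=> xX; apply: (@local_comm _ _ _ _ X [set x]); [|by case: (hPhi X)|by case: (hQ x)].
  by rewrite disjoint_sym disjoints1.
have QQ x y : x != y -> comm_mx (Qm x) (Qm y).
  move=> xy; apply: (@local_comm _ _ _ _ [set x] [set y]); [|by case: (hQ x)|by case: (hQ y)].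
  by rewrite disjoints1 inE.
have P_bnd X : bnd (P X) m by apply: mxop_bnd (ltW m0) _; case: (hPhi X).
have Q_bnd x : bnd (Qm x) q by apply: mxop_bnd (ltW q0) _; case: (hQ x).
have Q_int x : flow (Qm x) (2 * trigo.pi) = 1%:M.
  apply: flow_int => // j; have [_ _ hz _] := hQ x.
  have [z hl] := hz _ (spectral_eigenvalue j (Q_herm x)).
  move/(congr1 toC): hl; rewrite ofCK => ->; have [k' [e|e]] := IZR_nat z; exists k'.
    left; rewrite /RtoC e. by apply: complex_eqP; rewrite -(rmorph_nat (real_complex R)).
  right; rewrite /RtoC e. by apply: complex_eqP; rewrite -(rmorph_nat (real_complex R)) -rmorphN.
have QE Y : mxop (chargeY Qx Y) = QS Qm Y by rewrite mxop_sum.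
have charge (X Y : {set site d L}) : X \subset Y -> comm_mx (P X) (QS Qm Y).
  move=> XY; apply/cmt0P; rewrite -QE -mxop_comm -(mxop_zero (Conf f d L n)).
  by apply/mxop_ext => b b'; have [_ _ _ _ ->] := hPhi X.
have not_small (X : {set site d L}) : ~~ small r X -> P X = 0.
  rewrite /small -ltnNge => hX; rewrite -(mxop_zero (Conf f d L n)); apply/mxop_ext => b b'.
  by have [_ _ -> //] := hPhi X; apply/RltP; rewrite ltNge rP -ltnNge.
have HE : mxop (hamiltonian (Phi)) = \sum_X P X by rewrite mxop_sum.
have HOm : (\sum_X P X) *m Om = 0.
  rewrite -HE -mxop_app (_ : 0 = cvec (fun _ : Conf f d L n => C0)); last by apply/colP=> i; rewrite !mxE.
  exact/cvec_ext.
have Om1 : Om^H *m Om = 1%:M.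
  rewrite [LHS]herm1; last by rewrite adjmxM adjmxK.
  by rewrite -/(ip Om Om) -nrm_sqr -norm2E nOm scale1r.
have ker (u : 'cV_#|Conf f d L n|) : (\sum_X P X) *m u = 0 -> exists a, u = a *: Om.
  rewrite -(cvec_surj u) -HE -mxop_app; set vv := (X in app _ X) => e.
  have [|a ha] := hker vv.
    apply/cvec_ext; rewrite e; by apply/colP=> i; rewrite !mxE.
  exists (toC a); transitivity (cvec (fun b => Cmul a (Omega b))); first exact/cvec_ext.
  by apply/colP=> i; rewrite !mxE.
have gap j : spectral_diag (\sum_X P X) 0 j = 0 \/ g <= complex.Re (spectral_diag (\sum_X P X) 0 j).
  have hH : (mxop (hamiltonian (Phi)))^H = mxop (hamiltonian (Phi)).
    by rewrite HE adjmx_sum; apply: eq_bigr.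
  rewrite -HE; have [e|[_ /RleP]] := hgap _ (spectral_eigenvalue j hH); last by right.
  by left; move/(congr1 toC): e; rewrite ofCK.
pose M := (L %/ 8)%N.
have rho_sum (x : site d L) : (absx1 hd x + (L./2 - absx1 hd x) = L./2)%N by rewrite subnKC // absx1_half.
have rho1_small (X : {set site d L}) x y : small r X -> x \in X -> y \in X -> (absx1 hd x <= absx1 hd y + r)%N.
  move=> sX xX yX; apply: leq_trans (absx1_lip hd x y) _.
  by rewrite leq_add2l (leq_trans (dist_diam xX yX)).
have rho2_small (X : {set site d L}) x y : small r X -> x \in X -> y \in X ->
    (L./2 - absx1 hd x <= L./2 - absx1 hd y + r)%N.
  move=> sX xX yX; apply: leq_trans (absx1_lip' hd x y oL) _.
  by rewrite leq_add2l (leq_trans (dist_diam xX yX)).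
have r3 : (3 * r < L./2)%N by move: hL; clear; lia.
have Mh : (M + r + (M + r) < L./2)%N by rewrite /M; move: hL; clear; lia.
have rM : (r <= M)%N by rewrite /M; move: hL; clear; lia.
have cross (X : {set site d L}) x y := @small_cross d L hd r X x y oL r3.
have St (x : site d L) : (x \in stripm L hd Rr) = (absx1 hd x <= r)%N.
  by rewrite inE -rP; case: Rle_dec => /= /RleP; [move=> ->|move/negbTE=> ->].
have := two_sided PP PQ QQ P_herm Q_herm (ltW m0) (ltW q0) g0 P_bnd Q_bnd Q_int charge
  (@small_card d L r) (@small_mem d L r) not_small rho_sum rho1_small rho2_small cross Mh rM
  HOm Om1 ker gap N hk.
have e := current_strip PQ charge not_small rho_sum rho1_small cross Mh rM St.
set J := 'i%C *: cmt _ _ in e *; move=> hJ.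
have EJ : mxop (Jminus hd Rr (Phi) Qx) = J.
  rewrite -e /Jminus mxop_scale mxop_sum; congr (_ *: _); apply: eq_bigr => X _.
  by rewrite mxop_comm QE.
(* Makes the expectation real, so that its modulus is the absolute value bounded by [two_sided]. *)
have J_herm : J^H = J.
  rewrite /J adjmxZ cmt_adj HS_herm // QS_herm // scalerN -scaleNr; congr (_ *: _).
  by apply: complex_eqP; rewrite /= ?oppr0 ?opprK.
have Ein : toC (inner Omega (app (Jminus hd Rr (Phi) Qx) Omega)) = (Om^H *m (J *m Om)) 0 0.
  by rewrite toC_inner mxop_app EJ.
have Im0 : Cim (inner Omega (app (Jminus hd Rr (Phi) Qx) Omega)) = 0.
  transitivity (complex.Im ((Om^H *m (J *m Om)) 0 0)); first by rewrite -Ein.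
  apply: herm1_Im.
  by rewrite !adjmxM adjmxK J_herm mulmxA.
have Re_ip : Cre (inner Omega (app (Jminus hd Rr (Phi) Qx) Omega)) = ip Om (J *m Om).
  by rewrite /ip -Ein.
rewrite Cmod_real // Re_ip; apply: le_trans hJ _.
by rewrite card_ffun !card_ord.
Qed.

Local Close Scope ring_scope.

Theorem theorem3p2
  (fermionic : bool) (d n : nat) (hd : 0 < d) (Rr m g q : R)
  (Phi : forall L : nat, {set site d L} -> Op (Conf fermionic d L n))
  (Qx : forall L : nat, site d L -> Op (Conf fermionic d L n))
  (Omega : forall L : nat, Vec (Conf fermionic d L n)) :
  (0 < Rr)%coqR -> (0 < m)%coqR -> (0 < g)%coqR -> (0 < q)%coqR ->
  (forall L : nat, ~~ odd L -> 0 < L ->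
     (* interaction *)
     (forall X : {set site d L},
        [/\ selfadj (Phi L X),
            local X (Phi L X),
            (Rr < INR (diam X))%coqR -> forall b b', Phi L X b b' = C0,
            opnorm_le (Phi L X) m &
            forall Y : {set site d L}, X \subset Y ->
              forall b b', comm (Phi L X) (chargeY (Qx L) Y) b b' = C0]) /\
     (* charges *)
     (forall x : site d L,
        [/\ selfadj (Qx L x),
            local [set x] (Qx L x),
            (forall l, eigenvalue (Qx L x) l -> exists z : Z, l = RtoC (IZR z)) &
            opnorm_le (Qx L x) q]) /\
     (* non-degenerate eigenvalue 0 with unit eigenvector Omega, gap g *)
     (forall b, app (hamiltonian (Phi L)) (Omega L) b = C0) /\
     norm2 (Omega L) = 1%coqR /\
     (forall v : Vec (Conf fermionic d L n),
        (forall b, app (hamiltonian (Phi L)) v b = C0) ->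
        exists a : Cplx, forall b, v b = Cmul a (Omega L b)) /\
     (forall l, eigenvalue (hamiltonian (Phi L)) l ->
        l = C0 \/ (Cim l = 0 /\ g <= Cre l)%coqR)) ->
  forall k : nat, exists Ck : R, forall L : nat, ~~ odd L -> 0 < L ->
    (Cmod (inner (Omega L) (app (Jminus hd Rr (Phi L) (Qx L)) (Omega L)))
       <= Ck / INR L ^ k)%coqR.
Proof.
move=> /RltP Rr0 /RltP m0 /RltP g0 /RltP q0 hyp K.
pose f L := Cmod (inner (Omega L) (app (Jminus hd Rr (Phi L) (Qx L)) (Omega L))).
(* Graph distances are integers, so the real range acts only through its integer part. *)
pose r := Num.truncn Rr.
have rP k : (INR k <= Rr)%R = (k <= r) by rewrite INRE truncn_ge_nat // ltW.
have [Cst hC] := current_bound_decay d ((4 * r + 2) ^ d) (2 ^ ((4 * r + 2) ^ d)) r K (ltW m0) (ltW q0) g0.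
have big L : ~~ odd L -> 16 * r.+1 <= L -> (f L * L%:R ^+ K <= Cst)%R.
  move=> oL hL; have [hPhi [hQ [hOm [nOm [hker hgap]]]]] := hyp L oL (leq_trans (isT : 0 < 16 * r.+1) hL).
  have [k [N [hk hb]]] := hC L hL; apply: le_trans hb; apply: ler_wpM2r; first by rewrite exprn_ge0.
  exact: (current_le hd N m0 g0 q0 oL rP hL hk hPhi hQ hOm nOm hker hgap).
(* The finitely many sizes below [16 * r.+1], which the estimate does not reach, are absorbed by
   adding their own values to the constant. *)
exists (`|Cst| + \sum_(i < 16 * r.+1) f i * i%:R ^+ K)%R => L oL L0.
have L0' : (0 < L%:R :> R)%R by rewrite ltr0n.
apply/RleP; rewrite RdivE RpowE INRE ler_pdivlMr ?exprn_gt0 //.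
have f0 i : (0 <= f i * i%:R ^+ K)%R by rewrite mulr_ge0 ?exprn_ge0 //; apply/RleP/sqrt_pos.
have [h|h] := leqP (16 * r.+1) L.
  by apply: le_trans (big L oL h) _; apply: le_trans (ler_norm _) _; rewrite lerDl sumr_ge0.
rewrite -[X in (X <= _)%R]add0r; apply: lerD => //.
by rewrite (bigD1 (Ordinal h)) //= lerDl sumr_ge0.
Qed.
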